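(* Let $$\Lambda:=\Big\{\lambda\in\sigma\big(\widetilde{\Delta}_{\textup{sub}}^{T}\big):\ \exists\,\phi\in\ker\big(\widetilde{\Delta}_{\textup{sub}}^{T}-\lambda\big)\text{ such that }\phi(\mathrm{np})\neq0\Big\},$$ where $\mathrm{np}=(1,0,\dots,0)\in\mathbb{S}^7\subset\mathbb{R}^8$. Then the following inclusion of spectra (as sets) holds: $$\Lambda=\sigma\big(\Delta_{\textup{sub}}^{Q}\big)\subset\sigma\big(\widetilde{\Delta}_{\textup{sub}}^{T}\big).$$
   Context: Let $\mathbb{S}^7\subset\mathbb{R}^4\times\mathbb{R}^4\cong\mathbb{H}^2$ be the unit sphere with points $z=(x,y)$, the standard metric and the standard volume $\sigma$. $\sigma(A)$ denotes the spectrum of an operator $A$. $\widetilde{\Delta}_{\textup{sub}}^{T}=-\sum_{i=1}^4X_i^2$ is the sublaplacian of the trivializable structure with respect to the standard volume, where $X_l(z)=A_lz$ and $$A_1(x,y)=(y{\bf k},x{\bf k}),\quad A_2(x,y)=(y{\bf j},x{\bf j}),\quad A_3(x,y)=(-y{\bf i},-x{\bf i}),\quad A_4(x,y)=(y,-x).$$ It is a subelliptic, positive operator on $L^2(\mathbb{S}^7,\sigma)$ with discrete spectrum consisting of eigenvalues (with smooth eigenfunctions). $\Delta_{\textup{sub}}^{Q}$ is the (intrinsic) sublaplacian induced by the quaternionic Hopf fibration: with $V_{\bf i}(q)=q{\bf i}$, $V_{\bf j}(q)=q{\bf j}$, $V_{\bf k}(q)=q{\bf k}$ and $\mathcal{H}_Q$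 the orthogonal complement of $\mathrm{Span}\{V_{\bf i},V_{\bf j},V_{\bf k}\}$ in $T\mathbb{S}^7$ with the restricted metric, $\Delta_{\textup{sub}}^{Q}f=-\mathrm{div}_\sigma(\nabla_{\mathcal{H}_Q}f)$, equivalently $\Delta_{\textup{sub}}^{Q}=\Delta_{\mathbb{S}^7}+V_{\bf i}^2+V_{\bf j}^2+V_{\bf k}^2$ with $\Delta_{\mathbb{S}^7}\ge0$ the Laplace-Beltrami operator. (The Popp measure of $\mathcal{H}_Q$ is a constant multiple of $\sigma$.) *)

(* Defs.v *)
From HB Require Import structures.
From mathcomp Require Import all_boot all_order all_algebra.
From mathcomp Require Import all_classical all_reals all_analysis.
From mathcomp Require Import measurable_realfun.
From mathcomp Require Import ring.

Set Implicit Arguments.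
Unset Strict Implicit.
Unset Printing Implicit Defensive.
Import Order.TTheory GRing.Theory Num.Theory.
Import numFieldNormedType.Exports.
Local Open Scope classical_set_scope.
Local Open Scope ring_scope.

(** The quaternion a + b i + c j + d k is the quadruple (a, b, c, d). *)
Notation quat R := (R * R * R * R)%type.
Notation H2 R := (quat R * quat R)%type.

Section Geometry.
Context {R : realType}.
Local Notation H := (quat R).
Local Notation HH := (H2 R).

Definition qmul (p q : H) : H :=
  let: (a, b, c, d) := p in
  let: (a', b', c', d') := q in
  (a * a' - b * b' - c * c' - d * d',
   a * b' + b * a' + c * d' - d * c',
   a * c' - b * d' + c * a' + d * b',
   a * d' + b * c' - c * b' + d * a').

Definition q1 : H := (1, 0, 0, 0).
Definition qi : H := (0, 1, 0, 0).
Definition qj : H := (0, 0, 1, 0).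
Definition qk : H := (0, 0, 0, 1).

Definition qdot (p q : H) : R :=
  let: (a, b, c, d) := p in
  let: (a', b', c', d') := q in a * a' + b * b' + c * c' + d * d'.

Definition dot (z w : HH) : R := qdot z.1 w.1 + qdot z.2 w.2.

Lemma dot_ge0 (z : HH) : 0 <= dot z z.
Proof.
case: z => [[[[a b] c] d] [[[e f] g] h]]; rewrite /dot /qdot /=.
by rewrite !addr_ge0// -expr2 sqr_ge0.
Qed.

Definition S7 : set HH := [set z | dot z z = 1].

Definition np : HH := (q1, 0).

Definition basis : seq HH :=
  [:: (q1, 0); (qi, 0); (qj, 0); (qk, 0); (0, q1); (0, qi); (0, qj); (0, qk)].

Definition A1 (z : HH) : HH := (qmul z.2 qk, qmul z.1 qk).
Definition A2 (z : HH) : HH := (qmul z.2 qj, qmul z.1 qj).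
Definition A3 (z : HH) : HH := (- qmul z.2 qi, - qmul z.1 qi).
Definition A4 (z : HH) : HH := (z.2, - z.1).

Definition Vi (z : HH) : HH := (qmul z.1 qi, qmul z.2 qi).
Definition Vj (z : HH) : HH := (qmul z.1 qj, qmul z.2 qj).
Definition Vk (z : HH) : HH := (qmul z.1 qk, qmul z.2 qk).

(** The fibre at z of H_Q: tangent to S^7 and orthogonal to Vi, Vj, Vk. *)
Definition HQ (z : HH) : set HH :=
  [set w | [/\ dot w z = 0, dot w (Vi z) = 0, dot w (Vj z) = 0
             & dot w (Vk z) = 0]].

Definition tproj (z v : HH) : HH := v - dot v z *: z.

(** For z on S^7, the vectors z, Vi z, Vj z, Vk z are orthonormal, so this is
    the orthogonal projection onto HQ z (see [hprojP]). *)
Definition hproj (z v : HH) : HH :=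
  v - dot v z *: z - dot v (Vi z) *: Vi z - dot v (Vj z) *: Vj z
    - dot v (Vk z) *: Vk z.

Lemma hprojP (z v : HH) : S7 z ->
  HQ z (hproj z v) /\ (forall w, HQ z w -> dot w (v - hproj z v) = 0).
Proof.
move: z v => [[[[a b] c] d] [[[e f] g] h]] v; rewrite /S7 /HQ /= => z1.
set z := (_, _) in z1 *.
have dotBl (x y w : HH) : dot (x - y) w = dot x w - dot y w.
  move: x y w => [[[[? ?] ?] ?] [[[? ?] ?] ?]] [[[[? ?] ?] ?] [[[? ?] ?] ?]]
    [[[[? ?] ?] ?] [[[? ?] ?] ?]]; rewrite /dot /qdot /=; ring.
have dotZl (k : R) (x w : HH) : dot (k *: x) w = k * dot x w.
  move: x w => [[[[? ?] ?] ?] [[[? ?] ?] ?]] [[[[? ?] ?] ?] [[[? ?] ?] ?]].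
  rewrite /dot /qdot /= /GRing.scale /=; ring.
have dotC (x y : HH) : dot x y = dot y x.
  move: x y => [[[[? ?] ?] ?] [[[? ?] ?] ?]] [[[[? ?] ?] ?] [[[? ?] ?] ?]].
  rewrite /dot /qdot /=; ring.
have zi : dot z (Vi z) = 0 by rewrite /dot /qdot /=; ring.
have zj : dot z (Vj z) = 0 by rewrite /dot /qdot /=; ring.
have zk : dot z (Vk z) = 0 by rewrite /dot /qdot /=; ring.
have [iz jz kz] : [/\ dot (Vi z) z = 0, dot (Vj z) z = 0 & dot (Vk z) z = 0].
  by rewrite !(dotC _ z).
have ij : dot (Vi z) (Vj z) = 0 by rewrite /dot /qdot /=; ring.
have ik : dot (Vi z) (Vk z) = 0 by rewrite /dot /qdot /=; ring.
have jk : dot (Vj z) (Vk z) = 0 by rewrite /dot /qdot /=; ring.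
have [ji ki kj] : [/\ dot (Vj z) (Vi z) = 0, dot (Vk z) (Vi z) = 0
  & dot (Vk z) (Vj z) = 0].
  by split; rewrite dotC.
have ii : dot (Vi z) (Vi z) = 1 by rewrite -z1 /dot /qdot /=; ring.
have jj : dot (Vj z) (Vj z) = 1 by rewrite -z1 /dot /qdot /=; ring.
have kk : dot (Vk z) (Vk z) = 1 by rewrite -z1 /dot /qdot /=; ring.
split.
  split; rewrite /hproj !(dotBl, dotZl).
  - by rewrite z1 iz jz kz; ring.
  - by rewrite zi ii ji ki; ring.
  - by rewrite zj ij jj kj; ring.
  - by rewrite zk ik jk kk; ring.
move=> w [wz wi wj wk].
rewrite dotC /hproj !(dotBl, dotZl) (dotC z) (dotC (Vi z)) (dotC (Vj z)).
by rewrite (dotC (Vk z)) wz wi wj wk; ring.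
Qed.

(** C^oo functions on R^8: all iterated directional derivatives are
    differentiable everywhere.  A smooth function on S^7 is the restriction to
    S^7 of such a function; the operators below only use, at a point of S^7,
    derivatives in tangential directions, so that on S^7 their values depend
    only on that restriction. *)
Definition iter_derive (s : seq HH) (F : HH -> R) : HH -> R :=
  foldr (fun v G z => 'D_v G z) F s.

Definition smooth (F : HH -> R) : Prop :=
  forall (s : seq HH) (z : HH), differentiable (iter_derive s F) z.

Definition vfield (A : HH -> HH) (F : HH -> R) : HH -> R :=
  fun z => 'D_(A z) F z.

Definition subT (F : HH -> R) : HH -> R := fun z =>
  - \sum_(A <- [:: A1; A2; A3; A4]) vfield A (vfield A F) z.

Definition grad (F : HH -> R) (z : HH) : HH :=
  \sum_(e <- basis) 'D_e F z *: e.

(** Divergence on S^7 of a tangent field W: the trace of its covariant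
    derivative v |-> tproj z ('D_v W z) on the tangent space at z. *)
Definition divS (W : HH -> HH) (z : HH) : R :=
  \sum_(e <- basis) dot ('D_(tproj z e) W z) (tproj z e).

Definition subQ (F : HH -> R) : HH -> R := fun z =>
  - divS (fun w => hproj w (grad F w)) z.

End Geometry.

(** [lebesgue_measure] with domain [set R] rather than
    [set (measurableTypeR R)]: same sigma-algebra, different display. *)
Definition lebR (R : realType) (A : set R) : \bar R := @lebesgue_measure R A.

Section Leb.
Variable R : realType.

HB.instance Definition _ :=
  isMeasure.Build default_measure_display R R (@lebR R)
    (measure0 (@lebesgue_measure R)) (measure_ge0 (@lebesgue_measure R))
    (@measure_semi_sigma_additive _ _ _ (@lebesgue_measure R)).

HB.instance Definition _ :=
  Measure_isSigmaFinite.Build default_measure_display R R (@lebR R)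
    (@sigma_finiteT _ _ _ (@lebesgue_measure R)).

End Leb.

Lemma sigma_finite_product d1 d2 (T1 : measurableType d1)
    (T2 : measurableType d2) (R : realType) (m1 : {measure set T1 -> \bar R})
    (m2 : {sigma_finite_measure set T2 -> \bar R}) :
  sigma_finite setT m1 -> sigma_finite setT (m1 \x m2)%E.
Proof.
move=> /sigma_finiteP[F [TF ndF mF]].
have /sigma_finiteP[G [TG ndG mG]] := sigma_finiteT m2.
exists (fun n => F n `*` G n).
  apply/seteqP; split => // -[x y] _.
  have [i _ Fx] : (\bigcup_i F i) x by rewrite -TF.
  have [j _ Gy] : (\bigcup_i G i) y by rewrite -TG.
  exists (maxn i j) => //; split => /=.
    by move/subsetPset: (ndF _ _ (leq_maxl i j)); exact.
  by move/subsetPset: (ndG _ _ (leq_maxr i j)); exact.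
move=> i; have [mFi Fi] := mF i; have [mGi Gi] := mG i.
split; first exact: measurableX.
by rewrite product_measure1E// lte_mul_pinfty// ge0_fin_numE.
Qed.

Section SphereMeasure.
Context {R : realType}.
Local Notation H := (quat R).
Local Notation HH := (H2 R).

Definition leb4 : set H -> \bar R := (@lebR R \x @lebR R \x @lebR R \x @lebR R)%E.
HB.instance Definition _ := Measure.on leb4.

Let sigma_finite_leb4 : sigma_finite setT leb4.
Proof.
by do 3! [apply: sigma_finite_product]; exact: (sigma_finiteT (@lebR R)).
Qed.

HB.instance Definition _ :=
  Measure_isSigmaFinite.Build _ _ _ leb4 sigma_finite_leb4.

Definition leb8 : set HH -> \bar R := (leb4 \x leb4)%E.
HB.instance Definition _ := Measure.on leb8.

Definition pball : set HH := [set z | 0 < dot z z <= 1].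

Definition radial (z : HH) : HH := (Num.sqrt (dot z z))^-1 *: z.

Let mfst d1 d2 (T1 : measurableType d1) (T2 : measurableType d2)
    (f : HH -> T1 * T2) :
  measurable_fun setT f -> measurable_fun setT (fun z => (f z).1).
Proof. by move=> mf; exact: (measurableT_comp measurable_fst mf). Qed.

Let msnd d1 d2 (T1 : measurableType d1) (T2 : measurableType d2)
    (f : HH -> T1 * T2) :
  measurable_fun setT f -> measurable_fun setT (fun z => (f z).2).
Proof. by move=> mf; exact: (measurableT_comp measurable_snd mf). Qed.

Let measurable_coords : let co := fun f : HH -> R => measurable_fun setT f in
  [/\ co (fun z : HH => z.1.1.1.1), co (fun z : HH => z.1.1.1.2),
      co (fun z : HH => z.1.1.2) & co (fun z : HH => z.1.2)] /\
  [/\ co (fun z : HH => z.2.1.1.1), co (fun z : HH => z.2.1.1.2),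
      co (fun z : HH => z.2.1.2) & co (fun z : HH => z.2.2)].
Proof.
have m1 : measurable_fun setT (fun z : HH => z.1) by exact: measurable_fst.
have m2 : measurable_fun setT (fun z : HH => z.2) by exact: measurable_snd.
split; split.
- exact: mfst (mfst (mfst m1)).
- exact: msnd (mfst (mfst m1)).
- exact: msnd (mfst m1).
- exact: msnd m1.
- exact: mfst (mfst (mfst m2)).
- exact: msnd (mfst (mfst m2)).
- exact: msnd (mfst m2).
- exact: msnd m2.
Qed.

Lemma measurable_dot : measurable_fun setT (fun z : HH => dot z z).
Proof.
rewrite (_ : (fun z => _) = fun z : HH =>
    z.1.1.1.1 * z.1.1.1.1 + z.1.1.1.2 * z.1.1.1.2 + z.1.1.2 * z.1.1.2
    + z.1.2 * z.1.2 + (z.2.1.1.1 * z.2.1.1.1 + z.2.1.1.2 * z.2.1.1.2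
    + z.2.1.2 * z.2.1.2 + z.2.2 * z.2.2)); last first.
  by apply/funext => -[[[[? ?] ?] ?] [[[? ?] ?] ?]].
have [[? ? ? ?] [? ? ? ?]] := measurable_coords.
by do ?[apply: measurable_funD | apply: measurable_funM].
Qed.

Lemma measurable_radial : measurable_fun setT radial.
Proof.
pose k (z : HH) : R := (Num.sqrt (dot z z))^-1.
have mk : measurable_fun setT k.
  rewrite (_ : k = (fun x => x `^ (- 2^-1)) \o (fun z : HH => dot z z)).
    apply: measurableT_comp; [exact: measurable_powR|exact: measurable_dot].
  apply/funext => z /=; rewrite powRN powR12_sqrt ?dot_ge0//.
rewrite (_ : radial = fun z : HH =>
   ((k z * z.1.1.1.1, k z * z.1.1.1.2, k z * z.1.1.2, k z * z.1.2),
    (k z * z.2.1.1.1, k z * z.2.1.1.2, k z * z.2.1.2, k z * z.2.2))); last first.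
  by apply/funext => -[[[[? ?] ?] ?] [[[? ?] ?] ?]].
have [[? ? ? ?] [? ? ? ?]] := measurable_coords.
do ?[apply: measurable_fun_pair | apply: measurable_funM] => //.
Qed.

Lemma measurable_pball : measurable pball.
Proof.
rewrite (_ : pball = (fun z : HH => dot z z) @^-1` [set` `]0%R, 1%R]]).
  by rewrite -[X in measurable X]setTI; apply: measurable_dot.
by apply/seteqP; split => z /=; rewrite in_itv.
Qed.

(** The volume of S^7, as a measure on R^8 carried by S^7: the volume of A is
    8 times the Lebesgue measure of the cone {t z | 0 < t <= 1, z in A}. *)
Definition sphere_measure (A : set HH) : \bar R :=
  (8%:E * pushforward (mrestr leb8 measurable_pball) radial A)%E.

Let sphere_measure' : {measure set HH -> \bar R} := mscale 8%:nng
  (measure_function_pushforward__canonical__measure_function_Measure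
    (mrestr leb8 measurable_pball) measurable_radial).

HB.instance Definition _ := isMeasure.Build _ _ _ sphere_measure
  (measure0 sphere_measure') (measure_ge0 sphere_measure')
  (@measure_semi_sigma_additive _ _ _ sphere_measure').

End SphereMeasure.

Section Spectrum.
Context {R : realType}.
Local Notation HH := (H2 R).

Definition norm2 (f : HH -> R) : \bar R :=
  'N[sphere_measure]_2%:E[EFin \o f]%E.

(** L^2(S^7, sigma): functions are defined on R^8, but sigma only sees S^7. *)
Definition L2 : set (HH -> R) := [set f | f \in Lfun sphere_measure 2%:E].

(** An operator [D] is given on smooth functions; [op_closure D f g] says that
    (f, g) belongs to the closure in L^2 x L^2 of the graph of [D]. *)
Definition op_closure (D : (HH -> R) -> HH -> R) (f g : HH -> R) : Prop :=
  [/\ L2 f, L2 g & forall eps : R, 0 < eps -> exists F : HH -> R,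
    [/\ smooth F, (norm2 (fun z => F z - f z)%R < eps%:E)%E
      & (norm2 (fun z => D F z - g z)%R < eps%:E)%E]].

(** [closure D - l] is a bijection onto L^2 with bounded inverse; note that
    [op_closure D f (l f + h)] means [(closure D - l) f = h]. *)
Definition resolvent_set (D : (HH -> R) -> HH -> R) : set R :=
  [set l | (forall h, L2 h -> exists f,
      op_closure D f (fun z => l * f z + h z)) /\
    exists C : R, forall f h, L2 h -> op_closure D f (fun z => l * f z + h z) ->
      (norm2 f <= C%:E * norm2 h)%E].

(** Only real points are considered, which is no restriction for the
    (self-adjoint) closures of the two sublaplacians. *)
Definition spectrum (D : (HH -> R) -> HH -> R) : set R := ~` resolvent_set D.

(** Smooth elements of the kernel of [D - l] on S^7. *)
Definition smooth_ker (D : (HH -> R) -> HH -> R) (l : R) : set (HH -> R) :=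
  [set phi | smooth phi /\ forall z, S7 z -> D phi z = l * phi z].

End Spectrum.

(* Main.v *)
(** On S^7, Delta_Q is the polynomial operator E^2 + 6 E - L + C, where E is the
    Euler field, L the flat Laplacian and C = Vi^2 + Vj^2 + Vk^2.  By a
    Clebsch-Gordan argument for C, every polynomial is annihilated by a product
    of factors Delta_Q - mu with mu = k (k + 6) - m (m + 2) and k - m even and
    nonnegative.  Since Delta_Q is symmetric, polynomials split into
    eigenfunctions; as they are dense in L^2, the spectrum of Delta_Q is the set
    of these mu.

    Each mu has an eigenfunction that does not vanish at np and is a polynomial
    in re x, |x|^2 and |y|^2; on such polynomials both sublaplacians agree, so
    it is also an eigenfunction of Delta_T.  Conversely, if Delta_T phi = l phi
    and l is not one of the mu, then phi is orthogonal to all polynomials in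
    re x, |x|^2 and |y|^2, in particular to the powers of (1 + re x) / 2, which
    concentrate at np; hence phi np = 0. *)

(* The spectrum is defined through the closure of the graph, so excluding a number l takes both a
   bound and solvability in L^2. All mu are integers, so an l outside the list stays at some
   distance d > 0 from it. On polynomials the eigencomponents are orthogonal and the resolvent has
   norm at most 1/d. Testing a smooth function against solutions with polynomial right-hand side
   carries the bound over to smooth functions and then to the closure; density of polynomials and
   completeness of L^2 give the solutions.

   Symmetry of both operators rests on one fact: a linear skew field has integral zero. This is the
   derivative of the rotation invariance of the cone measure, which itself comes from factoring
   plane rotations into shears. For this reason E^2 + 6 E - L is rewritten on S^7 as a sum of
   squares of rotation fields.

   Points enter the spectrum of Delta_T only through explicit eigenfunctions, and the condition at
   np is tested only through its pairing with polynomials in re x, |x|^2 and |y|^2. *)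
From HB Require Import structures.
From mathcomp Require Import all_boot all_order all_algebra.
From mathcomp Require Import all_classical all_reals all_analysis.
From mathcomp Require Import measurable_realfun.
From mathcomp Require Import ring lra zify.
Require Import Defs.

Set Implicit Arguments.
Unset Strict Implicit.
Unset Printing Implicit Defensive.
Import Order.TTheory GRing.Theory Num.Theory.
Import numFieldNormedType.Exports.
Local Open Scope classical_set_scope.
Local Open Scope ring_scope.

(** * Smooth functions and vector fields on R^8 *)

Section Calculus.
Context {R : realType}.
Local Notation HH := (H2 R).
Implicit Types (F G : HH -> R) (A : HH -> HH) (u v w z : HH).

Lemma dotC u v : dot u v = dot v u.
Proof.
move: u v => [[[[? ?] ?] ?] [[[? ?] ?] ?]] [[[[? ?] ?] ?] [[[? ?] ?] ?]].
rewrite /dot /qdot /=; ring.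
Qed.

Lemma dotDl u v w : dot (u + v) w = dot u w + dot v w.
Proof.
move: u v w => [[[[? ?] ?] ?] [[[? ?] ?] ?]] [[[[? ?] ?] ?] [[[? ?] ?] ?]]
  [[[[? ?] ?] ?] [[[? ?] ?] ?]]; rewrite /dot /qdot /=; ring.
Qed.

Lemma dotZl (k : R) u v : dot (k *: u) v = k * dot u v.
Proof.
move: u v => [[[[? ?] ?] ?] [[[? ?] ?] ?]] [[[[? ?] ?] ?] [[[? ?] ?] ?]].
rewrite /dot /qdot /= /GRing.scale /=; ring.
Qed.

Lemma dotDr u v w : dot u (v + w) = dot u v + dot u w.
Proof. by rewrite dotC dotDl !(dotC _ u). Qed.

Lemma dotZr (k : R) u v : dot u (k *: v) = k * dot u v.
Proof. by rewrite dotC dotZl dotC. Qed.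

Lemma dot0l u : dot 0 u = 0.
Proof. by rewrite -(scale0r u) dotZl mul0r. Qed.

Lemma dotNl u v : dot (- u) v = - dot u v.
Proof. by rewrite -scaleN1r dotZl mulN1r. Qed.

Lemma dotNr u v : dot u (- v) = - dot u v.
Proof. by rewrite dotC dotNl dotC. Qed.

Lemma dot_suml (I : Type) (s : seq I) (f : I -> HH) v :
  dot (\sum_(i <- s) f i) v = \sum_(i <- s) dot (f i) v.
Proof.
elim: s => [|i s ih]; first by rewrite !big_nil dot0l.
by rewrite !big_cons dotDl ih.
Qed.

Lemma HH_ext z w : z.1.1.1.1 = w.1.1.1.1 -> z.1.1.1.2 = w.1.1.1.2 ->
  z.1.1.2 = w.1.1.2 -> z.1.2 = w.1.2 -> z.2.1.1.1 = w.2.1.1.1 ->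
  z.2.1.1.2 = w.2.1.1.2 -> z.2.1.2 = w.2.1.2 -> z.2.2 = w.2.2 -> z = w.
Proof.
move: z w => [[[[? ?] ?] ?] [[[? ?] ?] ?]] [[[[? ?] ?] ?] [[[? ?] ?] ?]] /=.
by do 8! move=> ->.
Qed.

Lemma basisE z : \sum_(e <- @basis R) dot z e *: e = z.
Proof.
move: z => [[[[a b] c] d] [[[e f] g] h]]; rewrite /basis !big_cons big_nil.
rewrite /dot /qdot /=.
apply: HH_ext; rewrite /= /GRing.scale /=; ring.
Qed.

Lemma dot_basis u v : \sum_(e <- @basis R) dot u e * dot v e = dot u v.
Proof.
by rewrite -[in RHS](basisE u) dot_suml; apply: eq_bigr => e _; rewrite dotZl (dotC e).
Qed.

Lemma coord_continuous :
  [/\ continuous (fun z : HH => z.1.1.1.1), continuous (fun z : HH => z.1.1.1.2),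
      continuous (fun z : HH => z.1.1.2) & continuous (fun z : HH => z.1.2)] /\
  [/\ continuous (fun z : HH => z.2.1.1.1), continuous (fun z : HH => z.2.1.1.2),
      continuous (fun z : HH => z.2.1.2) & continuous (fun z : HH => z.2.2)].
Proof.
have c1 (U S T : topologicalType) (f : U -> S * T) :
    continuous f -> continuous (fun t : U => (f t).1).
  by move=> cf t; apply: (continuous_comp (cf t)); exact: cvg_fst.
have c2 (U S T : topologicalType) (f : U -> S * T) :
    continuous f -> continuous (fun t : U => (f t).2).
  by move=> cf t; apply: (continuous_comp (cf t)); exact: cvg_snd.
have m1 : continuous (fun z : HH => z.1) by move=> t; exact: cvg_fst.
have m2 : continuous (fun z : HH => z.2) by move=> t; exact: cvg_snd.
split; split.
- exact: (c1 _ _ _ _ (c1 _ _ _ _ (c1 _ _ _ _ m1))).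
- exact: (c2 _ _ _ _ (c1 _ _ _ _ (c1 _ _ _ _ m1))).
- exact: (c2 _ _ _ _ (c1 _ _ _ _ m1)).
- exact: (c2 _ _ _ _ m1).
- exact: (c1 _ _ _ _ (c1 _ _ _ _ (c1 _ _ _ _ m2))).
- exact: (c2 _ _ _ _ (c1 _ _ _ _ (c1 _ _ _ _ m2))).
- exact: (c2 _ _ _ _ (c1 _ _ _ _ m2)).
- exact: (c2 _ _ _ _ m2).
Qed.

Lemma dot_continuous v : continuous (fun z => dot z v).
Proof.
have D (f g : HH -> R) : continuous f -> continuous g -> continuous (f + g).
  by move=> cf cg t; apply: continuousD; [exact: cf|exact: cg].
have M k (f : HH -> R) : continuous f -> continuous (f * cst k).
  by move=> cf t; apply: continuousM; [exact: cf|exact: cst_continuous].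
have [[c1 c2 c3 c4] [c5 c6 c7 c8]] := coord_continuous.
rewrite (_ : (fun z => dot z v) =
  (fun z => z.1.1.1.1) * cst v.1.1.1.1 + (fun z => z.1.1.1.2) * cst v.1.1.1.2
  + (fun z => z.1.1.2) * cst v.1.1.2 + (fun z => z.1.2) * cst v.1.2
  + ((fun z => z.2.1.1.1) * cst v.2.1.1.1 + (fun z => z.2.1.1.2) * cst v.2.1.1.2
  + (fun z => z.2.1.2) * cst v.2.1.2 + (fun z => z.2.2) * cst v.2.2)); last first.
  apply/funext; move: v => [[[[? ?] ?] ?] [[[? ?] ?] ?]].
  by move=> [[[[? ?] ?] ?] [[[? ?] ?] ?]].
exact: (D _ _ (D _ _ (D _ _ (D _ _ (M _ _ c1) (M _ _ c2)) (M _ _ c3)) (M _ _ c4))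
  (D _ _ (D _ _ (D _ _ (M _ _ c5) (M _ _ c6)) (M _ _ c7)) (M _ _ c8))).
Qed.

Lemma is_diff_dot v z : is_diff z (fun z => dot z v) (fun z => dot z v).
Proof.
have lin : linear (fun z => dot z v) by move=> k x y; rewrite dotDl dotZl.
pose f : {linear HH -> R} :=
  HB.pack (fun z => dot z v) (GRing.isLinear.Build R HH R *:%R _ lin).
have cf : continuous f by exact: dot_continuous.
have df : differentiable f z by exact: linear_differentiable.
have ef : 'd f z = f :> (HH -> R) by exact: diff_lin.
exact: DiffDef df ef.
Qed.

Lemma derive_dot v w z : 'D_w (fun z => dot z v) z = dot w v.
Proof. by have [d e] := is_diff_dot v z; rewrite deriveE// e. Qed.

(** Differentiability up to a finite order, peeling off the innermost derivative: the product rule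
    can then be proved by induction on the order. *)
Fixpoint cdiff (n : nat) F : Prop :=
  (forall z, differentiable F z) /\
  (if n is n'.+1 then forall v, cdiff n' (fun z => 'D_v F z) else True).

Lemma smoothP F : smooth F <-> forall n, cdiff n F.
Proof.
(* [foldr] applies the last direction of the list first, so lists are taken apart from the right. *)
have E s v G : iter_derive (rcons s v) G = iter_derive s (fun z => 'D_v G z).
  by rewrite /iter_derive foldr_rcons.
split=> [sF n|cF s].
  elim: n F sF => [|n ih] F sF /=; first by split=> // z; exact: (sF [::]).
  split=> [z|v]; first exact: (sF [::]).
  by apply: ih => s z; rewrite -E.
move: (cF (size s)); move: {2}(size s) (erefl (size s)) => n; clear cF.
elim: n s F => [|n ih] s F; first by move=> /size0nil-> [].
case/lastP: s => // s v; rewrite size_rcons => -[ns]; rewrite ns => -[_ /(_ v) cF].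
rewrite E; apply: ih => //; first by rewrite ns.
Qed.

Lemma cdiffW n F : cdiff n.+1 F -> cdiff n F.
Proof.
elim: n F => [|n ih] F [dF cF]; first by split.
by split=> // v; apply: ih; exact: cF.
Qed.

Lemma deriveDfun F G v : (forall z, differentiable F z) ->
  (forall z, differentiable G z) ->
  (fun z => 'D_v (F + G) z) = (fun z => 'D_v F z) + (fun z => 'D_v G z).
Proof.
move=> dF dG; apply/funext => z.
by rewrite deriveD//; exact: diff_derivable.
Qed.

Lemma deriveMfun F G v : (forall z, differentiable F z) ->
  (forall z, differentiable G z) ->
  (fun z => 'D_v (F * G) z) = (fun z => 'D_v F z) * G + F * (fun z => 'D_v G z).
Proof.
move=> dF dG; apply/funext => z; rewrite deriveM; [|exact: diff_derivable..].
by rewrite addrC [_ *: 'D_v F z]mulrC.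
Qed.

Lemma cdiffD n F G : cdiff n F -> cdiff n G -> cdiff n (F + G).
Proof.
elim: n F G => [|n ih] F G [dF cF] [dG cG]; (split=> [z|]; first exact: differentiableD) => //.
by move=> v; rewrite deriveDfun//; apply: ih; [exact: cF|exact: cG].
Qed.

Lemma cdiffM n F G : cdiff n F -> cdiff n G -> cdiff n (F * G).
Proof.
elim: n F G => [|n ih] F G hF hG; have [dF cF] := hF; have [dG cG] := hG;
  (split=> [z|]; first exact: differentiableM) => //.
move=> v; rewrite deriveMfun//.
by apply: cdiffD; apply: ih; [exact: cF|exact: cdiffW|exact: cdiffW|exact: cG].
Qed.

Lemma cdiff_cst n (k : R) : cdiff n (fun=> k).
Proof.
elim: n k => [|n ih] k; (split=> [z|]; first exact: differentiable_cst) => //.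
by move=> v; under eq_fun do rewrite derive_cst.
Qed.

Lemma smooth_cst (k : R) : smooth (fun _ : HH => k).
Proof. by apply/smoothP => n; exact: cdiff_cst. Qed.

Lemma smooth_dot v : smooth (fun z => dot z v).
Proof.
apply/smoothP => -[|n]; (split=> [z|]; first by have [] := is_diff_dot v z) => //.
by move=> w; under eq_fun do rewrite derive_dot; exact: cdiff_cst.
Qed.

Lemma smoothD F G : smooth F -> smooth G -> smooth (F + G).
Proof. by move=> /smoothP sF /smoothP sG; apply/smoothP => n; exact: cdiffD. Qed.

Lemma smoothM F G : smooth F -> smooth G -> smooth (F * G).
Proof. by move=> /smoothP sF /smoothP sG; apply/smoothP => n; exact: cdiffM. Qed.

Lemma smoothN F : smooth F -> smooth (- F).
Proof.
move=> sF; rewrite (_ : - F = (fun=> -1) * F); first exact/smoothM/sF/smooth_cst.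
by apply/funext => z /=; rewrite -[LHS]mulN1r.
Qed.

Lemma smoothB F G : smooth F -> smooth G -> smooth (F - G).
Proof. by move=> sF sG; apply: smoothD => //; exact: smoothN. Qed.

Lemma smooth_sum (I : Type) (s : seq I) (f : I -> HH -> R) :
  (forall i, smooth (f i)) -> smooth (\sum_(i <- s) f i).
Proof.
by move=> sf; elim/big_ind : _ => [||i _] //; [exact: (smooth_cst 0)|exact: smoothD].
Qed.

Lemma smooth_derive F v : smooth F -> smooth (fun z => 'D_v F z).
Proof. by move=> /smoothP sF; apply/smoothP => n; have [_] := sF n.+1; exact. Qed.

Lemma smooth_diff F z : smooth F -> differentiable F z.
Proof. exact: (fun sF => sF [::] z). Qed.

End Calculus.

(** * Vector fields and the polynomial form of Delta_Q on S^7 *)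

Section Fields.
Context {R : realType}.
Local Notation HH := (H2 R).
Local Notation basis := (@Defs.basis R).
Implicit Types (F G : HH -> R) (A : HH -> HH) (u v w z : HH).

(* Sealed so that failed unifications do not unfold down to limits. *)
Definition vf := locked (@vfield R).

Lemma vfE A F z : vf A F z = 'D_(A z) F z.
Proof. by rewrite /vf -lock. Qed.

Definition smooth_field A := forall v, smooth (fun z => dot (A z) v).

Lemma derive_basis F w z : smooth F ->
  'D_w F z = \sum_(e <- basis) dot w e * 'D_e F z.
Proof.
move=> /(smooth_diff z) dF; rewrite -[in LHS](basisE w) deriveE// linear_sum.
by apply: eq_bigr => e _; rewrite linearZ deriveE.
Qed.

Lemma deriveDv F u v z : smooth F -> 'D_(u + v) F z = 'D_u F z + 'D_v F z.
Proof. by move=> /(smooth_diff z) dF; rewrite !deriveE// linearD. Qed.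

Lemma deriveZv F k v z : smooth F -> 'D_(k *: v) F z = k * 'D_v F z.
Proof. by move=> /(smooth_diff z) dF; rewrite !deriveE// linearZ. Qed.

Definition dirder v F := vf (fun=> v) F.

Lemma dirderE v F : dirder v F = fun z => 'D_v F z.
Proof. by apply/funext => z; rewrite /dirder vfE. Qed.

Lemma smooth_dirder v F : smooth F -> smooth (dirder v F).
Proof. by rewrite dirderE; exact: smooth_derive. Qed.

Lemma vf_basisE A F z : smooth F ->
  vf A F z = \sum_(e <- basis) dot (A z) e * dirder e F z.
Proof.
move=> sF; rewrite vfE derive_basis//.
by apply: eq_bigr => e _; rewrite dirderE.
Qed.

Lemma vfield_basis A F : smooth F ->
  vf A F = \sum_(e <- basis) (fun z => dot (A z) e) * dirder e F.
Proof.
move=> sF; apply/funext => z; rewrite vf_basisE//.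
by elim/big_rec2 : _ => // e a b _ ->.
Qed.

Lemma smooth_vfield A F : smooth_field A -> smooth F -> smooth (vf A F).
Proof.
move=> sA sF; rewrite vfield_basis//; apply: smooth_sum => e.
by apply: smoothM; [exact: sA|exact: smooth_dirder].
Qed.

Lemma vfieldD A F G : smooth F -> smooth G ->
  vf A (F + G) = vf A F + vf A G.
Proof.
move=> sF sG; apply/funext => z.
rewrite vfE deriveD; [by rewrite -!vfE|exact/diff_derivable/smooth_diff..].
Qed.

Lemma vfieldM A F G : smooth F -> smooth G ->
  vf A (F * G) = vf A F * G + F * vf A G.
Proof.
move=> sF sG; apply/funext => z; rewrite vfE deriveM.
- by rewrite addrC [_ *: 'D__ F z]mulrC -!vfE.
- exact/diff_derivable/smooth_diff.
- exact/diff_derivable/smooth_diff.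
Qed.

Lemma vfield_cst A (k : R) : vf A (cst k) = 0.
Proof. by apply/funext => z; rewrite vfE derive_cst. Qed.

Lemma vfieldZ A (k : R) F : smooth F -> vf A (cst k * F) = cst k * vf A F.
Proof.
by move=> sF; rewrite vfieldM//; [rewrite vfield_cst mul0r add0r|exact: smooth_cst].
Qed.

Lemma vfieldN A F : smooth F -> vf A (- F) = - vf A F.
Proof.
move=> sF; have -> : - F = cst (-1) * F.
  by apply/funext => z; rewrite /= -[LHS]mulN1r.
by rewrite vfieldZ//; apply/funext => z; rewrite -[RHS]mulN1r.
Qed.

Lemma vfieldB A F G : smooth F -> smooth G ->
  vf A (F - G) = vf A F - vf A G.
Proof. by move=> sF sG; rewrite vfieldD ?vfieldN//; exact: smoothN. Qed.

Lemma vfield_sum A (I : Type) (s : seq I) (f : I -> HH -> R) :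
  (forall i, smooth (f i)) ->
  vf A (\sum_(i <- s) f i) = \sum_(i <- s) vf A (f i).
Proof.
move=> sf; elim: s => [|i s ih]; first by rewrite !big_nil; exact: (vfield_cst A 0).
by rewrite !big_cons vfieldD// ?ih//; exact: smooth_sum.
Qed.

Lemma vfield_dot A v : vf A (fun z => dot z v) = fun z => dot (A z) v.
Proof. by apply/funext => z; rewrite vfE derive_dot. Qed.

Lemma fct_sumE (I T : Type) (s : seq I) (f : I -> T -> R) (x : T) :
  (\sum_(i <- s) f i) x = \sum_(i <- s) f i x.
Proof. by elim/big_rec2 : _ => // i a b _ <-. Qed.

Definition euler F := vf id F.
Definition laplace F := \sum_(e <- basis) dirder e (dirder e F).
Definition vert_sum F := \sum_(V <- [:: @Vi R; @Vj R; @Vk R]) vf V (vf V F).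
Definition subQ_poly F :=
  euler (euler F) + cst 6 * euler F - laplace F + vert_sum F.

Lemma smooth_field_id : smooth_field id.
Proof. exact: smooth_dot. Qed.

Lemma smooth_field_cst v : smooth_field (fun=> v).
Proof. by move=> u; exact: smooth_cst. Qed.

(** Having an adjoint forces [A] to be linear; this is why smoothness of the field follows from the
    identity alone. *)
Definition skew A := forall u v, dot (A u) v = - dot u (A v).

Lemma skew_smooth A : skew A -> smooth_field A.
Proof.
move=> kA v; rewrite (_ : (fun z => _) = - (fun z => dot z (A v))).
  exact/smoothN/smooth_dot.
by apply/funext => z; rewrite kA.
Qed.

Lemma skew_dot A z : skew A -> dot (A z) z = 0.
Proof. by move=> kA; have := kA z z; rewrite (dotC z); lra. Qed.

Lemma skew_V : [/\ skew (@Vi R), skew (@Vj R) & skew (@Vk R)].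
Proof.
split=> -[[[[? ?] ?] ?] [[[? ?] ?] ?]] [[[[? ?] ?] ?] [[[? ?] ?] ?]];
  rewrite /dot /qdot /=; ring.
Qed.

Lemma skew_A : [/\ skew (@A1 R), skew (@A2 R), skew (@A3 R) & skew (@A4 R)].
Proof.
split=> -[[[[? ?] ?] ?] [[[? ?] ?] ?]] [[[[? ?] ?] ?] [[[? ?] ?] ?]];
  rewrite /dot /qdot /=; ring.
Qed.

Lemma smooth_euler F : smooth F -> smooth (euler F).
Proof. exact/smooth_vfield/smooth_field_id. Qed.

Lemma smooth_laplace F : smooth F -> smooth (laplace F).
Proof. by move=> sF; apply: smooth_sum => e; do 2 apply: smooth_dirder. Qed.

Lemma smooth_vert_sum F : smooth F -> smooth (vert_sum F).
Proof.
have [ki kj kk] := skew_V.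
move=> sF; have h V : skew V -> smooth (vf V (vf V F)).
  by move=> /skew_smooth sV; exact/smooth_vfield/smooth_vfield.
rewrite /vert_sum !big_cons big_nil.
exact: smoothD (h _ ki) (smoothD (h _ kj) (smoothD (h _ kk) (smooth_cst 0))).
Qed.

Lemma smooth_subQ_poly F : smooth F -> smooth (subQ_poly F).
Proof.
move=> sF; apply: smoothD; last exact: smooth_vert_sum.
apply: smoothB; last exact: smooth_laplace.
apply: smoothD; first exact/smooth_euler/smooth_euler.
apply: smoothM; [exact: smooth_cst|exact: smooth_euler].
Qed.

Lemma differentiable_field (W : HH -> HH) z : smooth_field W -> differentiable W z.
Proof.
move=> sW; rewrite (_ : W = \sum_(e <- basis) (fun w => dot (W w) e *: e)); last first.
  apply/funext => w; rewrite -[LHS]basisE.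
  by elim/big_rec2 : _ => // e a b _ ->.
elim/big_ind : _ => [|f g df dg|e _]; first exact: differentiable_cst.
- exact: differentiableD.
- by apply: differentiableZl; exact: smooth_diff.
Qed.

Lemma derive_field (W : HH -> HH) v u z : smooth_field W ->
  dot ('D_v W z) u = 'D_v (fun w => dot (W w) u) z.
Proof.
move=> sW; have dW := differentiable_field z sW.
have [d e] := is_diff_dot u (W z).
have sc : differentiable (fun w => dot (W w) u) z by apply: smooth_diff.
rewrite !deriveE//.
have -> : 'd (fun w => dot (W w) u) z = 'd (fun w => dot w u) (W z) \o 'd W z :> (HH -> R).
  by rewrite -diff_comp.
by rewrite e.
Qed.

(** Expand [tproj z e] bilinearly and sum over the basis: each of the two cross terms removes
    [M z z], and the last term, weighted by |z|^2 = 1, gives it back once. *)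
Lemma trace_tproj (M : HH -> HH -> R) z : S7 z ->
  (forall u v w, M (u + v) w = M u w + M v w) ->
  (forall u v w, M w (u + v) = M w u + M w v) ->
  (forall k u v, M (k *: u) v = k * M u v) ->
  (forall k u v, M u (k *: v) = k * M u v) ->
  \sum_(e <- basis) M (tproj z e) (tproj z e) =
  \sum_(e <- basis) M e e - M z z.
Proof.
move=> z1 aDl aDr aZl aZr.
have E (f : HH -> R) : (forall u v, f (u + v) = f u + f v) ->
    (forall k u, f (k *: u) = k * f u) ->
    f z = \sum_(e <- basis) dot z e * f e.
  move=> fD fZ; rewrite -[in LHS](basisE z).
  have f0 : f 0 = 0 by rewrite -(scale0r z) fZ mul0r.
  elim: basis => [|e s ih]; first by rewrite !big_nil f0.
  by rewrite !big_cons fD fZ ih.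
have -> : \sum_(e <- basis) M (tproj z e) (tproj z e) =
    \sum_(e <- basis) M e e - \sum_(e <- basis) dot z e * M z e
    - \sum_(e <- basis) dot z e * M e z
    + \sum_(e <- basis) dot z e * dot z e * M z z.
  rewrite -!sumrB -big_split/=; apply: eq_bigr => e _.
  have -> : tproj z e = e + (- dot z e) *: z by rewrite /tproj (dotC e) scaleNr.
  rewrite !(aDl, aDr, aZl, aZr); ring.
rewrite -(E (M z))// -(E (M^~ z))// -mulr_suml dot_basis z1; ring.
Qed.

Lemma vfield_dot_skew A V u : skew V ->
  vf A (fun z => dot (V z) u) = fun z => dot (V (A z)) u.
Proof.
move=> kV; rewrite (_ : (fun z => dot (V z) u) = - (fun z => dot z (V u))).
  by rewrite vfieldN ?vfield_dot; [apply/funext => z; rewrite kV|exact: smooth_dot].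
by apply/funext => z; rewrite kV.
Qed.

Lemma hess_term F V v u : smooth F -> skew V ->
  vf (fun=> v) (vf V F * (fun w => dot (V w) u)) =
  dirder v (vf V F) * (fun w => dot (V w) u)
  + vf V F * (fun=> dot (V v) u).
Proof.
move=> sF kV; have sV := skew_smooth kV.
rewrite /dirder vfieldM; [|exact: smooth_vfield|exact: sV].
by rewrite vfield_dot_skew.
Qed.

(** The flat divergence of the field [(V F) V]. A skew field is divergence free because
    [dot (V e) e] vanishes. *)
Lemma trace_hess_term F V z : smooth F -> skew V ->
  \sum_(e <- basis) (dirder e (vf V F) z * dot (V z) e
    + vf V F z * dot (V e) e) = vf V (vf V F) z.
Proof.
move=> sF kV; have sV := smooth_vfield (skew_smooth kV) sF.
rewrite [RHS]vf_basisE//; apply: eq_bigr => e _.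
by rewrite skew_dot// mulr0 addr0 mulrC.
Qed.

Lemma dirder_eulerE v F : smooth F -> dirder v (euler F) =
  \sum_(e <- basis) ((fun=> dot v e) * dirder e F
    + (fun z => dot z e) * dirder v (dirder e F)).
Proof.
move=> sF; have -> : euler F = \sum_(e <- basis) (fun z => dot z e) * dirder e F.
  exact: (@vfield_basis id).
rewrite /dirder vfield_sum; last first.
  by move=> e; exact: smoothM (smooth_dot e) (smooth_dirder e sF).
apply: eq_bigr => e _; rewrite vfieldM; [|exact: smooth_dot|exact: smooth_dirder].
by rewrite vfield_dot.
Qed.

Lemma dirder_dirderE v u F : smooth F -> dirder v (dirder u F) =
  \sum_(e <- basis) (fun=> dot u e) * dirder v (dirder e F).
Proof.
move=> sF; have -> : dirder u F = \sum_(e <- basis) cst (dot u e) * dirder e F.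
  exact: (@vfield_basis (fun=> u)).
rewrite /dirder vfield_sum; last first.
  by move=> e; exact: smoothM (smooth_cst _) (smooth_dirder e sF).
by apply: eq_bigr => e _; rewrite vfieldZ//; exact: smooth_dirder.
Qed.

(** Applying the Euler field twice also differentiates its coefficients, which adds one [euler F] to
    the second derivative in the fixed direction [z]. *)
Lemma dirder_euler F z : smooth F ->
  dirder z (dirder z F) z = dirder z (euler F) z - euler F z.
Proof.
move=> sF; rewrite (dirder_eulerE z sF) (dirder_dirderE z z sF) !fct_sumE.
have -> : euler F z = \sum_(e <- basis) dot z e * dirder e F z.
  exact: vf_basisE.
rewrite -sumrB; apply: eq_bigr => e _.
move: (dirder e F) => f; move: (dirder z f) => g.
rewrite -[LHS]/(dot z e * g z) -[RHS]/((dot z e * f z + dot z e * g z) - dot z e * f z).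
ring.
Qed.

(** The coefficient 6 is 8 - 2: the flat divergence of [euler F w *: w] contributes the dimension 8,
    and passing to the tangential trace subtracts [M z z = - 2 * euler F z]. *)
Lemma divS_horizontal F (I J K : HH -> HH) z : smooth F -> S7 z ->
  skew I -> skew J -> skew K ->
  divS (fun w => grad F w - euler F w *: w - vf I F w *: I w
    - vf J F w *: J w - vf K F w *: K w) z =
  laplace F z - euler (euler F) z - 6 * euler F z
  - (vf I (vf I F) z + vf J (vf J F) z + vf K (vf K F) z).
Proof.
move=> sF z1 ki kj kk.
have [si sj sk] := And3 (skew_smooth ki) (skew_smooth kj) (skew_smooth kk).
set W := (W in divS W).
have dgrad w u : dot (grad F w) u = dirder u F w.
  rewrite dirderE /grad dot_suml derive_basis//; apply: eq_bigr => e _.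
  by rewrite dotZl mulrC dotC.
have dW u : (fun w => dot (W w) u) = dirder u F
    - euler F * (fun w => dot w u)
    - vf I F * (fun w => dot (I w) u)
    - vf J F * (fun w => dot (J w) u)
    - vf K F * (fun w => dot (K w) u).
  by apply/funext => w; rewrite /W !dotDl !dotNl !dotZl dgrad.
clearbody W.
have sE := smooth_euler sF.
have sT V u : skew V -> smooth (vf V F * (fun w => dot (V w) u)).
  by move=> /skew_smooth sV; exact: smoothM (smooth_vfield sV sF) (sV u).
have sD u := smooth_dirder u sF.
have sEu u : smooth (euler F * (fun w => dot w u)).
  exact: smoothM sE (smooth_dot u).
have sW : smooth_field W.
  move=> u; rewrite dW.
  exact: smoothB (smoothB (smoothB (smoothB (sD u) (sEu u)) (sT _ u ki)) (sT _ u kj)) (sT _ u kk).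
have hM v u : dot ('D_v W z) u = dirder v (dirder u F) z
    - (dirder v (euler F) z * dot z u + euler F z * dot v u)
    - (dirder v (vf I F) z * dot (I z) u + vf I F z * dot (I v) u)
    - (dirder v (vf J F) z * dot (J z) u + vf J F z * dot (J v) u)
    - (dirder v (vf K F) z * dot (K z) u + vf K F z * dot (K v) u).
  rewrite derive_field// dW -[LHS](vfE (fun=> v)).
  rewrite vfieldB; last exact: sT.
    rewrite vfieldB; last exact: sT.
      rewrite vfieldB; last exact: sT.
        rewrite vfieldB; [|exact: sD|exact: sEu].
        rewrite vfieldM; [|exact: sE|exact: smooth_dot].
        by rewrite vfield_dot !hess_term.
      exact: smoothB (sD u) (sEu u).
    exact: smoothB (smoothB (sD u) (sEu u)) (sT _ u ki).
  exact: smoothB (smoothB (smoothB (sD u) (sEu u)) (sT _ u ki)) (sT _ u kj).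
have hD v u : dot ('D_v W z) u = 'D_v (fun w => dot (W w) u) z.
  exact: (@derive_field W v u z sW).
pose M v u := dot ('D_v W z) u.
have MDl u v w : M (u + v) w = M u w + M v w.
  exact: (etrans (hD _ _) (etrans (deriveDv u v z (sW w)) (f_equal2 +%R (esym (hD _ _)) (esym (hD _ _))))).
have MZl k u v : M (k *: u) v = k * M u v.
  exact: (etrans (hD _ _) (etrans (deriveZv k u z (sW v)) (f_equal ( *%R k) (esym (hD _ _))))).
have MDr u v w : M w (u + v) = M w u + M w v by exact: dotDr.
have MZr k u v : M u (k *: v) = k * M u v by exact: dotZr.
have -> : divS W z = \sum_(e <- basis) M (tproj z e) (tproj z e) by [].
have {}hM v u : M v u = _ := hM v u.
rewrite (trace_tproj z1 MDl MDr MZl MZr).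
clearbody M; clear hD sW MDl MDr MZl MZr W dgrad dW.
(* Each skew field is orthogonal to [z] at [z], so only the Hessian and the Euler term survive in
   the normal direction. *)
have -> : M z z = - 2 * euler F z.
  have alg (a b c i i' j j' k k' n oi oj ok : R) : n = 1 -> oi = 0 -> oj = 0 ->
      ok = 0 -> a = b - c -> a - (b * n + c * n) - (i * oi + i' * oi)
      - (j * oj + j' * oj) - (k * ok + k' * ok) = - 2 * c.
    by move=> -> -> -> -> ->; ring.
  apply: etrans (hM z z) (alg _ _ _ _ _ _ _ _ _ _ _ _ _ z1 (skew_dot z ki)
    (skew_dot z kj) (skew_dot z kk) _).
  exact: dirder_euler.
under eq_bigr do rewrite hM.
rewrite !sumrB (trace_hess_term z sF ki) (trace_hess_term z sF kj).
rewrite (trace_hess_term z sF kk) big_split/= -!mulr_sumr.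
have -> : \sum_(e <- basis) dirder e (euler F) z * dot z e = euler (euler F) z.
  by rewrite [RHS]vf_basisE//; apply: eq_bigr => e _; rewrite mulrC.
have -> : \sum_(e <- basis) dot e e = 8.
  by rewrite !big_cons big_nil /dot /qdot /=; ring.
rewrite /laplace fct_sumE; ring.
Qed.

Lemma subQE F z : smooth F -> S7 z -> subQ F z = subQ_poly F z.
Proof.
move=> sF z1; have [ki kj kk] := skew_V.
have dgrad w u : dot (grad F w) u = 'D_u F w.
  rewrite /grad dot_suml derive_basis//; apply: eq_bigr => e _.
  by rewrite dotZl mulrC dotC.
have -> : subQ F z = - divS (fun w => grad F w - euler F w *: w
    - vf (@Vi R) F w *: Vi w - vf (@Vj R) F w *: Vj w
    - vf (@Vk R) F w *: Vk w) z.
  by congr (- divS _ z); apply/funext => w; rewrite /hproj !dgrad /euler !vfE.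
rewrite divS_horizontal// /subQ_poly /vert_sum !big_cons !big_nil.
set f := euler F; set g := euler f; set h := laplace F.
set a := vf _ _; set b := vf _ _; set c := vf _ _.
rewrite -[RHS]/(g z + 6 * f z - h z + (a z + (b z + (c z + 0)))); ring.
Qed.

End Fields.

Ltac smooth_tac := repeat (lazymatch goal with
  | H : smooth ?F |- smooth ?F => exact H
  | |- smooth (@Algebra.add _ _ _) => refine (smoothD _ _)
  | |- smooth (@GRing.mul _ _ _) => refine (smoothM _ _)
  | |- smooth (@Algebra.opp _ _) => refine (smoothN _)
  | |- smooth (@Algebra.zero _) => exact (smooth_cst 0)
  | |- smooth (@GRing.one _) => exact (smooth_cst 1)
  | |- smooth (cst ?c) => exact (smooth_cst c)
  | |- smooth (fun _ => dot _ ?v) => exact (smooth_dot v)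
  | |- smooth (vf _ _) => refine (smooth_vfield _ _)
  | |- smooth_field (fun _ => ?v) => exact (smooth_field_cst v)
  | |- smooth_field id => exact smooth_field_id
  | |- smooth_field _ => apply: skew_smooth; assumption
  | |- smooth (dirder ?v _) => refine (smooth_dirder v _)
  | |- smooth (euler _) => refine (smooth_euler _)
  | |- smooth (laplace _) => refine (smooth_laplace _)
  | |- smooth (vert_sum _) => refine (smooth_vert_sum _)
  | |- smooth (subQ_poly _) => refine (smooth_subQ_poly _)
  end).

(** * Homogeneous polynomials *)

Section HPoly.
Context {R : realType}.
Local Notation HH := (H2 R).
Local Notation basis := (@Defs.basis R).
Implicit Types (F G : HH -> R) (A V : HH -> HH) (u v w z : HH).

(** Generation by linear forms instead of monomials makes the notion independent of coordinates and
    reduces every fact to an induction with three cases. *)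
Inductive hpoly : nat -> (HH -> R) -> Prop :=
| hpoly_cst (c : R) : hpoly 0 (cst c)
| hpoly_dot k v F : hpoly k F -> hpoly k.+1 ((fun z => dot z v) * F)
| hpolyD k F G : hpoly k F -> hpoly k G -> hpoly k (F + G).

Lemma smooth_hpoly k F : hpoly k F -> smooth F.
Proof.
elim=> [c|{}k v {}F _ sF|{}k {}F G _ sF _ sG]; smooth_tac.
Qed.

Lemma hpolyZ k c F : hpoly k F -> hpoly k (cst c * F).
Proof.
elim=> [c'|{}k v {}F _ sF|{}k {}F G _ sF _ sG].
- exact: hpoly_cst (c * c').
- by rewrite mulrCA; exact: hpoly_dot.
- by rewrite mulrDr; exact: hpolyD.
Qed.

Lemma hpolyN k F : hpoly k F -> hpoly k (- F).
Proof.
move=> hF; have -> : - F = cst (-1) * F; last exact: hpolyZ.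
by apply/funext => z; rewrite -[LHS]mulN1r.
Qed.

Lemma hpolyB k F G : hpoly k F -> hpoly k G -> hpoly k (F - G).
Proof. by move=> hF hG; apply: hpolyD => //; exact: hpolyN. Qed.

Lemma hpoly0 k : hpoly k 0.
Proof.
have h F : hpoly k F -> hpoly k 0 by move=> hF; rewrite -(subrr F); exact: hpolyB.
elim: k h => [|k ih] h; first exact: (hpoly_cst 0).
apply: (h ((fun z => dot z 0) * 0)); apply: hpoly_dot.
by apply: ih => F hF; rewrite -(subrr F); exact: hpolyB.
Qed.

Lemma hpoly_sum k (I : Type) (s : seq I) (f : I -> HH -> R) :
  (forall i, hpoly k (f i)) -> hpoly k (\sum_(i <- s) f i).
Proof.
move=> hf; elim/big_ind : _ => // [|F G]; [exact: hpoly0|exact: hpolyD].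
Qed.

Lemma hpolyM k l F G : hpoly k F -> hpoly l G -> hpoly (k + l) (F * G).
Proof.
move=> hF hG; elim: hF => [c|{}k v {}F _ ih|{}k {}F F' _ ih _ ih'].
- exact: hpolyZ.
- by rewrite -mulrA addSn; exact: hpoly_dot.
- by rewrite mulrDl; exact: hpolyD.
Qed.

Lemma dirder_hpoly0 v F : hpoly 0 F -> dirder v F = 0.
Proof.
suff gen k G : hpoly k G -> k = 0%N -> dirder v G = 0 by move=> /gen; exact.
elim=> {k G} [c|//|k F' G hF ih hG ih'] k0.
- by rewrite /dirder vfield_cst.
- rewrite /dirder vfieldD; [|exact: smooth_hpoly hF|exact: smooth_hpoly hG].
  by rewrite -!/(dirder _ _) ih// ih'// addr0.
Qed.

Lemma hpoly_dirder k v F : hpoly k.+1 F -> hpoly k (dirder v F).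
Proof.
suff gen l G : hpoly l G -> forall k, l = k.+1 -> hpoly k (dirder v G).
  by move=> /gen; exact.
elim=> {k l G F} [//|l u F hF ih|l F G hF ih hG ih'] k k0.
- have sF := smooth_hpoly hF; case: k0 => k0.
  rewrite /dirder vfieldM ?vfield_dot; [|smooth_tac..].
  apply: hpolyD; first by rewrite -k0; exact: hpolyZ.
  case: k k0 => [|k] k0; last by apply: hpoly_dot; exact: ih.
  have -> : vf (fun=> v) F = 0 by apply: dirder_hpoly0; move: hF; rewrite k0.
  by rewrite mulr0; exact: hpoly0.
- have sF := smooth_hpoly hF; have sG := smooth_hpoly hG.
  by rewrite /dirder vfieldD//; apply: hpolyD; [exact: ih|exact: ih'].
Qed.

Lemma hpoly_vf k V F : skew V -> hpoly k F -> hpoly k (vf V F).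
Proof.
move=> kV; elim=> {k F} [c|k u F hF ih|k F G hF ih hG ih'].
- by rewrite vfield_cst; exact: hpoly0.
- have sF := smooth_hpoly hF; rewrite vfieldM ?vfield_dot; [|smooth_tac..].
  apply: hpolyD; last exact: hpoly_dot.
  have -> : (fun z => dot (V z) u) = (fun z => dot z (- V u)).
    by apply/funext => z; rewrite kV dotNr.
  exact: hpoly_dot.
- have sF := smooth_hpoly hF; have sG := smooth_hpoly hG.
  by rewrite vfieldD//; exact: hpolyD.
Qed.

Lemma euler_hpoly k F : hpoly k F -> euler F = cst k%:R * F.
Proof.
elim=> {k F} [c|k u F hF ih|k F G hF ih hG ih'].
- by rewrite /euler vfield_cst (_ : cst 0%:R = 0) ?mul0r.
- have sF := smooth_hpoly hF; rewrite /euler vfieldM ?vfield_dot; [|smooth_tac..].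
  rewrite -/(euler F) ih (_ : cst k.+1%:R = 1 + cst k%:R); first ring.
  by apply/funext => z; rewrite /= -natr1 addrC.
- have sF := smooth_hpoly hF; have sG := smooth_hpoly hG.
  by rewrite /euler vfieldD// -!/(euler _) ih ih' mulrDr.
Qed.

Lemma hpoly_homogeneous k F t z : hpoly k F -> F (t *: z) = t ^+ k * F z.
Proof.
elim=> {k F} [c|k u F hF ih|k F G hF ih hG ih'].
- by rewrite expr0 mul1r.
- rewrite -[LHS]/(dot (t *: z) u * F (t *: z)) ih dotZl exprS.
  rewrite -[X in _ = _ * X]/(dot z u * F z); ring.
- by rewrite -[LHS]/(F (t *: z) + G (t *: z)) ih ih' -mulrDr.
Qed.

Lemma hpoly_laplace k F : hpoly k.+2 F -> hpoly k (laplace F).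
Proof. by move=> hF; apply: hpoly_sum => e; do 2 apply: hpoly_dirder. Qed.

Lemma laplace_hpoly_lt2 k F : (k < 2)%N -> hpoly k F -> laplace F = 0.
Proof.
move=> k2 hF; rewrite /laplace big1// => e _.
case: k k2 hF => [|[|//]] _ hF; last by apply/dirder_hpoly0/hpoly_dirder.
by rewrite (dirder_hpoly0 e hF); exact: (dirder_hpoly0 e (hpoly_cst 0)).
Qed.

Lemma vert_sumE F : vert_sum F = vf (@Vi R) (vf (@Vi R) F)
  + vf (@Vj R) (vf (@Vj R) F) + vf (@Vk R) (vf (@Vk R) F).
Proof. by rewrite /vert_sum !big_cons big_nil addr0 addrA. Qed.

Lemma subQ_poly_hpoly k F : hpoly k F ->
  subQ_poly F = cst (k%:R * (k%:R + 6)) * F - laplace F + vert_sum F.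
Proof.
move=> hF; rewrite /subQ_poly (euler_hpoly hF) /euler.
rewrite vfieldZ; last exact: smooth_hpoly hF.
rewrite -/(euler F) (euler_hpoly hF); congr (_ - _ + _).
by apply/funext => z; rewrite !fctE; ring.
Qed.

End HPoly.

(** * Rotation invariance of the sphere measure *)

Section Shears.
Context {R : realType}.

Lemma lebR_itvoc (a b : R) : lebR `]a, b]%classic = (if a < b then (b - a)%:E else 0%E).
Proof. by rewrite /lebR lebesgue_measure_itv/= lte_fin; case: ifP => //; rewrite EFinB. Qed.

Lemma measurable_shift (t : R) : measurable_fun setT ((fun x => x + t) : measurableTypeR R -> measurableTypeR R).
Proof. by apply: measurable_funD. Qed.

(** The pushforward by a translation agrees with Lebesgue measure on half-open intervals, and these
    determine it. *)
Lemma lebR_shift (t : R) (A : set R) : measurable A ->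
  lebR ((fun x => x + t) @^-1` A) = lebR A.
Proof.
move=> mA; have mA' : @measurable _ (measurableTypeR R) A by exact: mA.
pose mu := measure_function_pushforward__canonical__measure_function_Measure
  (@lebesgue_measure R) (measurable_shift t).
rewrite -[RHS]/(lebesgue_measure (A : set (measurableTypeR R))).
rewrite (@lebesgue_measure_unique R mu _ A mA') => [//|X [[a b] _ <-]] /=.
rewrite /mu/= /pushforward.
have -> : (fun x => x + t) @^-1` `]a, b]%classic = `](a - t), (b - t)]%classic.
  by apply/seteqP; split => x /=; rewrite !in_itv/= ltrBlDr lerBrDr.
rewrite -![lebesgue_measure _]/(lebR _) !lebR_itvoc ltrD2r.
by case: ifP => // _; congr EFin; ring.
Qed.

(* Since [phi] is constant along the orbits of [tau], the map below translates
   each orbit by a constant amount. *)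
Definition shear_invariant d (T : measurableType d) (m : set T -> \bar R)
    (tau : R -> T -> T) :=
  measurable_fun setT (fun p : R * T => tau p.1 p.2) /\
  forall phi : T -> R, measurable_fun setT phi ->
    (forall t x, phi (tau t x) = phi x) ->
    forall A, measurable A -> m ((fun x => tau (phi x) x) @^-1` A) = m A.

Lemma shear_lebR : shear_invariant (@lebR R) (fun t x => x + t).
Proof.
split=> [|phi mphi phiE A mA].
  by apply: measurable_funD; [exact: measurable_snd|exact: measurable_fst].
have e x : phi x = phi 0 by rewrite -{1}(add0r x) phiE.
under eq_fun do rewrite e.
exact: lebR_shift.
Qed.

Section Product.
Context d1 d2 (T1 : measurableType d1) (T2 : measurableType d2).
Variable m1 : {sigma_finite_measure set T1 -> \bar R}.
Variable m2 : {sigma_finite_measure set T2 -> \bar R}.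

(** On the slice over [x] the amount [phi (x, y)] is still invariant under [tau], so every section
    keeps its measure; the amount may vary freely with [x]. *)
Lemma shear_prod2 tau : shear_invariant m2 tau ->
  shear_invariant (m1 \x m2)%E (fun t p => (p.1, tau t p.2)).
Proof.
move=> [mtau htau]; split=> [|phi mphi phiE A mA].
  apply: measurable_fun_pair => /=.
    exact: (measurableT_comp measurable_fst measurable_snd).
  exact: (measurableT_comp mtau (measurable_fun_pair measurable_fst
    (measurableT_comp measurable_snd measurable_snd))).
rewrite /product_measure1; apply: eq_integral => x _ /=.
rewrite -[RHS](htau (fun y => phi (x, y)))//.
- exact: (measurableT_comp mphi (measurable_fun_pair (measurable_cst x) (@measurable_id _ _ _))).
- by move=> t y; rewrite -[RHS](phiE t).
- exact: measurable_xsection.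
Qed.

Lemma product_measure1_ysection A : measurable A ->
  (m1 \x m2)%E A = (\int[m2]_y m1 (ysection A y))%E.
Proof.
move=> mA; have := indic_fubini_tonelli m1 m2 mA.
by rewrite indic_fubini_tonelli_FE// indic_fubini_tonelli_GE.
Qed.

(** The same argument on the other sections, after Tonelli has exchanged the order of
    integration. *)
Lemma shear_prod1 tau : shear_invariant m1 tau ->
  shear_invariant (m1 \x m2)%E (fun t p => (tau t p.1, p.2)).
Proof.
move=> [mtau htau].
have mT : measurable_fun setT (fun p : R * (T1 * T2) => (tau p.1 p.2.1, p.2.2)).
  apply: measurable_fun_pair => /=.
    exact: (measurableT_comp mtau (measurable_fun_pair measurable_fst
      (measurableT_comp measurable_fst measurable_snd))).
  exact: (measurableT_comp measurable_snd measurable_snd).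
split=> // phi mphi phiE A mA.
have mS : measurable_fun setT (fun p : T1 * T2 => (tau (phi p) p.1, p.2)).
  exact: (measurableT_comp mT (measurable_fun_pair mphi (@measurable_id _ _ _))).
rewrite !product_measure1_ysection//; last first.
  by rewrite -[X in measurable X]setTI; exact: mS.
apply: eq_integral => y _ /=.
rewrite -[RHS](htau (fun x => phi (x, y)))//.
- exact: (measurableT_comp mphi (measurable_fun_pair (@measurable_id _ _ _) (measurable_cst y))).
- by move=> t x; rewrite -[RHS](phiE t).
- exact: measurable_ysection.
Qed.

End Product.

Local Notation H := (quat R).
Local Notation HH := (H2 R).

Lemma eq_shear d (T : measurableType d) (m : set T -> \bar R) tau tau' :
  (forall t x, tau t x = tau' t x) -> shear_invariant m tau -> shear_invariant m tau'.
Proof.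
move=> e; suff -> : tau = tau' by [].
by apply/funext => t; apply/funext.
Qed.

Lemma shear_leb4 : [/\
  shear_invariant (@leb4 R) (fun t p => (p.1.1.1 + t, p.1.1.2, p.1.2, p.2)),
  shear_invariant (@leb4 R) (fun t p => (p.1.1.1, p.1.1.2 + t, p.1.2, p.2)),
  shear_invariant (@leb4 R) (fun t p => (p.1.1.1, p.1.1.2, p.1.2 + t, p.2)) &
  shear_invariant (@leb4 R) (fun t p => (p.1.1.1, p.1.1.2, p.1.2, p.2 + t))].
Proof.
have s1 := shear_lebR.
pose l1 : {sigma_finite_measure set R -> \bar R} := @lebR R.
have f2 : sigma_finite setT (l1 \x l1)%E.
  exact: sigma_finite_product (sigma_finiteT l1).
pose l2 : {sigma_finite_measure set (R * R)%type -> \bar R} :=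
  HB.pack (l1 \x l1)%E (Measure_isSigmaFinite.Build _ _ _ (l1 \x l1)%E f2).
have f3 : sigma_finite setT (l2 \x l1)%E.
  exact: sigma_finite_product (sigma_finiteT l2).
pose l3 : {sigma_finite_measure set (R * R * R)%type -> \bar R} :=
  HB.pack (l2 \x l1)%E (Measure_isSigmaFinite.Build _ _ _ (l2 \x l1)%E f3).
have a1 : shear_invariant l2 (fun t p => (p.1 + t, p.2)) := @shear_prod1 _ _ _ _ l1 l1 _ s1.
have a2 : shear_invariant l2 (fun t p => (p.1, p.2 + t)) := @shear_prod2 _ _ _ _ l1 l1 _ s1.
have b1 := @shear_prod1 _ _ _ _ l2 l1 _ a1.
have b2 := @shear_prod1 _ _ _ _ l2 l1 _ a2.
have b3 := @shear_prod2 _ _ _ _ l2 l1 _ s1.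
have c1 := @shear_prod1 _ _ _ _ l3 l1 _ b1.
have c2 := @shear_prod1 _ _ _ _ l3 l1 _ b2.
have c3 := @shear_prod1 _ _ _ _ l3 l1 _ b3.
have c4 := @shear_prod2 _ _ _ _ l3 l1 _ s1.
split; [apply: eq_shear c1|apply: eq_shear c2|apply: eq_shear c3|apply: eq_shear c4];
  by move=> t [[[? ?] ?] ?].
Qed.

Lemma shear_leb8 e : e \in (Defs.basis : seq HH) ->
  shear_invariant (@leb8 R) (fun t z => z + t *: e).
Proof.
have [s1 s2 s3 s4] := shear_leb4.
pose l4 : {sigma_finite_measure set H -> \bar R} := @leb4 R.
have c1 := @shear_prod1 _ _ _ _ l4 l4 _ s1.
have c2 := @shear_prod1 _ _ _ _ l4 l4 _ s2.
have c3 := @shear_prod1 _ _ _ _ l4 l4 _ s3.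
have c4 := @shear_prod1 _ _ _ _ l4 l4 _ s4.
have c5 := @shear_prod2 _ _ _ _ l4 l4 _ s1.
have c6 := @shear_prod2 _ _ _ _ l4 l4 _ s2.
have c7 := @shear_prod2 _ _ _ _ l4 l4 _ s3.
have c8 := @shear_prod2 _ _ _ _ l4 l4 _ s4.
rewrite !inE => /orP[|/orP[|/orP[|/orP[|/orP[|/orP[|/orP[|]]]]]]] /eqP ->;
  [apply: eq_shear c1|apply: eq_shear c2|apply: eq_shear c3|apply: eq_shear c4
  |apply: eq_shear c5|apply: eq_shear c6|apply: eq_shear c7|apply: eq_shear c8];
  move=> t [[[[? ?] ?] ?] [[[? ?] ?] ?]]; apply: HH_ext; rewrite /= /GRing.scale /=; ring.
Qed.

End Shears.

(** * Measurability of continuous functions on R^8 *)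

Section Sphere.
Context {R : realType}.
Local Notation H := (quat R).
Local Notation HH := (H2 R).
Implicit Types (F G : HH -> R) (u v w z : HH).

Lemma measurable_coord : let co := fun f : HH -> R => measurable_fun setT f in
  [/\ co (fun z : HH => z.1.1.1.1), co (fun z : HH => z.1.1.1.2),
      co (fun z : HH => z.1.1.2) & co (fun z : HH => z.1.2)] /\
  [/\ co (fun z : HH => z.2.1.1.1), co (fun z : HH => z.2.1.1.2),
      co (fun z : HH => z.2.1.2) & co (fun z : HH => z.2.2)].
Proof.
have mfst d1 d2 (T1 : measurableType d1) (T2 : measurableType d2)
    (f : HH -> T1 * T2) :
    measurable_fun setT f -> measurable_fun setT (fun z => (f z).1).
  by move=> mf; exact: (measurableT_comp measurable_fst mf).
have msnd d1 d2 (T1 : measurableType d1) (T2 : measurableType d2)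
    (f : HH -> T1 * T2) :
    measurable_fun setT f -> measurable_fun setT (fun z => (f z).2).
  by move=> mf; exact: (measurableT_comp measurable_snd mf).
have m1 : measurable_fun setT (fun z : HH => z.1) by exact: measurable_fst.
have m2 : measurable_fun setT (fun z : HH => z.2) by exact: measurable_snd.
split; split.
- exact: (mfst _ _ _ _ _ (mfst _ _ _ _ _ (mfst _ _ _ _ _ m1))).
- exact: (msnd _ _ _ _ _ (mfst _ _ _ _ _ (mfst _ _ _ _ _ m1))).
- exact: (msnd _ _ _ _ _ (mfst _ _ _ _ _ m1)).
- exact: (msnd _ _ _ _ _ m1).
- exact: (mfst _ _ _ _ _ (mfst _ _ _ _ _ (mfst _ _ _ _ _ m2))).
- exact: (msnd _ _ _ _ _ (mfst _ _ _ _ _ (mfst _ _ _ _ _ m2))).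
- exact: (msnd _ _ _ _ _ (mfst _ _ _ _ _ m2)).
- exact: (msnd _ _ _ _ _ m2).
Qed.

Lemma measurable_dotr v : measurable_fun setT (fun z : HH => dot z v).
Proof.
have [[m1 m2 m3 m4] [m5 m6 m7 m8]] := measurable_coord.
rewrite (_ : (fun z => _) = fun z : HH =>
    z.1.1.1.1 * v.1.1.1.1 + z.1.1.1.2 * v.1.1.1.2 + z.1.1.2 * v.1.1.2
    + z.1.2 * v.1.2 + (z.2.1.1.1 * v.2.1.1.1 + z.2.1.1.2 * v.2.1.1.2
    + z.2.1.2 * v.2.1.2 + z.2.2 * v.2.2)); last first.
  by apply/funext; move: v => [[[[? ?] ?] ?] [[[? ?] ?] ?]] [[[[? ?] ?] ?] [[[? ?] ?] ?]].
by do ?[apply: measurable_funD | apply: measurable_funM].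
Qed.

Definition grid (n : nat) (x : R) : R := (Num.floor (n.+1%:R * x))%:~R / n.+1%:R.

Lemma grid_cvg x : grid n x @[n --> \oo] --> x.
Proof.
apply/subr_cvg0.
have h n : - (n.+1%:R)^-1 <= grid n x - x <= 0.
  have n0 : (0 : R) < n.+1%:R by rewrite ltr0n.
  have /andP[h1 h2] := floor_itv (n.+1%:R * x).
  rewrite intrD in h2.
  rewrite subr_le0 /grid ler_pdivrMr// [x * _]mulrC h1 andbT.
  rewrite lerBrDr ler_pdivlMr// mulrDl mulNr mulVf ?gt_eqF// [x * _]mulrC.
  by rewrite addrC lerBlDr ltW.
have hN : - (n.+1%:R^-1 : R) @[n --> \oo] --> (0 : R).
  by rewrite -[X in _ --> X]oppr0; apply: cvgN; exact: cvg_harmonic.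
have h0 : (0 : R) @[n --> \oo] --> (0 : R) by exact: cvg_cst.
by apply: (squeeze_cvgr _ hN h0); exact: nearW.
Qed.

(* A continuous [F] is the pointwise limit of the countably valued functions
   [F \o hgrid n]; this makes it measurable for the product sigma-algebra. *)
Definition hgrid n (z : HH) : HH :=
  ((grid n z.1.1.1.1, grid n z.1.1.1.2, grid n z.1.1.2, grid n z.1.2),
   (grid n z.2.1.1.1, grid n z.2.1.1.2, grid n z.2.1.2, grid n z.2.2)).

Lemma hgrid_cvg z : hgrid n z @[n --> \oo] --> z.
Proof.
have -> : z = ((z.1.1.1.1, z.1.1.1.2, z.1.1.2, z.1.2),
    (z.2.1.1.1, z.2.1.1.2, z.2.1.2, z.2.2)).
  by case: z => [[[[? ?] ?] ?] [[[? ?] ?] ?]].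
have cp (U V : topologicalType) (f : nat -> U) (g : nat -> V) (a : U) (b : V) :
    f n @[n --> \oo] --> a -> g n @[n --> \oo] --> b ->
    (f n, g n) @[n --> \oo] --> (a, b).
  by move=> fa gb; exact: cvg_pair fa gb.
have g4 (a b c d : R) : ((grid n a, grid n b, grid n c, grid n d) : H) @[n --> \oo]
    --> ((a, b, c, d) : H).
  have h2 := @cp R R (fun n => grid n a) (fun n => grid n b) a b (@grid_cvg a) (@grid_cvg b).
  have h3 := @cp (R * R)%type R _ (fun n => grid n c) _ c h2 (@grid_cvg c).
  exact: (@cp (R * R * R)%type R _ (fun n => grid n d) _ d h3 (@grid_cvg d)).
exact: (@cp H H _ _ _ _ (g4 _ _ _ _) (g4 _ _ _ _)).
Qed.

Local Notation Z4 := (int * int * int * int)%type.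

Lemma measurable_hgrid n F : measurable_fun setT (F \o hgrid n).
Proof.
pose fl x := Num.floor (n.+1%:R * x : R).
pose k (z : HH) : Z4 * Z4 :=
  ((fl z.1.1.1.1, fl z.1.1.1.2, fl z.1.1.2, fl z.1.2),
   (fl z.2.1.1.1, fl z.2.1.1.2, fl z.2.1.2, fl z.2.2)).
pose g (i : int) : R := i%:~R / n.+1%:R.
pose iota (i : Z4 * Z4) : HH :=
  ((g i.1.1.1.1, g i.1.1.1.2, g i.1.1.2, g i.1.2),
   (g i.2.1.1.1, g i.2.1.1.2, g i.2.1.2, g i.2.2)).
have mfl (f : HH -> R) i : measurable_fun setT f -> measurable [set z | fl (f z) = i].
  move=> mf; have n0 : (0 : R) < n.+1%:R by rewrite ltr0n.
  rewrite (_ : [set z | _] = f @^-1` [set` `[g i, g (i + 1)[]); last first.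
    apply/seteqP; split => z /=; rewrite in_itv/= /g ler_pdivrMr// ltr_pdivlMr// !(mulrC (f z)).
      by move=> <-; exact: floor_itv.
    exact: floor_def.
  by rewrite -[X in measurable X]setTI; exact: mf.
have mk i : measurable [set z | k z = i].
  have [[m1 m2 m3 m4] [m5 m6 m7 m8]] := measurable_coord.
  move: i => [[[[i1 i2] i3] i4] [[[i5 i6] i7] i8]].
  rewrite (_ : [set z | _] = [set z : HH | fl z.1.1.1.1 = i1] `&` [set z : HH | fl z.1.1.1.2 = i2]
    `&` [set z : HH | fl z.1.1.2 = i3] `&` [set z : HH | fl z.1.2 = i4]
    `&` ([set z : HH | fl z.2.1.1.1 = i5] `&` [set z : HH | fl z.2.1.1.2 = i6]
    `&` [set z : HH | fl z.2.1.2 = i7] `&` [set z : HH | fl z.2.2 = i8])).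
    by do ?apply: measurableI; exact: mfl.
  by apply/seteqP; split => z /=; rewrite /k; [case|case=> -[[[-> ->] ->] ->] [[[-> ->] ->] ->]].
move=> _ Y mY; rewrite setTI.
(* The cells of the grid are countably many measurable boxes, and the composite takes the constant
   value [F (iota i)] on the cell [i]. *)
rewrite (_ : _ @^-1` Y = \bigcup_i ([set z | k z = i] `&` [set z | Y (F (iota i))])).
  apply: countable_bigcupT_measurable => // i; apply: measurableI => //.
  have [hY|hY] := pselect (Y (F (iota i))).
    by rewrite (_ : [set z | _] = setT)//; apply/seteqP; split.
  by rewrite (_ : [set z | _] = set0)//; apply/seteqP; split.
apply/seteqP; split => [z Yz|z [i _ [<-]]//].
by exists (k z) => //; split.
Qed.

Lemma continuous_measurable F : continuous F -> measurable_fun setT F.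
Proof.
move=> cF; apply: (@measurable_fun_cvg _ _ _ setT (fun n => F \o hgrid n)).
  by move=> n; exact: measurable_hgrid.
move=> z _; apply: continuous_cvg; [exact: cF|exact: hgrid_cvg].
Qed.

Lemma smooth_continuous F : smooth F -> continuous F.
Proof. by move=> sF z; apply: differentiable_continuous; exact: smooth_diff. Qed.

Lemma smooth_measurable F : smooth F -> measurable_fun setT F.
Proof. by move=> /smooth_continuous; exact: continuous_measurable. Qed.

Lemma basis_orth e e' : e \in (Defs.basis : seq HH) -> e' \in (Defs.basis : seq HH) ->
  e != e' -> dot e e' = 0.
Proof.
rewrite !inE.
by do 7?[case/orP]; move=> /eqP ->; do 7?[case/orP]; move=> /eqP ->;
  rewrite ?eqxx// => _; rewrite /dot /qdot /=; ring.
Qed.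

Lemma basis_norm e : e \in (Defs.basis : seq HH) -> dot e e = 1.
Proof.
rewrite !inE.
by do 7?[case/orP]; move=> /eqP ->; rewrite /dot /qdot /=; ring.
Qed.

End Sphere.

(** * Plane rotations preserve the sphere measure *)

Section Rotation.
Context {R : realType}.
Local Notation H := (quat R).
Local Notation HH := (H2 R).
Local Notation basis := (Defs.basis : seq HH).
Local Notation sigma := (@sphere_measure R).
Implicit Types (F G : HH -> R) (u v w z e : HH).

Definition shear e e' (a : R) z : HH := z + (a * dot z e') *: e.

Lemma shear_leb8P e e' a : e \in basis -> e' \in basis -> e != e' ->
  measurable_fun setT (shear e e' a) /\
  forall A, measurable A -> leb8 (shear e e' a @^-1` A) = leb8 A.
Proof.
move=> be be' ee'; have [mt ht] := shear_leb8 be.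
have mphi : measurable_fun setT (fun z => a * dot z e').
  by apply: measurable_funM => //; exact: measurable_dotr.
split.
  exact: (measurableT_comp mt (measurable_fun_pair mphi (@measurable_id _ _ _))).
move=> A mA; apply: (ht (fun z => a * dot z e')) => // t z.
by rewrite dotDl dotZl (basis_orth be be' ee') mulr0 addr0.
Qed.

(** For orthonormal [e] and [e'], the rotation of their plane with cosine [c] and sine [s], written
    as a correction to the identity so that the orthogonal complement is visibly fixed. *)
Definition rot e e' (c s : R) z : HH :=
  z + ((c - 1) * dot z e - s * dot z e') *: e + (s * dot z e + (c - 1) * dot z e') *: e'.

(* Rotations preserve Lebesgue measure because shears do. *)
Lemma rot_shear e e' c s z : dot e e = 1 -> dot e' e' = 1 -> dot e e' = 0 ->
  c ^+ 2 + s ^+ 2 = 1 -> s != 0 ->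
  rot e e' c s z = shear e e' ((c - 1) / s) (shear e' e s (shear e e' ((c - 1) / s) z)).
Proof.
move=> e1 e'1 ee' cs s0.
have c2 : c ^+ 2 = 1 - s ^+ 2 by rewrite -cs; ring.
(* For an angle with cosine [c] and sine [s], the coefficient [(c - 1) / s] is minus the tangent of
   the half angle. *)
rewrite /shear !(dotDl, dotZl) e1 e'1 ee' /rot.
set p := dot z e; set q := dot z e'.
have E (x y x' y' : R) : x = x' -> y = y' ->
    z + x *: e + y *: e' = z + x' *: e + y' *: e' by move=> -> ->.
transitivity (z + ((c - 1) / s * q + (c - 1) / s * (q + (c - 1) / s * q * 0
    + s * (p + (c - 1) / s * q * 1) * 1)) *: e + (s * (p + (c - 1) / s * q * 1)) *: e').
  apply: E; last by field.
  rewrite mulr0 addr0 !mulr1.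
  have -> : (c - 1) / s * q + (c - 1) / s * (q + s * (p + (c - 1) / s * q))
    = (c - 1) * p + (c ^+ 2 - 1) / s * q by field.
  by rewrite c2; field.
by rewrite [X in z + X + _]scalerDl -!addrA; congr (_ + (_ + _)); rewrite addrC.
Qed.

Lemma rotP e e' c s : e \in basis -> e' \in basis -> e != e' ->
  c ^+ 2 + s ^+ 2 = 1 -> s != 0 ->
  measurable_fun setT (rot e e' c s) /\
  forall A, measurable A -> leb8 (rot e e' c s @^-1` A) = leb8 A.
Proof.
move=> be be' ee' cs s0.
have [m1 h1] := shear_leb8P ((c - 1) / s) be be' ee'.
have e'e : e' != e by rewrite eq_sym.
have [m2 h2] := shear_leb8P s be' be e'e.
have -> : rot e e' c s = shear e e' ((c - 1) / s) \o (shear e' e s \o shear e e' ((c - 1) / s)).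
  by apply/funext => z; rewrite rot_shear ?(basis_norm be) ?(basis_norm be') ?(basis_orth be be' ee').
split; first exact: (measurableT_comp m1 (measurableT_comp m2 m1)).
move=> A mA; rewrite !comp_preimage h1.
  by rewrite h2 ?h1// -[X in measurable X]setTI; exact: m1.
rewrite -[X in measurable X]setTI; apply: m2 => //.
by rewrite -[X in measurable X]setTI; exact: m1.
Qed.

Lemma dot_rot e e' c s z w : dot e e = 1 -> dot e' e' = 1 -> dot e e' = 0 ->
  c ^+ 2 + s ^+ 2 = 1 -> dot (rot e e' c s z) (rot e e' c s w) = dot z w.
Proof.
move=> e1 e'1 ee' cs; have e'e : dot e' e = 0 by rewrite dotC.
have s2 : s ^+ 2 = 1 - c ^+ 2 by rewrite -cs; ring.
rewrite /rot !(dotDl, dotDr, dotZl, dotZr) e1 e'1 ee' e'e.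
rewrite !(dotC e) !(dotC e').
set p := dot z e; set q := dot z e'; set p' := dot w e; set q' := dot w e'.
(* The two sides differ by this multiple of [s ^+ 2 + c ^+ 2 - 1]; adding it as a zero turns the
   goal into a ring identity. *)
have E : forall x, x + (s ^+ 2 + c ^+ 2 - 1) * (p * p' + q * q') = x.
  by move=> x; rewrite s2; ring.
rewrite -[RHS]E; ring.
Qed.

Lemma rotZ e e' c s (k : R) z : rot e e' c s (k *: z) = k *: rot e e' c s z.
Proof.
rewrite /rot !dotZl; set p := dot z e; set q := dot z e'.
have -> : (c - 1) * (k * p) - s * (k * q) = k * ((c - 1) * p - s * q) by ring.
have -> : s * (k * p) + (c - 1) * (k * q) = k * (s * p + (c - 1) * q) by ring.
by rewrite -(scalerA k _ e) -(scalerA k _ e') -scalerDr -scalerDr.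
Qed.

Lemma sphere_measureE (A : set HH) :
  sigma A = (8%:E * leb8 ((radial @^-1` A) `&` pball))%E.
Proof. by []. Qed.

(** A rotation commutes with the radial projection and preserves the punctured ball, so the cone
    over the preimage is the preimage of the cone. *)
Lemma sphere_measure_rot e e' c s : e \in basis -> e' \in basis -> e != e' ->
  c ^+ 2 + s ^+ 2 = 1 -> s != 0 ->
  forall A, measurable A -> sigma (rot e e' c s @^-1` A) = sigma A.
Proof.
move=> be be' ee' cs s0 A mA; have [mr hr] := rotP be be' ee' cs s0.
have dr z : dot (rot e e' c s z) (rot e e' c s z) = dot z z.
  by rewrite dot_rot ?(basis_norm be) ?(basis_norm be') ?(basis_orth be be' ee').
rewrite !sphere_measureE -[in RHS]hr.
  congr (_ * leb8 _)%E; apply/seteqP; split=> z /=;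
    rewrite /pball /= dr /radial dr rotZ//.
apply: measurableI; last exact: measurable_pball.
by rewrite -[X in measurable X]setTI; exact: measurable_radial.
Qed.

Lemma measurable_S7 : measurable (S7 : set HH).
Proof.
rewrite (_ : S7 = (fun z : HH => dot z z) @^-1` [set 1]); last by [].
by rewrite -[X in measurable X]setTI; apply: measurable_dot.
Qed.

Lemma radial_S7 z : pball z -> S7 (radial z).
Proof.
move=> /= /andP[z0 _]; rewrite /S7/= /radial dotZl dotZr mulrA -invfM -expr2.
by rewrite sqr_sqrtr ?ltW// mulVf// gt_eqF.
Qed.

Lemma sphere_measure_compl : sigma (~` S7) = 0%E.
Proof.
rewrite sphere_measureE (_ : _ `&` _ = set0) ?measure0 ?mule0//.
by apply/seteqP; split=> // z [/= + /radial_S7].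
Qed.

Definition cube1 (a : R) : set R := `[- a, a]%classic.
Definition cube4 a : set H := cube1 a `*` cube1 a `*` cube1 a `*` cube1 a.
Definition cube8 a : set HH := cube4 a `*` cube4 a.

Lemma measurable_cube1 a : measurable (cube1 a).
Proof. exact: measurable_itv. Qed.

Lemma measurable_cube4 a : measurable (cube4 a).
Proof.
have m := measurable_cube1 a.
exact: measurableX (measurableX (measurableX m m) m) m.
Qed.

Lemma measurable_cube8 a : measurable (cube8 a).
Proof. by apply: measurableX; exact: measurable_cube4. Qed.

Lemma pball_cube : pball `<=` cube8 1.
Proof.
have sq (x y : R) : x * x + y <= 1 -> 0 <= y -> cube1 1 x.
  move=> h y0; rewrite /cube1/= in_itv/= -ler_norml -(@ler_pXn2r _ 2)// ?nnegrE//.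
  by rewrite expr1n real_normK ?num_real// expr2; lra.
move=> [[[[a b] c] d] [[[e f] g] h]] /= /andP[_]; rewrite /dot /qdot /= => le1.
have p (x : R) : 0 <= x * x by rewrite -expr2 sqr_ge0.
have := (p a, p b, p c, p d, (p e, p f, p g, p h)).
by move=> [[[[pa pb] pc] pd] [[[pe pf] pg] ph]];
  do ?split => /=; [
  apply: (sq _ (b*b+c*c+d*d+e*e+f*f+g*g+h*h))
  |apply: (sq _ (a*a+c*c+d*d+e*e+f*f+g*g+h*h))
  |apply: (sq _ (b*b+a*a+d*d+e*e+f*f+g*g+h*h))
  |apply: (sq _ (b*b+c*c+a*a+e*e+f*f+g*g+h*h))
  |apply: (sq _ (b*b+c*c+d*d+a*a+f*f+g*g+h*h))
  |apply: (sq _ (b*b+c*c+d*d+e*e+a*a+g*g+h*h))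
  |apply: (sq _ (b*b+c*c+d*d+e*e+f*f+a*a+h*h))
  |apply: (sq _ (b*b+c*c+d*d+e*e+f*f+g*g+a*a))]; lra.
Qed.

Lemma leb8_cube a : 0 <= a -> leb8 (cube8 a) = ((a *+ 2) ^+ 8)%:E.
Proof.
move=> a0.
have m1 := measurable_cube1 a.
have l1 : lebR (cube1 a) = (a *+ 2)%:E.
  rewrite /lebR /cube1 lebesgue_measure_itv/= lte_fin.
  have [a1|a1] := ltP (- a) a; first by rewrite -EFinB opprK.
  have -> : a = 0 by apply/eqP; rewrite eq_le a0 andbT; lra.
  by rewrite mul0rn.
have m4 := measurable_cube4 a.
have l4 : leb4 (cube4 a) = ((a *+ 2) ^+ 4)%:E.
  have m2 := measurableX m1 m1; have m3 := measurableX m2 m1.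
  have e2 : (@lebR R \x @lebR R)%E (cube1 a `*` cube1 a) = ((a *+ 2) ^+ 2)%:E.
    apply: etrans (product_measure1E _ _ m1 m1) _.
    by rewrite [X in (X * _)%E]l1 [X in (_ * X)%E]l1 -EFinM.
  have e3 : (@lebR R \x @lebR R \x @lebR R)%E (cube1 a `*` cube1 a `*` cube1 a)
      = ((a *+ 2) ^+ 3)%:E.
    apply: etrans (product_measure1E _ _ m2 m1) _.
    by rewrite [X in (X * _)%E]e2 [X in (_ * X)%E]l1 -EFinM -exprSr.
  apply: etrans (product_measure1E _ _ m3 m1) _.
  by rewrite [X in (X * _)%E]e3 [X in (_ * X)%E]l1 -EFinM -exprSr.
apply: etrans (product_measure1E _ _ m4 m4) _.
by rewrite [X in (X * _)%E]l4 [X in (_ * X)%E]l4 -EFinM -exprD.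
Qed.

Lemma sphere_measure_fin : (sigma setT < +oo)%E.
Proof.
rewrite sphere_measureE preimage_setT setTI.
have h : (leb8 (@pball R) <= leb8 (cube8 1))%E.
  apply: le_measure; rewrite ?inE; [exact: measurable_pball| |exact: pball_cube].
  exact: measurable_cube8.
rewrite lte_mul_pinfty//; apply: le_lt_trans h _.
by rewrite leb8_cube// ltry.
Qed.

End Rotation.

(** * Integration over S^7 and rotation fields *)

Section Integral.
Context {R : realType}.
Local Notation H := (quat R).
Local Notation HH := (H2 R).
Local Notation basis := (Defs.basis : seq HH).
Local Notation sigma := (@sphere_measure R).
Implicit Types (F G : HH -> R) (u v w z e : HH).

Lemma dot_np : dot (np : HH) np = 1.
Proof. by rewrite /dot /qdot /=; ring. Qed.

Lemma sqnormE : (fun z => dot z z) = \sum_(e <- basis) (fun z => dot z e) * (fun z => dot z e).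
Proof. by apply/funext => z; rewrite fct_sumE -[RHS]/(\sum_(e <- basis) dot z e * dot z e) dot_basis. Qed.

Lemma compact_S7 : compact (S7 : set HH).
Proof.
have c1 : compact (cube1 1 : set R) by exact: segment_compact.
have c4 : compact (cube4 1 : set H).
  exact: (compact_setX (compact_setX (compact_setX c1 c1) c1) c1).
have c8 : compact (cube8 1 : set HH) by exact: (compact_setX c4 c4).
apply: subclosed_compact c8 _.
  rewrite (_ : S7 = (fun z : HH => dot z z) @^-1` [set 1]); last by [].
  apply: closed_comp => [z _|]; last exact: closed_eq.
  rewrite sqnormE; apply: smooth_continuous.
  by apply: smooth_sum => e; smooth_tac.
move=> z z1; apply: pball_cube; rewrite /pball/=.
have -> : dot z z = 1 by exact: z1.
by rewrite ltr01 lexx.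
Qed.

Lemma S7_bounded F : continuous F -> exists2 M : R, 0 <= M & forall z, S7 z -> `|F z| <= M.
Proof.
move=> cF; have [||c _ h] := @compact_EVT_max _ R (fun z => `|F z|) S7 _ compact_S7.
- by exists np; exact: dot_np.
- apply: continuous_subspaceT => z; apply: continuous_comp; [exact: cF|exact: norm_continuous].
by exists `|F c| => // z z1; apply: h; rewrite inE.
Qed.

(** The admissible integrands: this class is closed under ring operations, contains smooth functions
    and indicators, and is integrable because the sphere has finite measure. *)
Definition bm F := measurable_fun setT F /\ exists M : R, forall z, S7 z -> `|F z| <= M.

Lemma smooth_bm F : smooth F -> bm F.
Proof.
move=> sF; split; first exact: smooth_measurable.
by have [M _ hM] := S7_bounded (smooth_continuous sF); exists M.
Qed.

Lemma bmD F G : bm F -> bm G -> bm (F + G).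
Proof.
move=> [mF [M hM]] [mG [N hN]]; split; first exact: measurable_funD.
exists (M + N) => z z1; apply: le_trans (ler_normD _ _) _.
by apply: lerD; [exact: hM|exact: hN].
Qed.

Lemma bmM F G : bm F -> bm G -> bm (F * G).
Proof.
move=> [mF [M hM]] [mG [N hN]]; split; first exact: measurable_funM.
exists (M * N) => z z1; rewrite normrM.
by apply: ler_pM => //; [exact: hM|exact: hN].
Qed.

Lemma bm_cst (c : R) : bm (cst c).
Proof. by split; [exact: measurable_cst|exists `|c|]. Qed.

Lemma sigma_S7_fin : (sigma S7 < +oo)%E.
Proof.
apply: le_lt_trans sphere_measure_fin.
by apply: le_measure; rewrite ?inE//; exact: measurable_S7.
Qed.

Lemma integrable_bm F : bm F -> sigma.-integrable S7 (EFin \o F).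
Proof.
move=> [mF [M hM]]; apply: measurable_bounded_integrable.
- exact: measurable_S7.
- exact: sigma_S7_fin.
- exact: measurable_funTS.
- by exists M; split; [exact: num_real|move=> N MN z z1; apply: le_trans (hM z z1) (ltW MN)].
Qed.

Definition sint F : R := (\int[sigma]_(z in S7) F z)%R.

Lemma sintD F G : bm F -> bm G -> sint (F + G) = sint F + sint G.
Proof. by move=> bF bG; apply: RintegralD; [exact: measurable_S7|exact: integrable_bm..]. Qed.

Lemma sintZ c F : bm F -> sint (cst c * F) = c * sint F.
Proof. by move=> bF; apply: RintegralZl; [exact: measurable_S7|exact: integrable_bm]. Qed.

Lemma sint_eq F G : (forall z, S7 z -> F z = G z) -> sint F = sint G.
Proof. by move=> e; apply: eq_Rintegral => z; rewrite inE; exact: e. Qed.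

Lemma sint_ge0 F : (forall z, S7 z -> 0 <= F z) -> 0 <= sint F.
Proof. exact: Rintegral_ge0. Qed.

Lemma sint_le F G : bm F -> bm G -> (forall z, S7 z -> F z <= G z) -> sint F <= sint G.
Proof. by move=> bF bG; apply: le_Rintegral; [exact: measurable_S7|exact: integrable_bm..]. Qed.

Lemma S7_rot e e' c s z : e \in basis -> e' \in basis -> e != e' ->
  c ^+ 2 + s ^+ 2 = 1 -> S7 (rot e e' c s z) <-> S7 z.
Proof.
move=> be be' ee' cs.
by rewrite /S7/= dot_rot ?(basis_norm be) ?(basis_norm be') ?(basis_orth be be' ee').
Qed.

Lemma sint_rot e e' c s F : e \in basis -> e' \in basis -> e != e' ->
  c ^+ 2 + s ^+ 2 = 1 -> s != 0 -> bm F -> bm (F \o rot e e' c s) ->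
  sint (F \o rot e e' c s) = sint F.
Proof.
move=> be be' ee' cs s0 bF bFr; have [mr _] := rotP be be' ee' cs s0.
have mF : measurable_fun setT (EFin \o F) by apply/measurable_EFinP; case: bF.
have pS : rot e e' c s @^-1` S7 = S7.
  by apply/seteqP; split=> z /= h; [move/(S7_rot z be be' ee' cs): h|apply/(S7_rot z be be' ee' cs)].
have h : sigma.-integrable (rot e e' c s @^-1` S7) ((EFin \o F) \o rot e e' c s).
  by rewrite pS; exact: integrable_bm.
congr fine; have := integral_pushforward mr mF h measurable_S7.
rewrite pS => <-; apply: eq_measure_integral => A mA _.
exact: sphere_measure_rot.
Qed.

Section Curve.
Variables e e' z : HH.
Hypotheses (be : e \in basis) (be' : e' \in basis) (ee' : e != e').
Let gam (t : R) : HH := rot e e' (cos t) (sin t) z.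

(** The generator of the rotations of the plane of [e] and [e']; the orbit [gam] is its integral
    curve. *)
Definition rot_field w : HH := dot w e *: e' - dot w e' *: e.

Lemma derive_scale (k : R -> R) (v : HH) (t dk : R) : is_derive t (1 : R) k dk ->
  differentiable (fun t => k t *: v) t /\ 'D_1 (fun t => k t *: v) t = dk *: v.
Proof.
move=> kd; have dkt : differentiable k t by apply/derivable1_diffP; case: kd.
split; first exact: differentiableZl.
rewrite deriveE; last exact: differentiableZl.
by rewrite diffZl// -deriveE//; congr (_ *: _); case: kd.
Qed.

Lemma rot_curve t : differentiable gam t /\ 'D_1 gam t = rot_field (gam t).
Proof.
set p := dot z e; set q := dot z e'.
have i1 : is_derive t 1 (fun t => (cos t - 1) * p - sin t * q) (- sin t * p - cos t * q).
  by apply: is_derive_eq; rewrite /GRing.scale/=; ring.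
have i2 : is_derive t 1 (fun t => sin t * p + (cos t - 1) * q) (cos t * p - sin t * q).
  by apply: is_derive_eq; rewrite /GRing.scale/=; ring.
have [d1 D1] := derive_scale e i1; have [d2 D2] := derive_scale e' i2.
have -> : gam = cst z + (fun t => ((cos t - 1) * p - sin t * q) *: e)
   + (fun t => (sin t * p + (cos t - 1) * q) *: e') by [].
have d3 : differentiable (cst z + (fun t => ((cos t - 1) * p - sin t * q) *: e)) t.
  by apply: differentiableD => //; exact: differentiable_cst.
split; first exact: differentiableD.
rewrite deriveD; [|exact: diff_derivable..].
rewrite deriveD; [|exact: diff_derivable..].
rewrite derive_cst D1 D2 add0r.
have E : dot (gam t) e = cos t * p - sin t * q /\ dot (gam t) e' = sin t * p + cos t * q.
  rewrite /gam /rot !(dotDl, dotZl) (basis_norm be) (basis_norm be') (dotC e' e).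
  by rewrite (basis_orth be be' ee') -/p -/q; split; ring.
rewrite -[X in rot_field X]/(gam t) /rot_field E.1 E.2 [LHS]addrC -(scaleNr _ e).
by congr (_ + _ *: _); ring.
Qed.

Lemma rot_curve_derive F t : smooth F ->
  is_derive t (1 : R) (F \o gam) (vf rot_field F (gam t)).
Proof.
move=> sF; have [dg Dg] := rot_curve t.
have dF : differentiable F (gam t) by exact: smooth_diff.
have dFg : differentiable (F \o gam) t by exact: differentiable_comp.
apply: DeriveDef; first exact: diff_derivable.
have e1 : 'd gam t 1 = rot_field (gam t) by rewrite -Dg deriveE.
by rewrite deriveE// diff_comp//= e1 vfE deriveE.
Qed.

Lemma rot_curve0 : gam 0 = z.
Proof. by rewrite /gam /rot cos0 sin0 subrr !mul0r subrr scale0r addr0 addr0 scale0r addr0. Qed.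

End Curve.

Lemma skew_rot_field e e' : skew (rot_field e e').
Proof.
by move=> u v; rewrite /rot_field !(dotDl, dotDr, dotNl, dotNr, dotZl, dotZr) (dotC e) (dotC e'); ring.
Qed.

Lemma sintN F : bm F -> sint (- F) = - sint F.
Proof.
move=> bF; have -> : - F = cst (-1) * F by apply/funext => z; rewrite -[LHS]mulN1r.
by rewrite sintZ// mulN1r.
Qed.

Lemma bmN F : bm F -> bm (- F).
Proof.
move=> bF; have -> : - F = cst (-1) * F by apply/funext => z; rewrite -[LHS]mulN1r.
by apply: bmM => //; exact: bm_cst.
Qed.

Lemma integral_sint F : bm F -> (\int[sigma]_(z in S7) (F z)%:E)%E = (sint F)%:E.
Proof.
move=> bF; rewrite /sint /Rintegral fineK//.
by apply: integrable_fin_num; [exact: measurable_S7|exact: integrable_bm].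
Qed.

Lemma sint_dominated (q : nat -> HH -> R) G (M : R) : (forall n, bm (q n)) -> bm G ->
  (forall n z, S7 z -> `|q n z| <= M) -> (forall z, S7 z -> q n z @[n --> \oo] --> G z) ->
  sint (q n) @[n --> \oo] --> sint G.
Proof.
move=> bq bG qM qG.
have mS := measurable_S7 (R := R).
have [] := @dominated_convergence _ _ R sigma S7 mS (fun n => EFin \o q n) (EFin \o G) (cst M%:E).
- by move=> n; apply/measurable_EFinP; apply: measurable_funTS; case: (bq n).
- by apply/measurable_EFinP; apply: measurable_funTS; case: bG.
- by apply: aeW => z z1; apply: cvg_EFin; [exact: nearW|exact: qG].
- by have := integrable_bm (bm_cst M).
- by apply: aeW => z n z1 /=; rewrite lee_fin; exact: qM.
move=> _ _.
have -> : [sequence (\int[sigma]_(x in S7) (EFin \o q n) x)%E]_n = EFin \o (fun n => sint (q n)).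
  by apply/funext => n /=; exact: integral_sint.
have -> : (\int[sigma]_(x in S7) (EFin \o G) x)%E = (sint G)%:E by exact: integral_sint.
by move=> /fine_cvgP [].
Qed.

(** By rotation invariance the difference quotients of [F] along the rotations have integral zero.
    They converge to the derivative, and the mean value theorem bounds them uniformly, so the limit
    may be taken under the integral. *)
Lemma sint_rot_field e e' F : e \in basis -> e' \in basis -> e != e' -> smooth F ->
  sint (vf (rot_field e e') F) = 0.
Proof.
move=> be be' ee' sF.
pose G := vf (rot_field e e') F.
have kR := @skew_rot_field e e'.
have sG : smooth G by rewrite /G; smooth_tac.
(* These angles tend to 0 inside the interval from 0 to pi, where the sine does not vanish as
   [sint_rot] requires. *)
pose t n : R := n.+1%:R^-1.
have t0 n : 0 < t n by rewrite /t invr_gt0 ltr0n.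
have t1 n : t n <= 1 by rewrite /t invf_le1 ?ltr0n// ler1n.
have s0 n : sin (t n) != 0.
  rewrite gt_eqF// sin_gt0_pi// t0/=; apply: le_lt_trans (t1 n) _.
  by apply: lt_le_trans (pi_ge2 R); rewrite ltr1n.
pose r n := rot e e' (cos (t n)) (sin (t n)).
have cs n := cos2Dsin2 (t n).
have bF := smooth_bm sF.
have bFr n : bm (F \o r n).
  have [mr _] := rotP be be' ee' (cs n) (s0 n).
  split; first by apply: (measurableT_comp _ mr); case: bF.
  have [_ [M hM]] := bF; exists M => z z1; apply: hM.
  exact/(S7_rot z be be' ee' (cs n)).
pose q n := cst (n.+1%:R) * (F \o r n - F).
have bd n : bm (F \o r n - F) by apply: bmD => //; exact: bmN.
have bq n : bm (q n) by apply: bmM => //; exact: bm_cst.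
have q0 n : sint (q n) = 0.
  rewrite sintZ// sintD ?sintN//; last exact: bmN.
  have -> : sint (F \o r n) = sint F by exact: (sint_rot be be' ee' (cs n) (s0 n) bF (bFr n)).
  ring.
have [M M0 hM] := S7_bounded (smooth_continuous sG).
have qE n z : q n z = (t n)^-1 * (F (r n z) - F z) by rewrite /t invrK.
have h1 : sint (q n) @[n --> \oo] --> sint G.
  apply: (@sint_dominated q G M) => //; first exact: smooth_bm.
  - move=> n z z1.
    have der (x : R) := rot_curve_derive z be be' ee' x sF.
    have [|c _ hc] := @MVT R _ _ 0 (t n) (t0 n) (fun x _ => der x).
      apply: continuous_subspaceT => x; apply: differentiable_continuous.
      by apply/derivable1_diffP; case: (der x).
    move: hc; rewrite /= rot_curve0 subr0 => hc.
    rewrite qE hc mulrCA mulVf ?gt_eqF// mulr1; apply: hM.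
    by apply/(S7_rot z be be' ee') => //; exact: cos2Dsin2.
  - move=> z _; have [dg Dg] := rot_curve_derive z be be' ee' 0 sF.
    move: Dg; rewrite rot_curve0 => Dg.
    have lim0 : h^-1 * (F (rot e e' (cos h) (sin h) z) - F z) @[h --> (0 : R)^'] --> G z.
      pose g (h : R) := F (rot e e' (cos h) (sin h) z).
      have fE : (fun h : R => h^-1 *: (g (h *: 1 + 0) - g 0)) =
          fun h : R => h^-1 * (g h - F z).
        apply/funext => h; rewrite addr0 [h *: 1]mulr1.
        by rewrite -[X in _ - X]/(F _) (rot_curve0 e e' z).
      have h1 : cvg ((fun h : R => h^-1 *: (g (h *: 1 + 0) - g 0)) @ (0 : R)^') := dg.
      have h2 : lim ((fun h : R => h^-1 *: (g (h *: 1 + 0) - g 0)) @ (0 : R)^') = G z := Dg.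
      by rewrite fE in h1 h2; rewrite -h2.
    move/cvgr_dnbhsP: lim0 => /(_ t) lim0.
    rewrite (_ : (fun n => q n z) = fun n => (t n)^-1 * (F (r n z) - F z)).
      apply: lim0; split; first by move=> n; rewrite gt_eqF.
      exact: cvg_harmonic.
    by apply/funext => n; exact: qE.
have h2 : sint (q n) @[n --> \oo] --> 0.
  by under eq_fun do rewrite q0; exact: cvg_cst.
exact: (cvg_unique _ h1 h2).
Qed.

End Integral.

(** * Symmetry and positivity *)

Section Symmetry.
Context {R : realType}.
Local Notation HH := (H2 R).
Local Notation basis := (Defs.basis : seq HH).
Local Notation sigma := (@sphere_measure R).
Implicit Types (F G : HH -> R) (A : HH -> HH) (u v w z e : HH).

Lemma rot_field_vf e e' F : smooth F ->
  vf (rot_field e e') F = (fun z => dot z e) * dirder e' F - (fun z => dot z e') * dirder e F.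
Proof.
move=> sF; apply/funext => z.
have eD v : 'D_v F z = dirder v F z by rewrite dirderE.
rewrite vfE /rot_field -(scaleNr _ e) (deriveDv _ _ _ sF) !(deriveZv _ _ _ sF) !eD.
by rewrite mulNr.
Qed.

(** The factor 2 appears because each plane occurs twice, as (e, e') and as (e', e). *)
Lemma skew_decomp A F : skew A -> smooth F ->
  cst 2 * vf A F = \sum_(e <- basis) \sum_(e' <- basis)
    cst (dot (A e) e') * vf (rot_field e e') F.
Proof.
move=> kA sF; apply/funext => z.
have dA e' : dot (A z) e' = \sum_(e <- basis) dot z e * dot (A e) e'.
  by rewrite kA -dot_basis -sumrN; apply: eq_bigr => e _; rewrite kA (dotC e'); ring.
have v : vf A F z = \sum_(e <- basis) \sum_(e' <- basis) dot (A e) e' * (dot z e * dirder e' F z).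
  rewrite vf_basisE// exchange_big/=; apply: eq_bigr => e' _.
  by rewrite dA mulr_suml; apply: eq_bigr => e _; ring.
have v' : vf A F z = - \sum_(e <- basis) \sum_(e' <- basis) dot (A e) e' * (dot z e' * dirder e F z).
  rewrite v exchange_big/= -sumrN; apply: eq_bigr => e _.
  rewrite -sumrN; apply: eq_bigr => e' _.
  by rewrite kA (dotC e'); ring.
rewrite -[LHS]/(2 * vf A F z) mulr_natl mulr2n {1}v v' -sumrB fct_sumE.
apply: eq_bigr => e _; rewrite -sumrB fct_sumE; apply: eq_bigr => e' _.
rewrite rot_field_vf//.
rewrite -[RHS]/(dot (A e) e' * (dot z e * dirder e' F z - dot z e' * dirder e F z)); ring.
Qed.

Lemma sint_sum (I : Type) (s : seq I) (f : I -> HH -> R) : (forall i, smooth (f i)) ->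
  sint (\sum_(i <- s) f i) = \sum_(i <- s) sint (f i).
Proof.
move=> sf; elim: s => [|i s ih].
  rewrite !big_nil -(mul0r (1 : HH -> R)) (_ : 0 = cst 0)// sintZ ?mul0r//.
  exact: (bm_cst 1).
by rewrite !big_cons sintD ?ih//; apply: smooth_bm => //; exact: smooth_sum.
Qed.

(* A linear skew field is a combination of infinitesimal plane rotations. *)
Lemma sint_skew A F : skew A -> smooth F -> sint (vf A F) = 0.
Proof.
move=> kA sF; have sA : smooth (vf A F) by smooth_tac.
have kR e e' := @skew_rot_field R e e'.
have sR e e' : smooth (vf (rot_field e e') F) by have := kR e e'; move=> ?; smooth_tac.
have h : 2 * sint (vf A F) = 0.
  rewrite -sintZ; last exact: smooth_bm.
  rewrite skew_decomp// sint_sum; last first.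
    move=> e; apply: smooth_sum => e'; have := sR e e' => ?; smooth_tac.
  rewrite big_seq big1// => e be; rewrite sint_sum; last first.
    by move=> e'; have := sR e e' => ?; smooth_tac.
  rewrite big_seq big1// => e' be'; rewrite sintZ; last exact: smooth_bm.
  have [->|ee'] := eqVneq e e'; first by rewrite skew_dot// mul0r.
  by rewrite sint_rot_field// mulr0.
by apply/eqP; move/eqP: h; rewrite mulf_eq0 pnatr_eq0.
Qed.

Lemma sint_by_parts A F G : skew A -> smooth F -> smooth G ->
  sint (vf A (vf A F) * G) = - sint (vf A F * vf A G).
Proof.
move=> kA sF sG; have sAF : smooth (vf A F) by smooth_tac.
have : sint (vf A (vf A F * G)) = 0 by apply: sint_skew => //; smooth_tac.
rewrite vfieldM// sintD; [|apply: smooth_bm; smooth_tac..].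
by move/eqP; rewrite addr_eq0 => /eqP.
Qed.

Lemma sintDM F1 F2 G : smooth F1 -> smooth F2 -> smooth G ->
  sint ((F1 + F2) * G) = sint (F1 * G) + sint (F2 * G).
Proof. by move=> s1 s2 sG; rewrite mulrDl sintD//; apply: smooth_bm; smooth_tac. Qed.

Lemma sintNM F G : smooth F -> smooth G -> sint (- F * G) = - sint (F * G).
Proof. by move=> sF sG; rewrite mulNr sintN//; apply: smooth_bm; smooth_tac. Qed.

Lemma sintZM c F G : smooth F -> smooth G -> sint (cst c * F * G) = c * sint (F * G).
Proof. by move=> sF sG; rewrite -mulrA sintZ//; apply: smooth_bm; smooth_tac. Qed.

Lemma vert_sum_energy F G : smooth F -> smooth G -> sint (vert_sum F * G) =
  - (sint (vf (@Vi R) F * vf (@Vi R) G) + sint (vf (@Vj R) F * vf (@Vj R) G)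
    + sint (vf (@Vk R) F * vf (@Vk R) G)).
Proof.
have [k1 k2 k3] := @skew_V R.
move=> sF sG; rewrite vert_sumE !sintDM//; [|smooth_tac..].
by rewrite !sint_by_parts//; ring.
Qed.

(* The Casimir element of so(8): on [S7] it is twice the opposite of the
   Laplace-Beltrami operator. *)
Definition rot_sum F := \sum_(e <- basis) \sum_(e' <- basis)
  vf (rot_field e e') (vf (rot_field e e') F).

Lemma rot_sumE F z : smooth F -> S7 z ->
  rot_sum F z = - 2 * (euler (euler F) z + 6 * euler F z - laplace F z).
Proof.
move=> sF z1.
pose x e := dot z e; pose d e := dirder e F z; pose h e e' := dirder e (dirder e' F) z.
(* The part of the iterated field whose outer derivative is along [e']; the part along [e] is the
   same expression with [e] and [e'] exchanged, so the double sum is twice that of [A]. *)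
pose A e e' := x e * (dot e' e * d e' + x e * h e' e' - dot e' e' * d e - x e' * h e' e).
have T e e' : vf (rot_field e e') (vf (rot_field e e') F) z = A e e' + A e' e.
  have sG : smooth (vf (rot_field e e') F) by have := @skew_rot_field R e e' => ?; smooth_tac.
  rewrite rot_field_vf//.
  have D v : dirder v (vf (rot_field e e') F) z = dot v e * d e' + x e * h v e'
      - dot v e' * d e - x e' * h v e.
    rewrite rot_field_vf// /dirder vfieldB; [|smooth_tac..].
    rewrite !vfieldM; [|smooth_tac..]; rewrite !vfield_dot.
    rewrite -[LHS]/(dot v e * d e' + x e * h v e' - (dot v e' * d e + x e' * h v e)); ring.
  rewrite -[LHS]/(x e * dirder e' (vf (rot_field e e') F) z
    - x e' * dirder e (vf (rot_field e e') F) z) !D /A; ring.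
have -> : rot_sum F z = \sum_(e <- basis) \sum_(e' <- basis) A e e'
    + \sum_(e <- basis) \sum_(e' <- basis) A e e'.
  rewrite /rot_sum fct_sumE [X in _ + X]exchange_big/= -big_split/=.
  apply: eq_bigr => e _; rewrite fct_sumE -big_split/=; apply: eq_bigr => e' _.
  exact: T.
have Ed e : \sum_(e' <- basis) dot e' e * d e' = d e.
  by rewrite /d [RHS]vf_basisE//; apply: eq_bigr => e' _; rewrite dotC.
have E1 : \sum_(e <- basis) x e * d e = euler F z by rewrite [RHS]vf_basisE.
have E2 : \sum_(e <- basis) x e * \sum_(e' <- basis) x e' * h e' e
    = euler (euler F) z - euler F z.
  have -> : euler (euler F) z = dirder z (euler F) z by rewrite /euler /dirder !vfE.
  rewrite -dirder_euler// dirder_dirderE// fct_sumE; apply: eq_bigr => e _.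
  rewrite -[RHS]/(dot z e * dirder z (dirder e F) z); congr (_ * _).
  rewrite /dirder [RHS]vf_basisE//; exact: smooth_dirder.
have E3 : \sum_(e <- basis) h e e = laplace F z by rewrite /laplace fct_sumE.
have E8 : \sum_(e <- basis) dot e e = 8.
  by rewrite !big_cons big_nil /dot /qdot /=; ring.
have Exx : \sum_(e <- basis) x e * x e = 1 by rewrite dot_basis; exact: z1.
have -> : \sum_(e <- basis) \sum_(e' <- basis) A e e' =
    \sum_(e <- basis) (x e * d e + x e * x e * laplace F z - 8 * (x e * d e)
      - x e * \sum_(e' <- basis) x e' * h e' e).
  apply: eq_bigr => e _; rewrite /A -mulr_sumr !sumrB big_split/= Ed -mulr_sumr E3.
  by rewrite -mulr_suml E8; ring.
rewrite !sumrB big_split/= -mulr_suml -mulr_sumr E1 E2 Exx; ring.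
Qed.

(** On S^7 the operator is a combination of squares of skew fields, namely
    [- 2^-1 * rot_sum + vert_sum]; integration by parts turns each square into a symmetric bilinear
    form. *)
Lemma subQ_sym F G : smooth F -> smooth G ->
  sint (subQ_poly F * G) = sint (F * subQ_poly G).
Proof.
have kR e e' := @skew_rot_field R e e'.
pose rs F' G' : R := \sum_(e <- basis) \sum_(e' <- basis)
    sint (vf (rot_field e e') F' * vf (rot_field e e') G').
have srot e e' H : smooth H -> smooth (vf (rot_field e e') H).
  by move=> sH; have := kR e e' => ?; smooth_tac.
have sRS H : smooth H -> smooth (rot_sum H).
  by move=> sH; apply: smooth_sum => e; apply: smooth_sum => e'; exact: (srot _ _ _ (srot _ _ _ sH)).
suff h F' G' : smooth F' -> smooth G' -> sint (subQ_poly F' * G') = 2^-1 * rs F' G'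
    - (sint (vf (@Vi R) F' * vf (@Vi R) G') + sint (vf (@Vj R) F' * vf (@Vj R) G')
    + sint (vf (@Vk R) F' * vf (@Vk R) G')).
  move=> sF sG; rewrite h// [F * _]mulrC h//.
  congr (_ * _ - (_ + _ + _)); try by congr sint; rewrite mulrC.
  by apply: eq_bigr => e _; apply: eq_bigr => e' _; rewrite mulrC.
move=> sF sG.
have -> : sint (subQ_poly F' * G') = sint ((cst (- 2^-1) * rot_sum F' + vert_sum F') * G').
  apply: sint_eq => z z1.
  rewrite -[LHS]/(subQ_poly F' z * G' z)
    -[RHS]/((- 2^-1 * rot_sum F' z + vert_sum F' z) * G' z) rot_sumE//.
  rewrite -[subQ_poly F' z]/(euler (euler F') z + 6 * euler F' z - laplace F' z + vert_sum F' z).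
  by congr ((_ + _) * _); field.
have sr := sRS _ sF.
rewrite sintDM; [|smooth_tac..]; rewrite sintZM// vert_sum_energy//; congr (_ + _).
have -> : sint (rot_sum F' * G') = - rs F' G'; last by ring.
rewrite /rot_sum mulr_suml sint_sum; last first.
  by move=> e; apply: smoothM => //; apply: smooth_sum => e'; exact: (srot _ _ _ (srot _ _ _ sF)).
rewrite -sumrN; apply: eq_bigr => e _; rewrite mulr_suml sint_sum; last first.
  by move=> e'; apply: smoothM => //; exact: (srot _ _ _ (srot _ _ _ sF)).
by rewrite -sumrN; apply: eq_bigr => e' _; rewrite sint_by_parts.
Qed.

End Symmetry.

(** * Positivity of the sphere measure and definiteness of the inner product *)

Section Positivity.
Context {R : realType}.
Local Notation H := (quat R).
Local Notation HH := (H2 R).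
Local Notation basis := (Defs.basis : seq HH).
Local Notation sigma := (@sphere_measure R).
Implicit Types (F G : HH -> R) (u v w z e : HH).

(** The neighbourhood system is a parameter so that the property passes to products through
    [filter_prod], one factor at a time. *)
Definition open_positive d (T : measurableType d) (nb : T -> set_system T)
  (m : set T -> \bar R) := forall x A, nb x A ->
  exists B, [/\ measurable B, B `<=` A & (0 < m B)%E].

Lemma open_positive_prod d1 d2 (T1 : measurableType d1) (T2 : measurableType d2)
    nb1 nb2 (m1 : {measure set T1 -> \bar R}) (m2 : {sigma_finite_measure set T2 -> \bar R}) :
  open_positive nb1 m1 -> open_positive nb2 m2 ->
  open_positive (fun p => filter_prod (nb1 p.1) (nb2 p.2)) (m1 \x m2)%E.
Proof.
move=> o1 o2 [x y] A [[A1 A2] /= [/o1[B1 [mB1 sB1 p1]] /o2[B2 [mB2 sB2 p2]]] sA].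
exists (B1 `*` B2); split; first exact: measurableX.
- by move=> [a b] [/= /sB1 ha /sB2 hb]; apply: sA.
- by rewrite product_measure1E// mule_gt0.
Qed.

Lemma open_positive_lebR : open_positive (fun x : R => nbhs x) (@lebR R).
Proof.
move=> x A /nbhs_ballP[e /= e0 sA]; exists (ball x e); split => //.
  by rewrite ball_itv; exact: measurable_itv.
by rewrite /lebR lebesgue_measure_ball ?ltW// lte_fin pmulrn_lgt0.
Qed.

Lemma open_positive_leb8 : open_positive (fun z : HH => nbhs z) (@leb8 R).
Proof.
pose l1 : {sigma_finite_measure set R -> \bar R} := @lebR R.
have f2 : sigma_finite setT (l1 \x l1)%E.
  exact: sigma_finite_product (sigma_finiteT l1).
pose l2 : {sigma_finite_measure set (R * R)%type -> \bar R} :=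
  HB.pack (l1 \x l1)%E (Measure_isSigmaFinite.Build _ _ _ (l1 \x l1)%E f2).
have f3 : sigma_finite setT (l2 \x l1)%E.
  exact: sigma_finite_product (sigma_finiteT l2).
pose l3 : {sigma_finite_measure set (R * R * R)%type -> \bar R} :=
  HB.pack (l2 \x l1)%E (Measure_isSigmaFinite.Build _ _ _ (l2 \x l1)%E f3).
pose l4 : {sigma_finite_measure set H -> \bar R} := @leb4 R.
have o1 := open_positive_lebR.
have o2 := @open_positive_prod _ _ _ _ _ _ l1 l1 o1 o1.
have o3 := @open_positive_prod _ _ _ _ _ _ l2 l1 o2 o1.
have o4 := @open_positive_prod _ _ _ _ _ _ l3 l1 o3 o1.
exact: (@open_positive_prod _ _ _ _ _ _ l4 l4 o4 o4).
Qed.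

Lemma sphere_measure_gt0 (U : set HH) p : measurable U -> nbhs p U -> S7 p ->
  (0 < sigma U)%E.
Proof.
(* A point strictly inside the punctured ball with radial projection [p]: the cone over [U] is a
   neighbourhood of it. *)
move=> mU pU p1; pose q : HH := 2^-1 *: p.
have qq : dot q q = 2^-1 ^+ 2.
  rewrite /q dotZl dotZr; have -> : dot p p = 1 by exact: p1.
  by ring.
have cd : continuous (fun z : HH => dot z z).
  by rewrite sqnormE; apply: smooth_continuous; apply: smooth_sum => e; smooth_tac.
have rq : radial q = p.
  by rewrite /radial qq sqrtr_sqr ger0_norm ?invr_ge0// /q scalerA invrK mulfV// scale1r.
have cr : {for q, continuous radial}.
  have cs : (fun z : HH => Num.sqrt (dot z z)) w @[w --> q] --> Num.sqrt (dot q q).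
    by apply: continuous_comp; [exact: cd|exact: sqrt_continuous].
  have s0 : Num.sqrt (dot q q) != 0.
    by rewrite gt_eqF// sqrtr_gt0 qq exprn_gt0// invr_gt0.
  exact: (cvgZ (cvgV s0 cs) cvg_id).
have nU : nbhs q ((radial @^-1` U) `&` pball).
  apply: filterI; first by apply: cr; rewrite rq.
  have o : nbhs (dot q q) `]0, 1[%classic.
    apply: open_nbhs_nbhs; split; first exact: interval_open.
    by rewrite /= in_itv/= qq; apply/andP; split; lra.
  apply: (filterS (P := (fun z : HH => dot z z) @^-1` `]0, 1[%classic)); last exact: (cd q _ o).
  move=> z /=; rewrite in_itv/= => /andP[h1 /ltW h2].
  by rewrite /pball/= h1.
have [B [mB sB B0]] := open_positive_leb8 nU.
rewrite sphere_measureE; apply: mule_gt0; first by rewrite lte_fin ltr0n.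
apply: (lt_le_trans B0); apply: le_measure; [by rewrite inE|rewrite inE|exact: sB].
apply: measurableI; last exact: measurable_pball.
by rewrite -[X in measurable X]setTI; exact: (measurable_radial measurableT mU).
Qed.

Lemma bm_indic (U : set HH) : measurable U -> bm (\1_U : HH -> R).
Proof.
move=> mU; split; first exact: measurable_indic.
by exists 1 => z _; rewrite indicE; case: (_ \in _); rewrite ?normr1 ?normr0.
Qed.

Lemma sint_indic (U : set HH) : measurable U -> ((sint (\1_U : HH -> R))%:E = sigma U)%E.
Proof.
move=> mU; apply: etrans (esym (integral_sint (bm_indic mU))) _.
apply: etrans (integral_indic sigma measurable_S7 mU) _.
have mI : measurable (U `&` S7) by apply: measurableI => //; exact: measurable_S7.
have mJ : measurable (U `&` ~` S7).
  by apply: measurableI => //; apply: measurableC; exact: measurable_S7.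
rewrite -[in RHS](setIT U) -(setUv S7) setIUr measureU//; last first.
  by rewrite setIACA setICr setI0.
rewrite [X in (_ + X)%E](_ : _ = 0%E) ?adde0//.
by apply: (subset_measure0 (B := ~` S7)) => //; [exact: measurableC measurable_S7|exact: sphere_measure_compl].
Qed.

Lemma sint_gt0 F p : smooth F -> (forall z, S7 z -> 0 <= F z) -> S7 p -> 0 < F p ->
  0 < sint F.
Proof.
move=> sF F0 p1 Fp; pose U := F @^-1` `]F p / 2, +oo[%classic.
have mU : measurable U.
  by rewrite /U -[X in measurable X]setTI; apply: smooth_measurable.
have pU : nbhs p U.
  have o : nbhs (F p) `]F p / 2, +oo[%classic.
    apply: open_nbhs_nbhs.
    by split; [exact: interval_open|rewrite /= in_itv/= andbT; lra].
  exact: (smooth_continuous sF o).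
have := sphere_measure_gt0 mU pU p1; rewrite -sint_indic// lte_fin => s0.
have bU := bm_indic mU.
apply: (@lt_le_trans _ _ (F p / 2 * sint (\1_U : HH -> R))); first by rewrite mulr_gt0// divr_gt0.
rewrite -sintZ//; apply: sint_le => //.
- by apply: bmM => //; exact: bm_cst.
- exact: smooth_bm.
move=> z z1; rewrite -[leLHS]/(F p / 2 * \1_U z) indicE.
have [/set_mem|_] := boolP (z \in U); last by rewrite mulr0 F0.
by rewrite /U /= in_itv/= andbT mulr1 => /ltW.
Qed.

Lemma sint_sqr_eq0 F z : smooth F -> sint (F * F) <= 0 -> S7 z -> F z = 0.
Proof.
move=> sF h z1; apply/eqP/contraT => Fz; move: h; rewrite leNgt => /negP[].
apply: (@sint_gt0 _ z) => //; first by smooth_tac.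
  by move=> w _; rewrite -[leRHS]/(F w * F w) -expr2 sqr_ge0.
by rewrite -[ltRHS]/(F z * F z) -expr2 exprn_even_gt0.
Qed.

Lemma sint_sqr_ge0 F : 0 <= sint (F * F).
Proof. by apply: sint_ge0 => z _; rewrite -[leRHS]/(F z * F z) -expr2 sqr_ge0. Qed.

Lemma coord_sqr_le e z : e \in basis -> dot z e ^+ 2 <= dot z z.
Proof.
move=> be; rewrite -(dot_basis z z) (big_rem e be)/= -expr2 lerDl.
by rewrite big_seq sumr_ge0// => e' _; rewrite -expr2 sqr_ge0.
Qed.

Lemma dot_eq0 z : dot z z = 0 -> z = 0.
Proof.
move=> z0; rewrite -(basisE z) big_seq big1// => e be.
suff -> : dot z e = 0 by rewrite scale0r.
by apply/eqP; rewrite -sqrf_eq0 eq_le sqr_ge0 andbT -z0 coord_sqr_le.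
Qed.

Lemma hpoly_S7_eq0 k F : hpoly k F -> (forall z, S7 z -> F z = 0) -> F = 0.
Proof.
move=> hF F0; apply/funext => z.
have [z0|z0] := eqVneq (dot z z) 0.
  rewrite (dot_eq0 z0) -(scale0r np).
  by rewrite (hpoly_homogeneous _ _ hF) F0 ?mulr0//; exact: dot_np.
have p0 : 0 < dot z z by rewrite lt_def z0 dot_ge0.
have -> : z = Num.sqrt (dot z z) *: ((Num.sqrt (dot z z))^-1 *: z).
  by rewrite scalerA mulfV ?scale1r// gt_eqF// sqrtr_gt0.
rewrite (hpoly_homogeneous _ _ hF) F0 ?mulr0//.
rewrite /S7/= dotZl dotZr mulrA -invfM -expr2 sqr_sqrtr ?ltW// mulVf//.
Qed.

(** The vertical Casimir operator is nonpositive, so 1 is not one of its eigenvalues. This removes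
    the spurious type m - 1 when m = 0. *)
Lemma vert_sum_le0 k F : hpoly k F -> vert_sum F = F -> F = 0.
Proof.
move=> hF vF; have sF := smooth_hpoly hF; apply: (hpoly_S7_eq0 hF) => z.
apply: sint_sqr_eq0 => //; rewrite -{1}vF vert_sum_energy// oppr_le0.
by rewrite !addr_ge0// sint_sqr_ge0.
Qed.

End Positivity.

(** * The vertical Casimir operator on polynomials *)

Section Casimir.
Context {R : realType}.
Local Notation HH := (H2 R).
Implicit Types (F G : HH -> R) (A V : HH -> HH) (u v w z : HH).

Lemma vfield0 A : vf A 0 = 0.
Proof. exact: (vfield_cst A 0). Qed.

(** A commutator of derivations is a derivation, so the relation extends from linear forms, where it
    is the hypothesis on compositions, to the polynomials they generate. *)
Lemma bracket_hpoly (X Y Z : HH -> HH) k F : skew X -> skew Y -> skew Z ->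
  (forall z, Y (X z) = Z z) -> (forall z, X (Y z) = - Z z) -> hpoly k F ->
  vf X (vf Y F) = vf Y (vf X F) + (vf Z F + vf Z F).
Proof.
move=> kX kY kZ YX XY; elim=> {k F} [c|k u F hF ih|k F G hF ihF hG ihG].
- by rewrite !vfield_cst ?vfield0 !addr0.
- have sF := smooth_hpoly hF.
  have sX : smooth (fun z => dot (X z) u) by exact: skew_smooth.
  have sY : smooth (fun z => dot (Y z) u) by exact: skew_smooth.
  have e1 := vfield_dot_skew X u kY; have e2 := vfield_dot_skew Y u kX.
  rewrite !(vfieldM, vfieldD, vfield_dot, e1, e2); [|smooth_tac..]; try assumption.
  rewrite ih.
  have -> : (fun z => dot (Y (X z)) u) = (fun z => dot (Z z) u).
    by apply/funext => z; rewrite YX.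
  have -> : (fun z => dot (X (Y z)) u) = - (fun z => dot (Z z) u).
    by apply/funext => z; rewrite XY dotNl.
  ring.
- have sF := smooth_hpoly hF; have sG := smooth_hpoly hG.
  rewrite !vfieldD; [|smooth_tac..]; rewrite ihF ihG; ring.
Qed.

(** The relations of right multiplication by i, j, k; composition reverses the order of the factors,
    whence [Y (X z) = Z z]. Their cyclic symmetry lets one of three cases stand for all. *)
Definition quaternionic (X Y Z : HH -> HH) := [/\
  [/\ skew X, skew Y & skew Z],
  [/\ forall z, X (X z) = - z, forall z, Y (Y z) = - z & forall z, Z (Z z) = - z],
  [/\ forall z, Y (X z) = Z z, forall z, Z (Y z) = X z & forall z, X (Z z) = Y z] &
  [/\ forall z, X (Y z) = - Z z, forall z, Y (Z z) = - X z
    & forall z, Z (X z) = - Y z]].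

Lemma quaternionic_V : quaternionic (@Vi R) (@Vj R) (@Vk R).
Proof.
split; first exact: skew_V.
all: split=> -[[[[? ?] ?] ?] [[[? ?] ?] ?]].
all: by apply: HH_ext; rewrite /=; ring.
Qed.

Definition casimir (X Y Z : HH -> HH) F := vf X (vf X F) + vf Y (vf Y F) + vf Z (vf Z F).

Section Triple.
Variables X Y Z : HH -> HH.
Hypothesis qXYZ : quaternionic X Y Z.
Local Notation C := (casimir X Y Z).

Let kX : skew X. Proof. by case: qXYZ => -[]. Qed.
Let kY : skew Y. Proof. by case: qXYZ => -[]. Qed.
Let kZ : skew Z. Proof. by case: qXYZ => -[]. Qed.

Lemma casimirM F G : smooth F -> smooth G ->
  C (F * G) = C F * G + F * C G
    + (vf X F * vf X G + vf Y F * vf Y G + vf Z F * vf Z G)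
    + (vf X F * vf X G + vf Y F * vf Y G + vf Z F * vf Z G).
Proof.
move=> sF sG; rewrite /casimir !(vfieldM, vfieldD); [|smooth_tac..]; ring.
Qed.

Lemma casimirD F G : smooth F -> smooth G -> C (F + G) = C F + C G.
Proof. by move=> sF sG; rewrite /casimir !vfieldD; [ring|smooth_tac..]. Qed.

Lemma casimir_dot u : C (fun z => dot z u) = cst (- 3) * (fun z => dot z u).
Proof.
have [_ [XX YY ZZ] _ _] := qXYZ.
rewrite /casimir !vfield_dot !vfield_dot_skew//.
by apply/funext => z; rewrite !fctE XX YY ZZ dotNl; ring.
Qed.

(** Moving [X] past the square of [Y] and past the square of [Z] produces the same mixed terms with
    opposite signs. *)
Lemma casimir_commX k F : hpoly k F -> C (vf X F) = vf X (C F).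
Proof.
have [_ _ [YX ZY XZ] [XY YZ ZX]] := qXYZ.
move=> hF; have sF := smooth_hpoly hF.
have [hX hY hZ] := And3 (hpoly_vf kX hF) (hpoly_vf kY hF) (hpoly_vf kZ hF).
have bXY G : hpoly k G -> vf X (vf Y G) = vf Y (vf X G) + (vf Z G + vf Z G).
  by apply: bracket_hpoly.
have bZX G : hpoly k G -> vf Z (vf X G) = vf X (vf Z G) + (vf Y G + vf Y G).
  by apply: bracket_hpoly.
have eX : vf X (vf Y (vf Y F)) = vf Y (vf Y (vf X F))
    + (vf Y (vf Z F) + vf Y (vf Z F)) + (vf Z (vf Y F) + vf Z (vf Y F)).
  by rewrite (bXY _ hY) (bXY _ hF) !vfieldD//; smooth_tac.
have eZ : vf Z (vf Z (vf X F)) = vf X (vf Z (vf Z F))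
    + (vf Y (vf Z F) + vf Y (vf Z F)) + (vf Z (vf Y F) + vf Z (vf Y F)).
  by rewrite (bZX _ hF) !vfieldD ?(bZX _ hZ)//; smooth_tac.
rewrite /casimir !vfieldD; [|smooth_tac..].
rewrite eX eZ; ring.
Qed.

End Triple.

Lemma quaternionic_rot X Y Z : quaternionic X Y Z -> quaternionic Y Z X.
Proof. by move=> [[? ? ?] [? ? ?] [? ? ?] [? ? ?]]. Qed.

Lemma casimir_rot X Y Z F : casimir Y Z X F = casimir X Y Z F.
Proof. by rewrite /casimir; ring. Qed.

Lemma casimir_comm X Y Z k F : quaternionic X Y Z -> hpoly k F ->
  [/\ casimir X Y Z (vf X F) = vf X (casimir X Y Z F),
      casimir X Y Z (vf Y F) = vf Y (casimir X Y Z F) &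
      casimir X Y Z (vf Z F) = vf Z (casimir X Y Z F)].
Proof.
move=> q hF; have q' := quaternionic_rot q; have q'' := quaternionic_rot q'.
split; first exact: casimir_commX hF.
- by rewrite -!(casimir_rot X); exact: casimir_commX hF.
- by rewrite -!(casimir_rot X) -!(casimir_rot Y); exact: casimir_commX hF.
Qed.

(** The functions [l * F] and [W] span a space stable under the Casimir operator. For q = m (m + 2)
    the resulting 2 x 2 matrix has eigenvalues - (m + 1)(m + 3) and - (m - 1)(m + 1), the values
    attached to the types m + 1 and m - 1. *)
Lemma casimir_pairing X Y Z k u F (q : R) : quaternionic X Y Z ->
  hpoly k F -> casimir X Y Z F = cst (- q) * F ->
  let l := fun z => dot z u in
  let W := vf X l * vf X F + vf Y l * vf Y F + vf Z l * vf Z F in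
  casimir X Y Z (l * F) = cst (- (q + 3)) * (l * F) + cst 2 * W
  /\ casimir X Y Z W = cst (1 - q) * W + cst (2 * q) * (l * F).
Proof.
move=> qXYZ; have [[kX kY kZ] [XX YY ZZ] [YX ZY XZ] [XY YZ ZX]] := qXYZ.
move=> hF CF l W; have sF := smooth_hpoly hF.
have sl : smooth l by exact: smooth_dot.
split.
  rewrite (casimirM qXYZ)// (casimir_dot qXYZ) CF -/l /W.
  by apply/funext => z; rewrite !fctE; ring.
have [cX cY cZ] := casimir_comm qXYZ hF.
have [hX hY hZ] := And3 (hpoly_vf kX hF) (hpoly_vf kY hF) (hpoly_vf kZ hF).
have [sX sY sZ] := And3 (smooth_hpoly hX) (smooth_hpoly hY) (smooth_hpoly hZ).
have lE V : skew V -> vf V l = fun z => dot z (- V u).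
  by move=> kV; rewrite /l vfield_dot; apply/funext => z; rewrite kV dotNr.
have cl V : skew V -> casimir X Y Z (vf V l) = cst (- 3) * vf V l.
  by move=> kV; rewrite lE//; exact: casimir_dot.
have sV V : skew V -> smooth (vf V l) by move=> kV; smooth_tac.
have ll V V' V'' : skew V -> (forall z, V (V' z) = V'' z) ->
    vf V' (vf V l) = vf V'' l.
  move=> kV e; rewrite /l vfield_dot vfield_dot_skew// vfield_dot.
  by apply/funext => z; rewrite e.
have lN V V' V'' : skew V -> (forall z, V (V' z) = - V'' z) ->
    vf V' (vf V l) = - vf V'' l.
  move=> kV e; rewrite /l vfield_dot vfield_dot_skew// vfield_dot.
  by apply/funext => z; rewrite e dotNl.
have l1 V : skew V -> (forall z, V (V z) = - z) -> vf V (vf V l) = - l.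
  move=> kV e; rewrite /l vfield_dot vfield_dot_skew//.
  by apply/funext => z; rewrite e dotNl.
rewrite (casimirD qXYZ); [|smooth_tac..].
rewrite (casimirD qXYZ); [|smooth_tac..].
rewrite !(casimirM qXYZ); [|smooth_tac..].
rewrite !cl// cX cY cZ CF !vfieldZ//.
rewrite (l1 X)// (l1 Y)// (l1 Z)//.
rewrite (ll _ _ _ kY YX) (ll _ _ _ kZ ZY) (ll _ _ _ kX XZ).
rewrite (lN _ _ _ kX XY) (lN _ _ _ kY YZ) (lN _ _ _ kZ ZX).
have -> : vf X (vf Y F) = vf Y (vf X F) + (vf Z F + vf Z F) by apply: bracket_hpoly hF.
have -> : vf Y (vf Z F) = vf Z (vf Y F) + (vf X F + vf X F) by apply: bracket_hpoly hF.
have -> : vf Z (vf X F) = vf X (vf Z F) + (vf Y F + vf Y F) by apply: bracket_hpoly hF.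
(* Once the commutators are ordered, the eigenvalue equation of [F] is the only remaining relation;
   eliminating the square of [X] leaves a ring identity. *)
have eX : vf X (vf X F) = cst (- q) * F - vf Y (vf Y F) - vf Z (vf Z F).
  by rewrite -CF /casimir; ring.
rewrite eX /W; clear; apply/funext => z; rewrite !fctE; ring.
Qed.

Lemma vert_sum_casimir F : vert_sum F = casimir (@Vi R) (@Vj R) (@Vk R) F.
Proof. exact: vert_sumE. Qed.

Lemma vert_sumD F G : smooth F -> smooth G -> vert_sum (F + G) = vert_sum F + vert_sum G.
Proof. by move=> sF sG; rewrite !vert_sum_casimir (casimirD quaternionic_V). Qed.

Lemma vert_sumM F G : smooth F -> smooth G ->
  vert_sum (F * G) = vert_sum F * G + F * vert_sum G
    + (vf (@Vi R) F * vf (@Vi R) G + vf (@Vj R) F * vf (@Vj R) G + vf (@Vk R) F * vf (@Vk R) G)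
    + (vf (@Vi R) F * vf (@Vi R) G + vf (@Vj R) F * vf (@Vj R) G + vf (@Vk R) F * vf (@Vk R) G).
Proof. by move=> sF sG; rewrite !vert_sum_casimir (casimirM quaternionic_V). Qed.

Lemma casimirZ X Y Z c F : smooth F -> skew X -> skew Y -> skew Z ->
  casimir X Y Z (cst c * F) = cst c * casimir X Y Z F.
Proof.
by move=> sF kX kY kZ; rewrite /casimir !vfieldZ; [ring|smooth_tac..].
Qed.

Lemma vert_sumZ c F : smooth F -> vert_sum (cst c * F) = cst c * vert_sum F.
Proof. by have [kX kY kZ] := @skew_V R; move=> sF; rewrite !vert_sum_casimir casimirZ. Qed.

Lemma vert_sum_cst (c : R) : vert_sum (cst c) = 0.
Proof. by rewrite vert_sum_casimir /casimir !vfield_cst ?vfield0 !addr0. Qed.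

(* Sums of homogeneous polynomials of degree [k] on which the vertical Casimir
   acts by the scalars [- m (m + 2)], with [m <= k] of the parity of [k]. *)
Inductive vert_span (k : nat) : (HH -> R) -> Prop :=
| vert_span0 : vert_span k 0
| vert_spanD m j F G : k = (m + j.*2)%N -> hpoly k F ->
    vert_sum F = cst (- (m * (m + 2))%:R) * F -> vert_span k G -> vert_span k (F + G).

Lemma vert_span_add k F G : vert_span k F -> vert_span k G -> vert_span k (F + G).
Proof.
move=> vF vG; elim: vF => [|m j F' G' km hF' eF' _ ih]; first by rewrite add0r.
by rewrite -addrA; apply: vert_spanD km hF' eF' ih.
Qed.

Lemma vert_span1 k m j F : k = (m + j.*2)%N -> hpoly k F ->
  vert_sum F = cst (- (m * (m + 2))%:R) * F -> vert_span k F.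
Proof. by move=> km hF eF; rewrite -(addr0 F); exact: vert_spanD km hF eF (vert_span0 k). Qed.

(* Clebsch-Gordan: multiplying the [m]-isotypic part by a linear form only
   produces the types [m + 1] and [m - 1]. *)
Lemma vert_span_dot k u F : vert_span k F -> vert_span k.+1 ((fun z => dot z u) * F).
Proof.
elim=> [|m j F' G' km hF eF vG ih]; first by rewrite mulr0; exact: vert_span0.
rewrite mulrDr; apply: vert_span_add ih => {G' vG}; rename F' into G.
have [[kX kY kZ] _ _ _] := quaternionic_V.
set l := fun z => dot z u; set q : R := (m * (m + 2))%:R.
have sl : smooth l by exact: smooth_dot.
have sG := smooth_hpoly hF.
pose W := vf (@Vi R) l * vf (@Vi R) G + vf (@Vj R) l * vf (@Vj R) G
  + vf (@Vk R) l * vf (@Vk R) G.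
have sW : smooth W by rewrite /W; smooth_tac.
have [e1 e2] : vert_sum (l * G) = cst (- (q + 3)) * (l * G) + cst 2 * W
    /\ vert_sum W = cst (1 - q) * W + cst (2 * q) * (l * G).
  by rewrite !vert_sum_casimir; apply: (casimir_pairing u quaternionic_V hF); rewrite -eF vert_sumE.
have hl (V : HH -> HH) : skew V -> hpoly k.+1 (vf V l * vf V G).
  move=> kV; have -> : vf V l = fun z => dot z (- V u).
    by rewrite /l vfield_dot; apply/funext => z; rewrite kV dotNr.
  by apply: hpoly_dot; exact: hpoly_vf.
have hW : hpoly k.+1 W by exact: (hpolyD (hpolyD (hl _ kX) (hl _ kY)) (hl _ kZ)).
have hlG : hpoly k.+1 (l * G) by exact: hpoly_dot.
have m1 : (m%:R + 1 : R) != 0 by rewrite natr1 pnatr_eq0.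
have Eq : q = m%:R * (m%:R + 2) by rewrite /q natrM natrD.
(* [P] and [N] are the spectral projections of [l * G] for the two eigenvalues of [casimir_pairing];
   the denominator is half of their difference 4 (m + 1). *)
pose c : R := (2 * (m%:R + 1))^-1.
pose P := cst c * (cst (m%:R + 2) * (l * G) - W).
pose N := cst c * (cst m%:R * (l * G) + W).
have -> : l * G = P + N.
  apply/funext => z; rewrite !fctE /P /N /c !fctE.
  move: (l z) (G z) (W z) => a b d; field.
  by rewrite m1.
have hP : hpoly k.+1 P by apply: hpolyZ; apply: hpolyB => //; exact: hpolyZ.
have hN : hpoly k.+1 N by apply: hpolyZ; apply: hpolyD => //; exact: hpolyZ.
have vP : vert_sum P = cst (- (m.+1 * (m.+1 + 2))%:R) * P.
  rewrite /P vert_sumZ; last by smooth_tac.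
  rewrite vert_sumD; [|smooth_tac..].
  have -> : - W = cst (-1) * W by apply/funext => z; rewrite /= -[LHS]mulN1r.
  rewrite !vert_sumZ; [|smooth_tac..]; rewrite e1 e2.
  rewrite natrM natrD -natr1 Eq; clear.
  by apply/funext => z; rewrite !fctE; ring.
have vN : vert_sum N = cst (1 - m%:R ^+ 2) * N.
  rewrite /N vert_sumZ; last by smooth_tac.
  rewrite vert_sumD; [|smooth_tac..].
  rewrite !vert_sumZ; [|smooth_tac..]; rewrite e1 e2 Eq; clear.
  by apply/funext => z; rewrite !fctE; ring.
apply: vert_span_add.
  by apply: (@vert_span1 _ m.+1 j) => //; rewrite km.
(* There is no type below m = 0: [N] would have eigenvalue 1 and therefore vanishes. *)
have [m0|m0] := posnP m.
  have -> : N = 0; last exact: vert_span0.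
  by apply: vert_sum_le0 hN _; rewrite vN m0 expr0n subr0 mul1r.
apply: (@vert_span1 _ m.-1 j.+1) => //.
  by rewrite km doubleS -[in LHS](prednK m0) !addSn !addnS.
rewrite vN; congr (cst _ * _).
by rewrite -[in LHS](prednK m0) -natr1 natrM natrD; ring.
Qed.

Lemma hpoly_vert_span k F : hpoly k F -> vert_span k F.
Proof.
elim=> {k F} [c|k v F hF ih|k F G hF ihF hG ihG].
- apply: (@vert_span1 _ 0 0) => //; first exact: hpoly_cst.
  by rewrite vert_sum_cst mul0n oppr0 mul0r.
- exact: vert_span_dot.
- exact: vert_span_add.
Qed.

Definition hopf_eigenvalue (l : R) := exists m j : nat, let k := (m + j.*2)%N in
  l = k%:R * (k%:R + 6) - m%:R * (m%:R + 2).

(* [F] is annihilated by a product of factors [subQ_poly - mu], with each [mu]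
   in the expected spectrum. *)
Inductive killed : (HH -> R) -> Prop :=
| killed0 : killed 0
| killedS mu F : hopf_eigenvalue mu -> smooth F ->
    killed (subQ_poly F - cst mu * F) -> killed F.

Lemma laplaceD F G : smooth F -> smooth G -> laplace (F + G) = laplace F + laplace G.
Proof.
move=> sF sG; rewrite /laplace -big_split/=; apply: eq_bigr => e _.
by rewrite /dirder !vfieldD; [|smooth_tac..].
Qed.

Lemma laplaceZ c F : smooth F -> laplace (cst c * F) = cst c * laplace F.
Proof.
move=> sF; rewrite /laplace mulr_sumr; apply: eq_bigr => e _.
by rewrite /dirder !vfieldZ; [|smooth_tac..].
Qed.

Lemma subQ_polyD F G : smooth F -> smooth G ->
  subQ_poly (F + G) = subQ_poly F + subQ_poly G.
Proof.
move=> sF sG; rewrite /subQ_poly laplaceD// vert_sumD// /euler.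
have sid := @smooth_field_id R.
rewrite !vfieldD//; [ring|exact: smooth_vfield..].
Qed.

Lemma subQ_polyZ c F : smooth F -> subQ_poly (cst c * F) = cst c * subQ_poly F.
Proof.
move=> sF; rewrite /subQ_poly laplaceZ// vert_sumZ// /euler.
have sid := @smooth_field_id R.
rewrite !vfieldZ//; [ring|exact: smooth_vfield].
Qed.

Lemma smooth_killed F : killed F -> smooth F.
Proof. by case=> [|mu G _ sG _]; [exact: (smooth_cst 0)|exact: sG]. Qed.

(** Factors of the form Delta_Q - mu commute, so one more can be applied before the annihilating
    product. *)
Lemma killed_sub mu F : killed F -> killed (subQ_poly F - cst mu * F).
Proof.
elim=> [|nu {}F nuE sF kF ih].
  have -> : subQ_poly 0 = 0 :> (HH -> R).
    by have := subQ_polyZ 0 (smooth_cst 0); rewrite (_ : cst 0 = 0)// !mul0r.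
  by rewrite mulr0 subr0; exact: killed0.
apply: (killedS nuE); first by smooth_tac.
have e c G : smooth G -> subQ_poly (subQ_poly G - cst c * G)
    = subQ_poly (subQ_poly G) - cst c * subQ_poly G.
  move=> sG; have -> : subQ_poly G - cst c * G = subQ_poly G + cst (- c) * G.
    by apply/funext => z; rewrite !fctE; ring.
  rewrite subQ_polyD ?subQ_polyZ; [|smooth_tac..].
  by apply/funext => z; rewrite !fctE; ring.
move: ih; rewrite (e nu F sF) (e mu F sF).
by congr killed; ring.
Qed.

(** The factors that annihilate [F] are applied to the whole sum; by [killed_sub] the image of [G]
    stays annihilated by its own product. *)
Lemma killedD F G : killed F -> killed G -> killed (F + G).
Proof.
move=> kF; elim: kF G => [|mu {}F muE sF kF ih] G kG; first by rewrite add0r.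
have sG := smooth_killed kG.
apply: (killedS muE); first by smooth_tac.
rewrite subQ_polyD// [X in killed X](_ : _ = (subQ_poly F - cst mu * F)
  + (subQ_poly G - cst mu * G)); last by ring.
by apply: ih; exact: killed_sub.
Qed.

(** On a component of type m in degree k, the factor with mu = k (k + 6) - m (m + 2) leaves only
    [- laplace G], of degree k - 2; hence a strong induction on the degree. *)
Lemma killed_hpoly k F : hpoly k F -> killed F.
Proof.
elim/ltn_ind: k F => k ih F /[dup] hF /hpoly_vert_span.
elim=> [|m j G G' km hG eG _]; first exact: killed0.
apply: killedD => {G' F hF}.
have muE : hopf_eigenvalue (k%:R * (k%:R + 6) - m%:R * (m%:R + 2)).
  by exists m, j; rewrite -km.
apply: (killedS muE); first exact: smooth_hpoly hG.
rewrite (subQ_poly_hpoly hG) eG.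
rewrite [X in killed X](_ : _ = - laplace G); last first.
  rewrite natrM natrD; clear; move: (laplace G) => L.
  by apply/funext => z; rewrite !fctE; ring.
have [k2|k2] := ltnP k 2.
  by rewrite (laplace_hpoly_lt2 k2 hG) oppr0; exact: killed0.
apply: (ih k.-2); first by case: k k2 {ih km hG muE eG} => [|[|k]].
by apply: hpolyN; apply: hpoly_laplace; move: hG; case: k k2 {ih km muE eG} => [|[|k]].
Qed.

End Casimir.

(** * Zonal eigenfunctions *)

Section Zonal.
Context {R : realType}.
Local Notation HH := (H2 R).
Local Notation basis := (@Defs.basis R).
Implicit Types (F G : HH -> R) (A V : HH -> HH) (u v w z : HH).

Definition px z : HH := (z.1, 0).
Definition py z : HH := (0, z.2).
Definition re_x z : R := dot z np.
Definition sqx z : R := dot z (px z).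
Definition sqy z : R := dot z (py z).

Lemma sqr_coordE (b : seq HH) (f : HH -> R) :
  f = \sum_(e <- b) (fun z => dot z e) * (fun z => dot z e) ->
  [/\ smooth f, hpoly 2 f & forall A z, vf A f z = 2 * \sum_(e <- b) dot (A z) e * dot z e].
Proof.
move=> ->; have sf e : smooth ((fun z => dot z e) * (fun z => dot z e)) by smooth_tac.
have h e : hpoly 2 ((fun z => dot z e) * (fun z => dot z e)).
  by apply: hpoly_dot; rewrite -(mulr1 (fun z => dot z e)); apply: hpoly_dot (hpoly_cst 1).
split; [exact: smooth_sum|exact: hpoly_sum|].
move=> A z; rewrite vfield_sum// fct_sumE mulr_sumr; apply: eq_bigr => e _.
rewrite vfieldM; [|smooth_tac..]; rewrite vfield_dot !fctE; ring.
Qed.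

Lemma px_dot u v : \sum_(e <- [:: (q1, 0); (qi, 0); (qj, 0); (qk, 0)] : seq HH) dot u e * dot v e
  = dot u (px v).
Proof.
move: u v => [[[[? ?] ?] ?] [[[? ?] ?] ?]] [[[[? ?] ?] ?] [[[? ?] ?] ?]].
rewrite !big_cons big_nil /dot /qdot /=; ring.
Qed.

Lemma py_dot u v : \sum_(e <- [:: (0, q1); (0, qi); (0, qj); (0, qk)] : seq HH) dot u e * dot v e
  = dot u (py v).
Proof.
move: u v => [[[[? ?] ?] ?] [[[? ?] ?] ?]] [[[[? ?] ?] ?] [[[? ?] ?] ?]].
rewrite !big_cons big_nil /dot /qdot /=; ring.
Qed.

Lemma sqxE : [/\ smooth sqx, hpoly 2 sqx & forall A z, vf A sqx z = 2 * dot (A z) (px z)].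
Proof.
have [|? ? h] := @sqr_coordE [:: (q1, 0); (qi, 0); (qj, 0); (qk, 0)] sqx.
  by apply/funext => z; rewrite fct_sumE -[RHS]/(\sum_(e <- _) dot z e * dot z e) px_dot.
by split=> // A z; rewrite h px_dot.
Qed.

Lemma sqyE : [/\ smooth sqy, hpoly 2 sqy & forall A z, vf A sqy z = 2 * dot (A z) (py z)].
Proof.
have [|? ? h] := @sqr_coordE [:: (0, q1); (0, qi); (0, qj); (0, qk)] sqy.
  by apply/funext => z; rewrite fct_sumE -[RHS]/(\sum_(e <- _) dot z e * dot z e) py_dot.
by split=> // A z; rewrite h py_dot.
Qed.

Lemma smooth_re_x : smooth re_x. Proof. exact: smooth_dot. Qed.

Lemma vf_re_x A z : vf A re_x z = dot (A z) np.
Proof. by rewrite /re_x vfield_dot. Qed.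

Lemma dot_px u v : dot u (px v) = dot (px u) v.
Proof.
move: u v => [[[[? ?] ?] ?] [[[? ?] ?] ?]] [[[[? ?] ?] ?] [[[? ?] ?] ?]].
rewrite /dot /qdot /=; ring.
Qed.

Lemma dot_py u v : dot u (py v) = dot (py u) v.
Proof.
move: u v => [[[[? ?] ?] ?] [[[? ?] ?] ?]] [[[[? ?] ?] ?] [[[? ?] ?] ?]].
rewrite /dot /qdot /=; ring.
Qed.

Lemma smooth_field_px : smooth_field px.
Proof.
by move=> v; have := smooth_dot (px v); under eq_fun do rewrite dot_px.
Qed.

Lemma smooth_field_py : smooth_field py.
Proof.
by move=> v; have := smooth_dot (py v); under eq_fun do rewrite dot_py.
Qed.

Lemma laplaceM F G : smooth F -> smooth G ->
  laplace (F * G) = laplace F * G + F * laplace G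
    + cst 2 * (\sum_(e <- basis) dirder e F * dirder e G).
Proof.
move=> sF sG; rewrite /laplace mulr_suml !mulr_sumr -!big_split/=.
apply: eq_bigr => e _; rewrite /dirder !(vfieldM, vfieldD); [|smooth_tac..].
by apply/funext => z; rewrite !fctE; ring.
Qed.

(** It serves |x|^2 and |y|^2, with [p] the projection onto a factor of dimension 4; the constant 8
    is the Laplacian of such a square norm. *)
Lemma laplace_quad f p F : smooth f -> smooth F ->
  (forall u v, dot u (p v) = dot (p u) v) -> \sum_(e <- basis) dot e (p e) = 4 ->
  (forall A z, vf A f z = 2 * dot (A z) (p z)) ->
  laplace (f * F) = cst 8 * F + f * laplace F + cst 4 * vf p F.
Proof.
move=> sf sF pS p4 vfE; rewrite laplaceM//.
have -> : laplace f = cst 8.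
  apply/funext => z; rewrite /laplace fct_sumE -[RHS]/(8 : R).
  rewrite (_ : 8 = 2 * \sum_(e <- basis) dot e (p e)); last by rewrite p4; ring.
  rewrite mulr_sumr; apply: eq_bigr => e _.
  have -> : dirder e f = cst 2 * (fun z => dot z (p e)).
    by apply/funext => x; rewrite /dirder vfE /= pS dotC.
  rewrite /dirder vfieldZ ?vfield_dot//; exact: smooth_dot.
apply/funext => z.
rewrite -[LHS]/(8 * F z + f z * laplace F z
  + 2 * (\sum_(e <- basis) dirder e f * dirder e F) z) fct_sumE.
rewrite -[RHS]/(8 * F z + f z * laplace F z + 4 * vf p F z) (vf_basisE p z sF).
rewrite (_ : \sum_(e <- basis) _ = 2 * \sum_(e <- basis) dot (p z) e * dirder e F z); first ring.
rewrite mulr_sumr; apply: eq_bigr => e _.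
rewrite -[LHS]/(vf (fun=> e) f z * dirder e F z) vfE dotC; ring.
Qed.

Lemma laplace_sqx F : smooth F ->
  laplace (sqx * F) = cst 8 * F + sqx * laplace F + cst 4 * vf px F.
Proof.
have [sf _ e] := sqxE; move=> sF; apply: laplace_quad => //; first exact: dot_px.
by rewrite !big_cons big_nil /dot /qdot /=; ring.
Qed.

Lemma laplace_sqy F : smooth F ->
  laplace (sqy * F) = cst 8 * F + sqy * laplace F + cst 4 * vf py F.
Proof.
have [sf _ e] := sqyE; move=> sF; apply: laplace_quad => //; first exact: dot_py.
by rewrite !big_cons big_nil /dot /qdot /=; ring.
Qed.

Lemma laplace_re_x F : smooth F ->
  laplace (re_x * F) = re_x * laplace F + cst 2 * dirder np F.
Proof.
move=> sF; rewrite laplaceM//; last exact: smooth_re_x.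
have -> : laplace re_x = 0.
  rewrite /laplace big1// => e _; rewrite /dirder [vf _ re_x]vfield_dot.
  exact: vfield_cst.
rewrite mul0r add0r; congr (_ + cst 2 * _).
rewrite /dirder (vfield_basis _ sF); apply: eq_bigr => e _.
by rewrite vfield_dot; apply/funext => z; rewrite !fctE dotC.
Qed.

Lemma fct0E z : (0 : HH -> R) z = 0. Proof. by []. Qed.

Lemma vf_px : [/\ vf px re_x = re_x, vf px sqx = cst 2 * sqx & vf px sqy = 0].
Proof.
have [_ _ ex] := sqxE; have [_ _ ey] := sqyE.
split; apply/funext => z; rewrite ?(vf_re_x, ex, ey) ?fctE ?fct0E /re_x /sqx;
  case: z => [[[[? ?] ?] ?] [[[? ?] ?] ?]]; rewrite /dot /qdot /=; ring.
Qed.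

Lemma vf_py : [/\ vf py re_x = 0, vf py sqx = 0 & vf py sqy = cst 2 * sqy].
Proof.
have [_ _ ex] := sqxE; have [_ _ ey] := sqyE.
split; apply/funext => z; rewrite ?(vf_re_x, ex, ey) ?fctE ?fct0E /re_x /sqy;
  case: z => [[[[? ?] ?] ?] [[[? ?] ?] ?]]; rewrite /dot /qdot /=; ring.
Qed.

Lemma dirder_np : [/\ dirder np re_x = cst 1, dirder np sqx = cst 2 * re_x
  & dirder np sqy = 0].
Proof.
have [_ _ ex] := sqxE; have [_ _ ey] := sqyE.
split; apply/funext => z; rewrite /dirder ?(vf_re_x, ex, ey) ?fctE ?fct0E /re_x;
  case: z => [[[[? ?] ?] ?] [[[? ?] ?] ?]]; rewrite /dot /qdot /=; ring.
Qed.

Lemma vf_V_sq : [/\ vf (@Vi R) sqx = 0, vf (@Vj R) sqx = 0 & vf (@Vk R) sqx = 0]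
  /\ [/\ vf (@Vi R) sqy = 0, vf (@Vj R) sqy = 0 & vf (@Vk R) sqy = 0].
Proof.
have [_ _ ex] := sqxE; have [_ _ ey] := sqyE.
by split; split; apply/funext => z; rewrite ?(ex, ey) ?fctE ?fct0E;
  case: z => [[[[? ?] ?] ?] [[[? ?] ?] ?]]; rewrite /dot /qdot /=; ring.
Qed.

Inductive wpoly : (HH -> R) -> Prop :=
| wpoly_cst (c : R) : wpoly (cst c)
| wpoly_re_x F : wpoly F -> wpoly (re_x * F)
| wpoly_sqx F : wpoly F -> wpoly (sqx * F)
| wpoly_sqy F : wpoly F -> wpoly (sqy * F)
| wpolyD F G : wpoly F -> wpoly G -> wpoly (F + G).

Lemma wpolyZ c F : wpoly F -> wpoly (cst c * F).
Proof.
elim=> [c'|F' _ ih|F' _ ih|F' _ ih|F' G' _ ihF _ ihG].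
- exact: wpoly_cst (c * c').
- by rewrite mulrCA; exact: wpoly_re_x.
- by rewrite mulrCA; exact: wpoly_sqx.
- by rewrite mulrCA; exact: wpoly_sqy.
- by rewrite mulrDr; exact: wpolyD.
Qed.

Lemma wpolyN F : wpoly F -> wpoly (- F).
Proof.
move=> wF; have -> : - F = cst (-1) * F; last exact: wpolyZ.
by apply/funext => z; rewrite -[LHS]mulN1r.
Qed.

Lemma smooth_wpoly F : wpoly F -> smooth F.
Proof.
have [sx _ _] := sqxE; have [sy _ _] := sqyE; have sr := smooth_re_x.
by elim=> *; smooth_tac.
Qed.

(* [zonal m] is the zonal harmonic [|x|^m U_m (re x / |x|)] of degree [m] on
   [R^4], with [U_m] the Chebyshev polynomial of the second kind. *)
Fixpoint zonal_pair m : (HH -> R) * (HH -> R) :=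
  if m is m'.+1 then let: (a, b) := zonal_pair m' in
    (b, cst 2 * (re_x * b) - sqx * a)
  else (cst 1, cst 2 * re_x).

Definition zonal m := (zonal_pair m).1.

Lemma zonal0 : zonal 0 = cst 1. Proof. by []. Qed.

Lemma zonal1 : zonal 1 = cst 2 * re_x. Proof. by []. Qed.

Lemma zonalSS m : zonal m.+2 = cst 2 * (re_x * zonal m.+1) - sqx * zonal m.
Proof. by rewrite /zonal /=; case: (zonal_pair m). Qed.

(** The carre du champ of [vert_sum]: half of the defect in its product rule. *)
Definition vert_grad F G := vf (@Vi R) F * vf (@Vi R) G
  + vf (@Vj R) F * vf (@Vj R) G + vf (@Vk R) F * vf (@Vk R) G.

Lemma vert_gradMr F G H : smooth G -> smooth H ->
  vert_grad F (G * H) = vert_grad F G * H + G * vert_grad F H.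
Proof. by move=> sG sH; rewrite /vert_grad !vfieldM//; ring. Qed.

Lemma vert_gradDr F G H : smooth G -> smooth H ->
  vert_grad F (G + H) = vert_grad F G + vert_grad F H.
Proof. by move=> sG sH; rewrite /vert_grad !vfieldD//; ring. Qed.

Lemma vert_grad_cst F c : vert_grad F (cst c) = 0.
Proof. by rewrite /vert_grad !vfield_cst !mulr0 !addr0. Qed.

Lemma vert_gradC F G : vert_grad F G = vert_grad G F.
Proof. by rewrite /vert_grad; ring. Qed.

Lemma vert_grad_re_x : vert_grad re_x re_x = sqx - re_x * re_x.
Proof.
apply/funext => z; rewrite /vert_grad !fctE !vf_re_x /re_x /sqx.
case: z => [[[[? ?] ?] ?] [[[? ?] ?] ?]]; rewrite /dot /qdot /=; ring.
Qed.

Lemma vert_grad_sq F : vert_grad F sqx = 0 /\ vert_grad F sqy = 0.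
Proof.
have [[e1 e2 e3] [e4 e5 e6]] := vf_V_sq.
by rewrite /vert_grad e1 e2 e3 e4 e5 e6 !mulr0 !addr0.
Qed.

Lemma vert_sum_re_x : vert_sum re_x = cst (-3) * re_x.
Proof. by rewrite vert_sum_casimir (casimir_dot quaternionic_V). Qed.

Lemma vert_sum_sq : vert_sum sqx = 0 /\ vert_sum sqy = 0.
Proof.
have [[e1 e2 e3] [e4 e5 e6]] := vf_V_sq.
by rewrite !vert_sumE e1 e2 e3 e4 e5 e6 !vfield0 !addr0.
Qed.

(** The recurrence propagates these facts only together: the Laplacian of the next term uses the
    derivatives along [px] and [np], and its vertical Casimir uses [vert_grad re_x]. *)
Definition zonal_spec m (Z Zpred : HH -> R) := [/\
  [/\ smooth Z, wpoly Z & hpoly m Z],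
  [/\ laplace Z = 0, vf px Z = cst m%:R * Z & vf py Z = 0],
  [/\ dirder np Z = cst (m%:R + 1) * Zpred,
      vert_grad re_x Z = sqx * dirder np Z - cst m%:R * (re_x * Z) &
      vert_sum Z = cst (- (m%:R * (m%:R + 2))) * Z] &
  Z np = m%:R + 1].

(** The value 0 extends the recurrence one step back, as U_(-1) = 0 does for Chebyshev
    polynomials. *)
Definition zonal_pred m := if m is m'.+1 then zonal m' else 0.

Lemma re_x_np : re_x np = 1.
Proof. by rewrite /re_x /dot /qdot /=; ring. Qed.

Lemma sqx_np : sqx np = 1.
Proof. by rewrite /sqx /dot /qdot /=; ring. Qed.

Lemma sqy_np : sqy np = 0.
Proof. by rewrite /sqy /dot /qdot /=; ring. Qed.

Lemma hpoly_re_x F k : hpoly k F -> hpoly k.+1 (re_x * F).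
Proof. exact: hpoly_dot. Qed.

Lemma zonalP m : zonal_spec m (zonal m) (zonal_pred m).
Proof.
have [sx hx _] := sqxE; have sr := smooth_re_x.
have [px1 px2 px3] := vf_px; have [py1 py2 py3] := vf_py.
have [np1 np2 np3] := dirder_np.
have sfx := smooth_field_px; have sfy := smooth_field_py.
have d0 A : vf A (cst 1) = 0 by exact: vfield_cst.
(* The recurrence has order two, so two consecutive degrees are carried. *)
suff: zonal_spec m (zonal m) (zonal_pred m) /\ zonal_spec m.+1 (zonal m.+1) (zonal m).
  by case.
elim: m => [|m [[[s1 w1 h1] [L1 X1 Y1] [D1 G1 V1] n1] S2]].
  split.
    rewrite zonal0; split.
    - by split; [smooth_tac|exact: wpoly_cst|exact: hpoly_cst].
    - split; rewrite ?d0.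
      + by rewrite /laplace big1// => e _; rewrite /dirder d0 vfield0.
      + by rewrite (_ : cst _ = 0) ?mul0r.
      + by [].
    - rewrite /dirder d0 vert_grad_cst vert_sum_cst !mulr0; split=> //.
      + by rewrite (_ : cst 0%:R = 0)// mul0r subrr.
      + by rewrite mul0r oppr0 (_ : cst 0 = 0) ?mul0r.
    - by rewrite add0r.
  rewrite zonal1; split.
  - split; [smooth_tac| |].
    + by apply: wpolyZ; rewrite -(mulr1 re_x); exact: wpoly_re_x (wpoly_cst 1).
    + by apply: hpolyZ; rewrite -(mulr1 re_x); exact: hpoly_re_x (hpoly_cst 1).
  - have Lr : laplace re_x = 0.
      rewrite -(mulr1 re_x) laplace_re_x; last by smooth_tac.
      rewrite /laplace big1 ?mulr0 ?add0r.
        by rewrite /dirder d0 mulr0.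
      by move=> e _; rewrite /dirder d0 vfield0.
    rewrite laplaceZ// !vfieldZ// Lr px1 py1 !mulr0; split=> //.
    by rewrite mul1r.
  - rewrite /dirder vfieldZ// -/(dirder np re_x) np1 vert_gradMr//; last by smooth_tac.
    rewrite vert_grad_cst vert_grad_re_x vert_sumZ// vert_sum_re_x.
    by split; apply/funext => z; rewrite !fctE ?fct0E; ring.
  - by rewrite -[LHS]/(2 * re_x np) re_x_np; ring.
split=> //; move: S2 => [[s2 w2 h2] [L2 X2 Y2] [D2 G2 V2] n2].
have s3 : smooth (re_x * zonal m.+1) by smooth_tac.
have s4 : smooth (sqx * zonal m) by smooth_tac.
have s5 : smooth (cst 2 * (re_x * zonal m.+1)) by smooth_tac.
rewrite zonalSS; split.
- split.
  + by smooth_tac.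
  + apply: wpolyD; first exact/wpolyZ/wpoly_re_x.
    exact/wpolyN/wpoly_sqx.
  + apply: hpolyB; first exact/hpolyZ/hpoly_re_x.
    exact: (hpolyM hx h1).
- have N F : - F = cst (-1) * F by apply/funext => z; rewrite -[LHS]mulN1r.
  split.
  + rewrite N laplaceD; [|smooth_tac..].
    rewrite !laplaceZ// laplace_re_x// laplace_sqx// L1 L2 X1 D2; clear.
    by apply/funext => z; rewrite -!natr1 !fctE ?fct0E; ring.
  + rewrite vfieldB// vfieldZ// !vfieldM// px1 px2 X1 X2; clear.
    by apply/funext => z; rewrite -!natr1 !fctE ?fct0E; ring.
  + rewrite vfieldB// vfieldZ// !vfieldM// py1 py2 Y1 Y2; clear.
    by apply/funext => z; rewrite !fctE ?fct0E; ring.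
- have eD : dirder np (cst 2 * (re_x * zonal m.+1) - sqx * zonal m)
      = cst (m.+2%:R + 1) * zonal m.+1.
    rewrite /dirder vfieldB// vfieldZ// !vfieldM// -!/(dirder _ _) np1 np2 D1 D2.
    case: m {s1 w1 h1 L1 X1 Y1 G1 V1 n1 s2 w2 h2 L2 X2 Y2 G2 V2 n2 s3 s4 s5 D1 D2} => [|m].
      rewrite zonal0 zonal1 /=; clear.
      by apply/funext => z; rewrite !fctE ?fct0E; ring.
    rewrite zonalSS /=; clear.
    by apply/funext => z; rewrite -!natr1 !fctE ?fct0E; ring.
  split=> //.
  + rewrite eD vert_gradDr; [|smooth_tac..].
    have -> : - (sqx * zonal m) = cst (-1) * (sqx * zonal m).
      by apply/funext => z; rewrite -[LHS]mulN1r.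
    have sc c : smooth (cst c : HH -> R) by exact: smooth_cst.
    rewrite !vert_gradMr// !vert_grad_cst vert_grad_re_x (vert_grad_sq re_x).1.
    rewrite G1 G2 D1 D2.
    case: m {s1 w1 h1 L1 X1 Y1 G1 V1 n1 s2 w2 h2 L2 X2 Y2 G2 V2 n2 s3 s4 s5 D1 D2 eD} => [|m].
      rewrite zonal0 zonal1 /=; clear.
      by apply/funext => z; rewrite !fctE ?fct0E; ring.
    rewrite zonalSS /=; clear.
    by apply/funext => z; rewrite -!natr1 !fctE ?fct0E; ring.
  + rewrite -[X in vert_sum (_ + X)]mulN1r vert_sumD; [|smooth_tac..].
    rewrite (_ : -1 = cst (-1))// !vert_sumZ// !vert_sumM// -!/(vert_grad _ _).
    rewrite vert_sum_re_x vert_sum_sq.1 V1 V2 G2 D2.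
    rewrite (vert_gradC sqx) (vert_grad_sq _).1; clear.
    by apply/funext => z; rewrite -!natr1 !fctE ?fct0E; ring.
- rewrite -[LHS]/(2 * (re_x np * zonal m.+1 np) - sqx np * zonal m np).
  by rewrite re_x_np sqx_np n1 n2 -!natr1; ring.
Qed.

End Zonal.

(** * Zonal eigenfunctions of Delta_Q and comparison with Delta_T *)

Section Eigen.
Context {R : realType}.
Local Notation HH := (H2 R).
Local Notation basis := (@Defs.basis R).
Local Notation zonal := (@zonal R).
Local Notation sqx := (@sqx R).
Local Notation sqy := (@sqy R).
Local Notation re_x := (@re_x R).
Local Notation px := (@px R).
Local Notation py := (@py R).
Implicit Types (F G : HH -> R) (A V : HH -> HH) (u v w z : HH).

Definition zmono m i a : HH -> R := sqx ^+ i * (sqy ^+ a * zonal m).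

(** On R^4 the Laplacian of |y|^(2 a) is 4 a (a + 1) |y|^(2 a - 2), and [zonal m] is harmonic and
    depends only on x. The truncated [a.-1] at a = 0 comes with coefficient 0. *)
Lemma zmono_y m a : [/\ [/\ smooth (sqy ^+ a * zonal m), wpoly (sqy ^+ a * zonal m)
    & hpoly (a.*2 + m) (sqy ^+ a * zonal m)],
  [/\ vf px (sqy ^+ a * zonal m) = cst m%:R * (sqy ^+ a * zonal m),
      vf py (sqy ^+ a * zonal m) = cst (2 * a%:R) * (sqy ^+ a * zonal m) &
      vert_sum (sqy ^+ a * zonal m) = cst (- (m%:R * (m%:R + 2))) * (sqy ^+ a * zonal m)] &
  laplace (sqy ^+ a * zonal m) = cst (4 * a%:R * (a%:R + 1)) * (sqy ^+ a.-1 * zonal m)].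
Proof.
have [sy hy _] := @sqyE R.
have [px1 px2 px3] := @vf_px R; have [py1 py2 py3] := @vf_py R.
have sfx := @smooth_field_px R; have sfy := @smooth_field_py R.
have [[s w h] [L X Y] [_ _ V] n] := @zonalP R m.
elim: a => [|a [[s' w' h'] [X' Y' V'] L']].
  rewrite expr0 mul1r; split=> //; first split => //.
    by rewrite Y; apply/funext => z; rewrite !fctE ?fct0E; ring.
  by rewrite L; apply/funext => z; rewrite !fctE ?fct0E; ring.
rewrite exprS -mulrA; split; first split.
- by smooth_tac.
- exact: wpoly_sqy.
- by rewrite doubleS !addSn; exact: (hpolyM hy h').
- split.
  + by rewrite vfieldM// px3 X'; clear; apply/funext => z; rewrite !fctE ?fct0E; ring.
  + by rewrite vfieldM// py3 Y' -natr1; clear; apply/funext => z; rewrite !fctE ?fct0E; ring.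
  + rewrite vert_sumM// -!/(vert_grad _ _) vert_sum_sq.2 vert_gradC (vert_grad_sq _).2 V'.
    by clear; apply/funext => z; rewrite !fctE ?fct0E; ring.
rewrite laplace_sqy// L' Y' /=.
case: a {s' w' h' X' Y' V' L'} => [|a]; rewrite ?exprS -!natr1; clear;
  by apply/funext => z; rewrite !fctE ?fct0E; ring.
Qed.

(** The extra m in [i + m + 1] is the degree of [zonal m] in x, which enters through the cross term
    of the product rule for |x|^2. *)
Lemma zmonoP m i a : [/\ [/\ smooth (zmono m i a), wpoly (zmono m i a)
    & hpoly (i.*2 + (a.*2 + m)) (zmono m i a)],
  [/\ vf px (zmono m i a) = cst (m%:R + 2 * i%:R) * zmono m i a &
      vert_sum (zmono m i a) = cst (- (m%:R * (m%:R + 2))) * zmono m i a] &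
  laplace (zmono m i a) = cst (4 * i%:R * (i%:R + m%:R + 1)) * zmono m i.-1 a
    + cst (4 * a%:R * (a%:R + 1)) * zmono m i a.-1].
Proof.
have [sx hx _] := @sqxE R.
have [px1 px2 px3] := @vf_px R.
have sfx := @smooth_field_px R.
have [[s w h] [X Y V] L] := zmono_y m a; rewrite /zmono.
elim: i => [|i [[s' w' h'] [X' V'] L']].
  rewrite expr0 !mul1r mulr0 addr0 add0n; split=> //.
  by rewrite L; apply/funext => z; rewrite !fctE ?fct0E; ring.
rewrite exprS -mulrA; split; first split.
- by smooth_tac.
- exact: wpoly_sqx.
- by rewrite doubleS !addSn; exact: (hpolyM hx h').
- split.
  + by rewrite vfieldM// px2 X' -natr1; clear; apply/funext => z; rewrite !fctE ?fct0E; ring.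
  + rewrite vert_sumM// -!/(vert_grad _ _) vert_sum_sq.1 vert_gradC (vert_grad_sq _).1 V'.
    by clear; apply/funext => z; rewrite !fctE ?fct0E; ring.
rewrite laplace_sqx// L' X' /=.
case: i {s' w' h' X' V' L'} => [|i]; rewrite ?exprS -!natr1; clear;
  by apply/funext => z; rewrite !fctE ?fct0E; ring.
Qed.

(* The coefficients that make [\sum_i zcoef m j i * zmono m i (j - i)] harmonic. *)
Fixpoint zcoef m j i : R := if i is i'.+1 then
    - zcoef m j i' * ((j - i')%:R * ((j - i')%:R + 1)) / (i'.+1%:R * (i'.+1%:R + m%:R + 1))
  else 1.

Lemma zcoef_neq0 m j i : (i <= j)%N -> zcoef m j i != 0.
Proof.
elim: i => [|i ih] ij /=; first exact: oner_neq0.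
have hi := ih (ltnW ij).
have pos (n : nat) : (n%:R + 1 : R) != 0 by rewrite natr1 pnatr_eq0.
rewrite !mulf_neq0 ?oppr_eq0 ?invr_eq0 ?mulf_neq0 ?pnatr_eq0//.
all: by rewrite ?subn_eq0 -?ltnNge -?natrD ?pos.
Qed.

(** A harmonic polynomial of degree k and vertical type m is an eigenfunction for k (k + 6) - m (m +
    2). Multiplying [zonal m] by polynomials in |x|^2 and |y|^2 raises the degree by 2 j and keeps
    the type. *)
Lemma zonal_eigenfunction l : hopf_eigenvalue l -> exists u : HH -> R,
  [/\ wpoly u, subQ_poly u = cst l * u & u np != 0].
Proof.
move=> [m [j ->]] /=.
pose t i := cst (zcoef m j i) * zmono m i (j - i).
have zp i := zmonoP m i (j - i).
exists (\sum_(i < j.+1) t i).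
have st i : smooth (t i) by rewrite /t; have [[? _ _] _ _] := zp i; smooth_tac.
have wt : wpoly (\sum_(i < j.+1) t i).
  elim/big_ind : _ => [||i _]; [exact: (wpoly_cst 0)|exact: wpolyD|].
  by apply: wpolyZ; have [[]] := zp i.
have ht : hpoly (m + j.*2) (\sum_(i < j.+1) t i).
  elim/big_ind : _ => [||i _]; [exact: hpoly0|exact: hpolyD|].
  apply: hpolyZ; have [[_ _ +] _ _] := zp i.
  by rewrite addnA -doubleD subnKC ?[(_ + m)%N]addnC// -ltnS.
have vt : vert_sum (\sum_(i < j.+1) t i) = cst (- (m%:R * (m%:R + 2))) * \sum_(i < j.+1) t i.
  elim: (j.+1) => [|n ih].
    by rewrite big_ord0 mulr0; exact: (vert_sum_cst 0).
  rewrite big_ord_recr/= vert_sumD//; last exact: smooth_sum.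
  rewrite ih [RHS]mulrDr; congr (_ + _); have [[sz _ _] [_ vz] _] := zp n.
  by rewrite /t vert_sumZ// vz; ring.
have lt : laplace (\sum_(i < j.+1) t i) = 0.
  have -> : laplace (\sum_(i < j.+1) t i) = \sum_(i < j.+1) laplace (t i).
    elim: (j.+1) => [|n ih].
      rewrite !big_ord0 /laplace big1// => e _.
      by rewrite /dirder !vfield0.
    by rewrite !big_ord_recr/= laplaceD ?ih//; exact: smooth_sum.
  pose a i := cst (zcoef m j i * (4 * i%:R * (i%:R + m%:R + 1))) * zmono m i.-1 (j - i).
  pose b i := cst (zcoef m j i * (4 * (j - i)%:R * ((j - i)%:R + 1))) * zmono m i (j - i).-1.
  have -> : \sum_(i < j.+1) laplace (t i) = \sum_(i < j.+1) a i + \sum_(i < j.+1) b i.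
    rewrite -big_split/=; apply: eq_bigr => i _; have [[sz _ _] _ lz] := zp i.
    rewrite /t laplaceZ// lz /a /b; clear.
    by apply/funext => z; rewrite !fctE ?fct0E; ring.
  (* After shifting the index, [a i.+1] meets [b i] and cancels it by the recursion of [zcoef]; the
     unpaired terms [a 0] and [b j] have a zero coefficient. *)
  rewrite big_ord_recl big_ord_recr/=.
  have -> : a 0%N = 0 by apply/funext => z; rewrite /a !fctE ?fct0E; ring.
  have -> : b j = 0 by apply/funext => z; rewrite /b subnn !fctE ?fct0E; ring.
  rewrite add0r addr0 -big_split/= big1// => i _.
  have ij := ltn_ord i.
  rewrite /bump /= add1n /a /b /= subnS; apply/funext => z; rewrite !fctE ?fct0E.
  move: (zmono _ _ _ _) => q.
  have h1 : (i.+1%:R : R) != 0 by rewrite pnatr_eq0.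
  have h2 : (i.+1%:R + m%:R + 1 : R) != 0 by rewrite -natrD natr1 pnatr_eq0.
  by field; rewrite nat1r h1 h2.
split=> //.
- rewrite (subQ_poly_hpoly ht) lt vt subr0.
  by apply/funext => z; rewrite !fctE; ring.
(* Since [sqy] vanishes at [np], only the term i = j, which is free of [sqy], contributes. *)
- rewrite fct_sumE big_ord_recr/= big1 ?add0r.
    rewrite -[X in X != 0]/(zcoef m j j * ((sqx ^+ j) np * ((sqy ^+ (j - j)) np * zonal m np))).
    have [_ _ _ ->] := @zonalP R m.
    rewrite subnn expr0 [(1 : HH -> R) np]/(1 : R) mul1r.
    apply: mulf_neq0; first by rewrite zcoef_neq0.
    apply: mulf_neq0; last by rewrite natr1 pnatr_eq0.
    have -> : (sqx ^+ j) np = 1; last exact: oner_neq0.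
    elim: (j) => [//|n ih]; rewrite exprS -[LHS]/(sqx np * (sqx ^+ n) np).
    by rewrite ih sqx_np mul1r.
  move=> i _; rewrite -[LHS]/(zcoef m j i * ((sqx ^+ i) np * ((sqy ^+ (j - i)) np * zonal m np))).
  have : (0 < j - i)%N by rewrite subn_gt0.
  case: (j - i)%N => // n _.
  by rewrite exprS -[(sqy * _) np]/(sqy np * (sqy ^+ n) np) sqy_np !(mul0r, mulr0).
Qed.

(* The carre du champ of each sublaplacian: being a derivation in each argument,
   it reduces the comparison of the two sublaplacians on [wpoly] to generators. *)
Definition gammaQ F G := euler F * euler G
  - \sum_(e <- basis) dirder e F * dirder e G + vert_grad F G.

Definition gammaT F G := - (vf (@A1 R) F * vf (@A1 R) G
  + vf (@A2 R) F * vf (@A2 R) G + vf (@A3 R) F * vf (@A3 R) G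
  + vf (@A4 R) F * vf (@A4 R) G).

Definition subT_poly F := - (vf (@A1 R) (vf (@A1 R) F)
  + vf (@A2 R) (vf (@A2 R) F) + vf (@A3 R) (vf (@A3 R) F)
  + vf (@A4 R) (vf (@A4 R) F)).

Lemma subTE F : subT F = subT_poly F.
Proof.
have e : @vfield R = @vf R by rewrite /vf -lock.
apply/funext => z; rewrite /subT e /subT_poly !big_cons big_nil.
by rewrite addr0 !addrA.
Qed.

Lemma subQ_polyM F G : smooth F -> smooth G ->
  subQ_poly (F * G) = subQ_poly F * G + F * subQ_poly G + (gammaQ F G + gammaQ F G).
Proof.
move=> sF sG; rewrite /subQ_poly laplaceM// vert_sumM// -!/(vert_grad _ _) /gammaQ /euler.
rewrite !(vfieldM, vfieldD); [|smooth_tac..].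
set u := \sum_(e <- _) _.
have -> : cst 2 * u = u + u by apply/funext => z; rewrite !fctE; ring.
ring.
Qed.

Lemma subT_polyM F G : smooth F -> smooth G ->
  subT_poly (F * G) = subT_poly F * G + F * subT_poly G + (gammaT F G + gammaT F G).
Proof.
have [k1 k2 k3 k4] := @skew_A R.
move=> sF sG; rewrite /subT_poly /gammaT !(vfieldM, vfieldD); [|smooth_tac..].
ring.
Qed.

Lemma subT_polyD F G : smooth F -> smooth G ->
  subT_poly (F + G) = subT_poly F + subT_poly G.
Proof.
have [k1 k2 k3 k4] := @skew_A R.
by move=> sF sG; rewrite /subT_poly !vfieldD; [ring|smooth_tac..].
Qed.

Lemma gammaQMr F G H : smooth G -> smooth H ->
  gammaQ F (G * H) = gammaQ F G * H + G * gammaQ F H.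
Proof.
move=> sG sH; rewrite /gammaQ vert_gradMr// /euler !vfieldM//.
have -> : \sum_(e <- basis) dirder e F * dirder e (G * H) =
    (\sum_(e <- basis) dirder e F * dirder e G) * H
    + G * \sum_(e <- basis) dirder e F * dirder e H.
  rewrite mulr_suml mulr_sumr -big_split/=; apply: eq_bigr => e _.
  by rewrite /dirder vfieldM//; ring.
ring.
Qed.

Lemma gammaTMr F G H : smooth G -> smooth H ->
  gammaT F (G * H) = gammaT F G * H + G * gammaT F H.
Proof. by move=> sG sH; rewrite /gammaT !vfieldM//; ring. Qed.

Lemma gammaQDr F G H : smooth G -> smooth H ->
  gammaQ F (G + H) = gammaQ F G + gammaQ F H.
Proof.
move=> sG sH; rewrite /gammaQ vert_gradDr// /euler !vfieldD//.
have -> : \sum_(e <- basis) dirder e F * dirder e (G + H) =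
    (\sum_(e <- basis) dirder e F * dirder e G)
    + \sum_(e <- basis) dirder e F * dirder e H.
  rewrite -big_split/=; apply: eq_bigr => e _.
  by rewrite /dirder vfieldD//; ring.
ring.
Qed.

Lemma gammaTDr F G H : smooth G -> smooth H ->
  gammaT F (G + H) = gammaT F G + gammaT F H.
Proof. by move=> sG sH; rewrite /gammaT !vfieldD//; ring. Qed.

Lemma gammaQ_cst F c : gammaQ F (cst c) = 0.
Proof.
rewrite /gammaQ vert_grad_cst /euler vfield_cst big1 ?mulr0 ?subr0 ?addr0//.
by move=> e _; rewrite /dirder vfield_cst mulr0.
Qed.

Lemma gammaT_cst F c : gammaT F (cst c) = 0.
Proof. by rewrite /gammaT !vfield_cst !mulr0 !addr0 oppr0. Qed.

Lemma subQ_poly_cst (c : R) : subQ_poly (cst c) = 0.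
Proof.
rewrite /subQ_poly /euler vfield_cst ?vfield0 vert_sum_cst /laplace big1 ?mulr0 ?subr0 ?addr0//.
by move=> e _; rewrite /dirder vfield_cst ?vfield0.
Qed.

Lemma subT_poly_cst (c : R) : subT_poly (cst c) = 0.
Proof. by rewrite /subT_poly !vfield_cst ?vfield0 !addr0 oppr0. Qed.

Lemma gammaC F G : gammaQ F G = gammaQ G F /\ gammaT F G = gammaT G F.
Proof.
split; last by rewrite /gammaT; ring.
rewrite /gammaQ vert_gradC mulrC; congr (_ - _ + _).
by apply: eq_bigr => e _; rewrite mulrC.
Qed.

Definition wgen g := [\/ g = re_x, g = sqx | g = sqy].

Lemma wpoly_gen g F : wgen g -> wpoly F -> wpoly (g * F).
Proof. by case=> -> ?; [exact: wpoly_re_x|exact: wpoly_sqx|exact: wpoly_sqy]. Qed.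

Lemma wpoly_rect (P : (HH -> R) -> Prop) : (forall c, P (cst c)) ->
  (forall g F, wgen g -> wpoly F -> P F -> P (g * F)) ->
  (forall F G, wpoly F -> wpoly G -> P F -> P G -> P (F + G)) ->
  forall F, wpoly F -> P F.
Proof.
move=> Pc Pm Pd F; elim=> [//|||| {}F G wF PF wG PG]; last exact: Pd.
- by move=> G wG PG; apply: Pm => //; exact: Or31.
- by move=> G wG PG; apply: Pm => //; exact: Or32.
- by move=> G wG PG; apply: Pm => //; exact: Or33.
Qed.

Lemma wpolyM F G : wpoly F -> wpoly G -> wpoly (F * G).
Proof.
move=> wF wG; move: F wF; apply: wpoly_rect => [c|g F hg _ ih|F H _ _ ihF ihH].
- exact: wpolyZ.
- by rewrite -mulrA; exact: wpoly_gen.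
- by rewrite mulrDl; exact: wpolyD.
Qed.

(** Naming the gradients [a] and [b] turns both carres du champ into expressions without
    derivatives, to be checked in coordinates. *)
Lemma grad_gen F G (a b : HH -> HH) z :
  (forall A x, vf A F x = dot (A x) (a x)) -> (forall A x, vf A G x = dot (A x) (b x)) ->
  gammaQ F G z = dot z (a z) * dot z (b z) - dot (a z) (b z)
    + (dot (Vi z) (a z) * dot (Vi z) (b z) + dot (Vj z) (a z) * dot (Vj z) (b z)
      + dot (Vk z) (a z) * dot (Vk z) (b z)) /\
  gammaT F G z = - (dot (A1 z) (a z) * dot (A1 z) (b z)
    + dot (A2 z) (a z) * dot (A2 z) (b z) + dot (A3 z) (a z) * dot (A3 z) (b z)
    + dot (A4 z) (a z) * dot (A4 z) (b z)).
Proof.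
move=> Fa Gb; split; last first.
  by rewrite -!Fa -!Gb.
rewrite -(dot_basis (a z)) -!Fa -!Gb.
rewrite -[LHS]/(vf id F z * vf id G z
  - (\sum_(e <- basis) dirder e F * dirder e G) z + vert_grad F G z) fct_sumE.
rewrite !Fa !Gb; congr (_ - _ + _); last by rewrite -!Fa -!Gb.
apply: eq_bigr => e _; rewrite -[LHS]/(vf (fun=> e) F z * vf (fun=> e) G z) Fa Gb.
by rewrite !(dotC e).
Qed.

Lemma vf_gen : [/\ forall A x, vf A re_x x = dot (A x) np,
  forall A x, vf A sqx x = dot (A x) (2 *: px x) &
  forall A x, vf A sqy x = dot (A x) (2 *: py x)].
Proof.
have [_ _ ex] := @sqxE R; have [_ _ ey] := @sqyE R.
by split=> A x; rewrite ?vf_re_x// dotZr.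
Qed.

Lemma S7_sq z : S7 z -> sqy z = 1 - sqx z.
Proof.
rewrite /S7 /= => <-; rewrite /sqy /sqx.
case: z => [[[[? ?] ?] ?] [[[? ?] ?] ?]]; rewrite /dot /qdot /=; ring.
Qed.

Ltac coord_ring z := case: z => [[[[? ?] ?] ?] [[[? ?] ?] ?]];
  rewrite /re_x /sqx /sqy /dot /qdot /px /py /= /GRing.scale /=; ring.

Lemma gammaQ_gen : [/\ gammaQ re_x re_x = sqx - cst 1,
    gammaQ re_x sqx = cst 2 * (re_x * sqx) - cst 2 * re_x
    & gammaQ re_x sqy = cst 2 * (re_x * sqy)] /\
  [/\ gammaQ sqx sqx = cst 4 * (sqx * sqx) - cst 4 * sqx,
    gammaQ sqx sqy = cst 4 * (sqx * sqy)
    & gammaQ sqy sqy = cst 4 * (sqy * sqy) - cst 4 * sqy].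
Proof.
have [er ex ey] := vf_gen.
split; split; apply/funext => z; rewrite !fctE.
- rewrite (grad_gen z er er).1; coord_ring z.
- rewrite (grad_gen z er ex).1; coord_ring z.
- rewrite (grad_gen z er ey).1; coord_ring z.
- rewrite (grad_gen z ex ex).1; coord_ring z.
- rewrite (grad_gen z ex ey).1; coord_ring z.
- rewrite (grad_gen z ey ey).1; coord_ring z.
Qed.

Lemma gammaT_gen : [/\ gammaT re_x re_x = - sqy,
    gammaT re_x sqx = cst (-2) * (re_x * sqy)
    & gammaT re_x sqy = cst 2 * (re_x * sqy)] /\
  [/\ gammaT sqx sqx = cst (-4) * (sqx * sqy),
    gammaT sqx sqy = cst 4 * (sqx * sqy)
    & gammaT sqy sqy = cst (-4) * (sqx * sqy)].
Proof.
have [er ex ey] := vf_gen.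
split; split; apply/funext => z; rewrite !fctE.
- rewrite (grad_gen z er er).2; coord_ring z.
- rewrite (grad_gen z er ex).2; coord_ring z.
- rewrite (grad_gen z er ey).2; coord_ring z.
- rewrite (grad_gen z ex ex).2; coord_ring z.
- rewrite (grad_gen z ex ey).2; coord_ring z.
- rewrite (grad_gen z ey ey).2; coord_ring z.
Qed.

(** The two multiplication tables differ on R^8 and coincide once [sqy] is replaced by [1 - sqx],
    that is on S^7. *)
Lemma gamma_wgen g g' : wgen g -> wgen g' ->
  wpoly (gammaQ g g') /\ forall z, S7 z -> gammaT g g' z = gammaQ g g' z.
Proof.
have wc c F := @wpolyZ R c F.
have wr : wpoly re_x by rewrite -(mulr1 re_x); exact: wpoly_re_x (wpoly_cst 1).
have wx : wpoly sqx by rewrite -(mulr1 sqx); exact: wpoly_sqx (wpoly_cst 1).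
have wy : wpoly sqy by rewrite -(mulr1 sqy); exact: wpoly_sqy (wpoly_cst 1).
have [[q1 q2 q3] [q4 q5 q6]] := gammaQ_gen.
have [[t1 t2 t3] [t4 t5 t6]] := gammaT_gen.
have sym F G : (wpoly (gammaQ F G) /\ forall z, S7 z -> gammaT F G z = gammaQ F G z) ->
    wpoly (gammaQ G F) /\ forall z, S7 z -> gammaT G F z = gammaQ G F z.
  by have [-> ->] := gammaC F G.
have rr : wpoly (gammaQ re_x re_x) /\ forall z, S7 z -> gammaT re_x re_x z = gammaQ re_x re_x z.
  rewrite q1 t1; split; first by apply: wpolyD => //; apply/wpolyN/wpoly_cst.
  by move=> z z1; rewrite !fctE (S7_sq z1); ring.
have rx : wpoly (gammaQ re_x sqx) /\ forall z, S7 z -> gammaT re_x sqx z = gammaQ re_x sqx z.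
  rewrite q2 t2; split.
    by apply: wpolyD; [exact/wc/wpoly_re_x|exact/wpolyN/wc].
  by move=> z z1; rewrite !fctE (S7_sq z1); ring.
have ry : wpoly (gammaQ re_x sqy) /\ forall z, S7 z -> gammaT re_x sqy z = gammaQ re_x sqy z.
  by rewrite q3 t3; split=> //; exact/wc/wpoly_re_x.
have xx : wpoly (gammaQ sqx sqx) /\ forall z, S7 z -> gammaT sqx sqx z = gammaQ sqx sqx z.
  rewrite q4 t4; split.
    by apply: wpolyD; [exact/wc/wpoly_sqx|exact/wpolyN/wc].
  by move=> z z1; rewrite !fctE (S7_sq z1); ring.
have xy : wpoly (gammaQ sqx sqy) /\ forall z, S7 z -> gammaT sqx sqy z = gammaQ sqx sqy z.
  by rewrite q5 t5; split=> //; exact/wc/wpoly_sqx.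
have yy : wpoly (gammaQ sqy sqy) /\ forall z, S7 z -> gammaT sqy sqy z = gammaQ sqy sqy z.
  rewrite q6 t6; split.
    by apply: wpolyD; [exact/wc/wpoly_sqy|exact/wpolyN/wc].
  by move=> z z1; rewrite !fctE (S7_sq z1); ring.
by case=> ->; case=> -> //; apply: sym.
Qed.

Lemma vf_vf_quad A f p b : skew A ->
  (forall u v, \sum_(e <- b) dot u e * dot v e = dot u (p v)) ->
  (f = fun z => dot z (p z)) -> forall z,
  vf A (vf A f) z = 2 * (dot (A (A z)) (p z) + dot (A z) (p (A z))).
Proof.
move=> kA bp fE z.
have [|_ _ hf] := @sqr_coordE R b f.
  by rewrite fE; apply/funext => x; rewrite fct_sumE -[RHS]/(\sum_(e <- _) dot x e * dot x e) bp.
have sA e : smooth (fun z => dot (A z) e) by exact: skew_smooth.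
have -> : vf A f = \sum_(e <- b) cst 2 * ((fun z => dot (A z) e) * (fun z => dot z e)).
  by apply/funext => x; rewrite hf fct_sumE mulr_sumr.
rewrite vfield_sum; last by move=> e; have := sA e; move=> *; smooth_tac.
rewrite fct_sumE -!bp -big_split/= mulr_sumr; apply: eq_bigr => e _.
have se := sA e.
rewrite vfieldZ; last by smooth_tac.
rewrite vfieldM//; last by smooth_tac.
by rewrite vfield_dot_skew// vfield_dot !fctE; ring.
Qed.

Lemma subT_gen : [/\ subT_poly re_x = cst 4 * re_x,
  subT_poly sqx = cst 8 * sqx - cst 8 * sqy & subT_poly sqy = cst 8 * sqy - cst 8 * sqx].
Proof.
have [k1 k2 k3 k4] := @skew_A R.
have ex A (kA : skew A) := @vf_vf_quad A sqx px _ kA (@px_dot R) (erefl _).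
have ey A (kA : skew A) := @vf_vf_quad A sqy py _ kA (@py_dot R) (erefl _).
split; apply/funext => z; rewrite !fctE.
- rewrite /subT_poly /re_x !vfield_dot !vfield_dot_skew// !fctE; coord_ring z.
- rewrite /subT_poly !fctE !ex//; coord_ring z.
- rewrite /subT_poly !fctE !ey//; coord_ring z.
Qed.

Lemma subQ_gen : [/\ subQ_poly re_x = cst 7 * re_x + cst (-3) * re_x,
  subQ_poly sqx = cst 16 * sqx - cst 8 & subQ_poly sqy = cst 16 * sqy - cst 8].
Proof.
have [sx hx _] := @sqxE R; have [sy hy _] := @sqyE R.
have L0 : laplace (1 : HH -> R) = 0.
  by rewrite /laplace big1// => e _; rewrite /dirder (vfield_cst _ 1) vfield0.
have s1 : smooth (1 : HH -> R) by smooth_tac.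
split.
- have hr : hpoly 1 re_x by rewrite -(mulr1 re_x); exact: hpoly_re_x (hpoly_cst 1).
  rewrite (subQ_poly_hpoly hr) vert_sum_re_x -(mulr1 re_x) laplace_re_x// L0.
  rewrite /dirder (vfield_cst _ 1) !mulr0 addr0 subr0 mulr1.
  by apply/funext => z; rewrite !fctE; ring.
- rewrite (subQ_poly_hpoly hx) vert_sum_sq.1 -{2}(mulr1 sqx) laplace_sqx// L0.
  rewrite (vfield_cst _ 1) !mulr0 !addr0 mulr1.
  by apply/funext => z; rewrite !fctE; ring.
- rewrite (subQ_poly_hpoly hy) vert_sum_sq.2 -{2}(mulr1 sqy) laplace_sqy// L0.
  rewrite (vfield_cst _ 1) !mulr0 !addr0 mulr1.
  by apply/funext => z; rewrite !fctE; ring.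
Qed.

Lemma sub_wgen g : wgen g -> [/\ smooth g, wpoly (subQ_poly g)
  & forall z, S7 z -> subT_poly g z = subQ_poly g z].
Proof.
have [sx _ _] := @sqxE R; have [sy _ _] := @sqyE R; have sr := @smooth_re_x R.
have wc c F := @wpolyZ R c F.
have wr : wpoly re_x by rewrite -(mulr1 re_x); exact: wpoly_re_x (wpoly_cst 1).
have wx : wpoly sqx by rewrite -(mulr1 sqx); exact: wpoly_sqx (wpoly_cst 1).
have wy : wpoly sqy by rewrite -(mulr1 sqy); exact: wpoly_sqy (wpoly_cst 1).
have [t1 t2 t3] := subT_gen; have [q1 q2 q3] := subQ_gen.
case=> ->; split=> //.
- by rewrite q1; apply: wpolyD; exact: wc.
- by move=> z _; rewrite t1 q1 !fctE; ring.
- by rewrite q2; apply: wpolyD; [exact: wc|exact/wpolyN/wpoly_cst].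
- by move=> z z1; rewrite t2 q2 !fctE (S7_sq z1); ring.
- by rewrite q3; apply: wpolyD; [exact: wc|exact/wpolyN/wpoly_cst].
- by move=> z z1; rewrite t3 q3 !fctE (S7_sq z1); ring.
Qed.

(** The product rule for [g * F] contains the carre du champ of [g] and [F], so its agreement for
    generators [g] belongs to the induction. Stability of [wpoly] lets the comparison be iterated
    along products of factors. *)
Lemma wpoly_subQ F : wpoly F ->
  [/\ wpoly (subQ_poly F), forall g, wgen g -> wpoly (gammaQ g F),
    forall z, S7 z -> subT_poly F z = subQ_poly F z &
    forall g z, wgen g -> S7 z -> gammaT g F z = gammaQ g F z].
Proof.
move: F; apply: wpoly_rect => [c|g F hg wF [wQ wG eT eG]|F G wF wG [wQ1 wG1 eT1 eG1] [wQ2 wG2 eT2 eG2]].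
- rewrite subQ_poly_cst subT_poly_cst; split=> //.
  + exact: (wpoly_cst 0).
  + by move=> g _; rewrite gammaQ_cst; exact: (wpoly_cst 0).
  + by move=> g z _ _; rewrite gammaQ_cst gammaT_cst.
- have [sg wQg eTg] := sub_wgen hg; have sF := smooth_wpoly wF.
  split.
  + rewrite subQ_polyM//; apply: wpolyD; last by apply: wpolyD; exact: wG.
    by apply: wpolyD; [exact: wpolyM|exact: wpoly_gen].
  + move=> h hh; rewrite gammaQMr//; apply: wpolyD.
      by apply: wpolyM => //; exact: (gamma_wgen hh hg).1.
    by apply: wpoly_gen => //; exact: wG.
  + by move=> z z1; rewrite subQ_polyM// subT_polyM// !fctE eT// eTg// eG.
  + move=> h z hh z1; rewrite gammaQMr// gammaTMr// !fctE eG//.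
    by rewrite (gamma_wgen hh hg).2.
- have sF := smooth_wpoly wF; have sG := smooth_wpoly wG.
  split.
  + by rewrite subQ_polyD//; exact: wpolyD.
  + by move=> g hg; rewrite gammaQDr//; apply: wpolyD; [exact: wG1|exact: wG2].
  + by move=> z z1; rewrite subQ_polyD// subT_polyD// !fctE eT1// eT2.
  + by move=> g z hg z1; rewrite gammaQDr// gammaTDr// !fctE eG1// eG2.
Qed.

End Eigen.

(** * Spectral decomposition of polynomials *)

Section Decomposition.
Context {R : realType}.
Local Notation HH := (H2 R).
Local Notation basis := (Defs.basis : seq HH).
Implicit Types (F G : HH -> R) (u v w z e : HH) (mu nu l : R).

Definition eigQ mu F := smooth F /\ forall z, S7 z -> subQ_poly F z = mu * F z.

Lemma subQ_poly0 : subQ_poly 0 = 0 :> (HH -> R).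
Proof.
have := subQ_polyZ 0 (smooth_cst (0 : R)).
by rewrite (_ : (cst 0 : HH -> R) = 0)// !mul0r.
Qed.

Lemma eigQ0 mu : eigQ mu 0.
Proof. by split=> [|z _]; [exact: (smooth_cst 0)|rewrite subQ_poly0 fct0E mulr0]. Qed.

Lemma eigQZ mu c F : eigQ mu F -> eigQ mu (cst c * F).
Proof.
move=> [sF eF]; split=> [|z z1]; first by smooth_tac.
by rewrite subQ_polyZ// !fctE eF//; ring.
Qed.

Lemma eigQ_sum (s : seq R) (f : R -> HH -> R) z : (forall nu, eigQ nu (f nu)) -> S7 z ->
  subQ_poly (\sum_(nu <- s) f nu) z = \sum_(nu <- s) nu * f nu z.
Proof.
move=> ef z1; elim: s => [|nu s ih]; first by rewrite !big_nil subQ_poly0.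
have [sn en] := ef nu; have ss : smooth (\sum_(nu <- s) f nu).
  by apply: smooth_sum => i; case: (ef i).
by rewrite !big_cons subQ_polyD// -[LHS]/(subQ_poly (f nu) z + _ z) ih en.
Qed.

(** Dividing the components of [subQ_poly F - cst mu * F] by nu - mu solves the equation away from
    mu; symmetry rules out a Jordan block at mu itself. *)
Lemma spectral_decomposition F : killed F -> exists (s : seq R) (f : R -> HH -> R),
  [/\ uniq s, forall mu, mu \in s -> hopf_eigenvalue mu, forall mu, eigQ mu (f mu)
    & F = \sum_(mu <- s) f mu].
Proof.
elim=> [|mu {}F muE sF _ [s [g [us sE eg GE]]]].
  by exists [::], (fun=> 0); split=> // [mu|]; [exact: eigQ0|rewrite big_nil].
have [s' [gm [us' s'E mus' [sgm egm] {}GE]]] : exists (s' : seq R) (gm : HH -> R),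
    [/\ uniq s', forall nu, nu \in s' -> hopf_eigenvalue nu, mu \notin s', eigQ mu gm
      & subQ_poly F - cst mu * F = gm + \sum_(nu <- s') g nu].
  have [ms|ms] := boolP (mu \in s).
    exists (rem mu s), (g mu); split=> //; first exact: rem_uniq.
    - by move=> nu /mem_rem; exact: sE.
    - by rewrite mem_rem_uniqF.
    - by rewrite GE (big_rem mu ms).
  by exists s, 0; split=> //; [exact: eigQ0|rewrite add0r].
pose f nu := cst (nu - mu)^-1 * g nu.
have ef nu : eigQ nu (f nu) by exact: eigQZ.
pose p := F - \sum_(nu <- s') f nu.
have sS : smooth (\sum_(nu <- s') f nu) by apply: smooth_sum => nu; case: (ef nu).
have sp : smooth p by rewrite /p; smooth_tac.
have pE z : S7 z -> subQ_poly p z = mu * p z + gm z.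
  move=> z1; have -> : p = F + cst (-1) * \sum_(nu <- s') f nu.
    by apply/funext => w; rewrite /p !fctE; ring.
  rewrite subQ_polyD ?subQ_polyZ; [|smooth_tac..].
  rewrite -[LHS]/(subQ_poly F z + -1 * subQ_poly (\sum_(nu <- s') f nu) z) eigQ_sum//.
  have := congr1 (fun G : HH -> R => G z) GE.
  rewrite -[X in X = _]/(subQ_poly F z - mu * F z) -[X in _ = X]/(gm z + (\sum_(nu <- s') g nu) z).
  move/eqP; rewrite subr_eq => /eqP ->.
  rewrite -[X in _ = X + _]/(mu * (F z + -1 * (\sum_(nu <- s') f nu) z)) !fct_sumE.
  have -> : \sum_(nu <- s') g nu z = \sum_(nu <- s') nu * f nu z - mu * \sum_(nu <- s') f nu z.
    rewrite mulr_sumr -sumrB big_seq [RHS]big_seq; apply: eq_bigr => nu nus.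
    have nm : nu - mu != 0 by rewrite subr_eq0; apply: contra mus' => /eqP <-.
    by rewrite -mulrBl /f !fctE mulrA mulfV// mul1r.
  ring.
(* On S^7, [gm] lies both in the image of Delta_Q - mu, through [p], and in its kernel; by symmetry
   it is orthogonal to itself. *)
have gm0 z : S7 z -> gm z = 0.
  move=> z1; apply: (sint_sqr_eq0 sgm) z1 => {z}.
  have -> : sint (gm * gm) = sint ((subQ_poly p + cst (- mu) * p) * gm).
    by apply: sint_eq => z z1; rewrite !fctE pE//; ring.
  rewrite sintDM; [|smooth_tac..]; rewrite sintZM// subQ_sym//.
  have -> : sint (p * subQ_poly gm) = sint (cst mu * p * gm).
    by apply: sint_eq => z z1; rewrite !fctE egm//; ring.
  by rewrite sintZM// mulNr subrr.
have ep : eigQ mu p by split=> // z z1; rewrite pE// gm0// addr0.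
exists (mu :: s'), (fun nu => if nu == mu then p else f nu); split.
- by rewrite /= mus'.
- by move=> nu; rewrite inE => /orP[/eqP ->//|/s'E].
- by move=> nu; case: eqP => // ->.
rewrite big_cons eqxx big_seq (eq_bigr f); first by rewrite -big_seq subrK.
by move=> nu ns; case: eqP => // e; rewrite -e ns in mus'.
Qed.

Lemma eigQ_orth mu nu F G : eigQ mu F -> eigQ nu G -> mu != nu -> sint (F * G) = 0.
Proof.
move=> [sF eF] [sG eG] mn; apply/eqP.
suff : (mu - nu) * sint (F * G) == 0 by rewrite mulf_eq0 subr_eq0 (negPf mn).
rewrite mulrBl subr_eq0 -!sintZM//; apply/eqP.
have -> : sint (cst mu * F * G) = sint (subQ_poly F * G).
  by apply: sint_eq => z z1; rewrite !fctE eF.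
rewrite subQ_sym//; apply: sint_eq => z z1; rewrite !fctE eG//; ring.
Qed.

Lemma pythagoras (s : seq R) (f : R -> HH -> R) : uniq s -> (forall nu, eigQ nu (f nu)) ->
  let S := \sum_(nu <- s) f nu in sint (S * S) = \sum_(nu <- s) sint (f nu * f nu).
Proof.
move=> + ef /=; have sf nu : smooth (f nu) by case: (ef nu).
elim: s => [|mu s ih] /=.
  by rewrite !big_nil mul0r (_ : 0 = cst 0 :> (HH -> R))// -(mulr1 (cst 0)) sintZ ?mul0r//; exact: (bm_cst 1).
case/andP=> ms us; rewrite !big_cons -ih//.
set S := \sum_(nu <- s) f nu; have sS : smooth S by exact: smooth_sum.
have fS : sint (f mu * S) = 0.
  rewrite /S mulr_sumr sint_sum; last by move=> i; have := sf i => ?; have := sf mu => ?; smooth_tac.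
  rewrite big_seq big1// => nu ns; apply: (@eigQ_orth mu nu) => //.
  by apply: contraNneq ms => ->.
have := sf mu => sm.
rewrite sintDM; [|smooth_tac..].
rewrite [f mu * _]mulrC [S * _]mulrC !sintDM; [|smooth_tac..].
by rewrite [S * f mu]mulrC fS addr0 add0r.
Qed.

(** Each eigencomponent is divided by nu - l, of absolute value at least [d]; orthogonality of the
    components turns this into a bound on the whole. *)
Lemma poly_resolvent l (d : R) F : 0 < d -> (forall nu, hopf_eigenvalue nu -> d <= `|nu - l|) ->
  killed F -> exists r : HH -> R, [/\ smooth r, forall z, S7 z -> subQ_poly r z = l * r z + F z
    & d ^+ 2 * sint (r * r) <= sint (F * F)].
Proof.
move=> d0 dE /spectral_decomposition[s [f [us sE ef ->]]].
pose g nu := cst (nu - l)^-1 * f nu.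
have eg nu : eigQ nu (g nu) by exact: eigQZ.
have sf nu : smooth (f nu) by case: (ef nu).
exists (\sum_(nu <- s) g nu); split.
- by apply: smooth_sum => nu; case: (eg nu).
- move=> z z1; rewrite eigQ_sum// !fct_sumE mulr_sumr -big_split/=.
  rewrite big_seq [RHS]big_seq; apply: eq_bigr => nu ns.
  have nl : nu - l != 0 by rewrite -normr_gt0; exact: lt_le_trans d0 (dE _ (sE _ ns)).
  by rewrite /g !fctE; field.
rewrite !pythagoras// mulr_sumr big_seq [leRHS]big_seq; apply: ler_sum => nu ns.
have dn := dE _ (sE _ ns).
have -> : sint (g nu * g nu) = (nu - l) ^- 2 * sint (f nu * f nu).
  rewrite -sintZ; last by apply: smooth_bm; have := sf nu => ?; smooth_tac.
  by congr sint; apply/funext => z; rewrite /g !fctE -exprVn; ring.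
rewrite mulrA ler_piMl ?sint_sqr_ge0// ler_pdivrMr ?mul1r.
  by rewrite -(real_normK (num_real (nu - l))) lerXn2r ?nnegrE// ltW.
by rewrite exprn_even_gt0//= -normr_gt0 (lt_le_trans d0).
Qed.

Lemma hopf_eigenvalue_int l : hopf_eigenvalue l -> exists i : int, l = i%:~R.
Proof.
move=> [m [j ->]]; set k := (m + j.*2)%N.
by exists (k%:Z * (k%:Z + 6) - m%:Z * (m%:Z + 2)); rewrite !(rmorphB, rmorphM, rmorphD)/= -!pmulrn.
Qed.

(** Eigenvalues are integers: the gap is 1 if [l] is an integer, and otherwise the distance from [l]
    to its nearest integer. *)
Lemma hopf_eigenvalue_gap l : ~ hopf_eigenvalue l ->
  exists2 d : R, 0 < d & forall nu, hopf_eigenvalue nu -> d <= `|nu - l|.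
Proof.
move=> nl; pose n := Num.floor l.
have n1 : n%:~R <= l by exact: floor_le.
have n2 : l < n%:~R + 1 by have := floorD1_gt l; rewrite intrD.
have [e|e] := eqVneq l n%:~R.
  exists 1 => // nu nuE; have [i iE] := hopf_eigenvalue_int nuE.
  rewrite e iE -intrB -intr_norm ler1z -gtz0_ge1 normr_gt0 subr_eq0.
  by apply: contra_notN nl => /eqP ni; rewrite e -ni -iE.
exists (Num.min (l - n%:~R) (n%:~R + 1 - l)).
  by rewrite lt_min !subr_gt0 n2 lt_neqAle eq_sym e n1.
move=> nu /hopf_eigenvalue_int[i ->]; rewrite ge_min.
have [ni|ni] := leP i n.
  apply/orP; left; rewrite ler0_norm ?opprB ?lerB ?ler_int//.
  by rewrite subr_le0 (le_trans _ n1)// ler_int.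
apply/orP; right; have h : n%:~R + 1 <= i%:~R :> R by rewrite -[1]/(1%:~R) -intrD ler_int lezD1.
by rewrite ger0_norm ?lerB// subr_ge0 (le_trans (ltW n2)).
Qed.

End Decomposition.

(** * Powers of a function that peaks at np *)

Section Peak.
Context {R : realType}.
Local Notation HH := (H2 R).
Local Notation basis := (Defs.basis : seq HH).
Local Notation sigma := (@sphere_measure R).
Implicit Types (F G : HH -> R) (u v w z e : HH).

Definition peak : HH -> R := cst 2^-1 + cst 2^-1 * re_x.

Lemma fctXE F n z : (F ^+ n) z = F z ^+ n.
Proof. by elim: n => [|n ih]; rewrite ?expr0// !exprS -ih. Qed.

Lemma smoothX F n : smooth F -> smooth (F ^+ n).
Proof. by move=> sF; elim: n => [|n ih]; rewrite ?expr0 ?exprS; smooth_tac. Qed.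

Lemma smooth_peak : smooth peak.
Proof. by have := @smooth_re_x R => ?; rewrite /peak; smooth_tac. Qed.

Lemma peakE z : S7 z -> dot (z - np) (z - np) = 4 * (1 - peak z).
Proof.
move=> z1; rewrite !(dotDl, dotDr, dotNl, dotNr) dot_np (dotC np z).
rewrite -[peak z]/(2^-1 + 2^-1 * dot z np).
by have -> : dot z z = 1; [exact: z1|field].
Qed.

Lemma peak_itv z : S7 z -> 0 <= peak z <= 1.
Proof.
move=> z1; have h := dot_ge0 (z - np); rewrite peakE// in h.
have : 0 <= dot (z + np) (z + np) by exact: dot_ge0.
have -> : dot (z + np) (z + np) = 4 * peak z.
  rewrite !(dotDl, dotDr) dot_np (dotC np z) -[peak z]/(2^-1 + 2^-1 * dot z np).
  by have -> : dot z z = 1; [exact: z1|field].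
move=> h'; apply/andP; split; lra.
Qed.

Lemma peak_lt1 z : S7 z -> z <> np -> peak z < 1.
Proof.
move=> z1 zn; have /andP[_ h] := peak_itv z1; rewrite lt_neqAle h andbT.
apply/eqP => p1; apply: zn; apply/eqP; rewrite -subr_eq0; apply/eqP; apply: dot_eq0.
by rewrite peakE// p1 subrr mulr0.
Qed.

Lemma peak_sup (U : set HH) : open U -> U np ->
  exists r : R, [/\ 0 <= r, r < 1 & forall z, S7 z -> ~ U z -> peak z <= r].
Proof.
move=> oU Unp; pose K := S7 `&` ~` U.
have [[p Kp]|K0] := pselect (K !=set0); last first.
  exists 0; split=> // z z1 nU; exfalso; apply: K0; by exists z.
have cK : compact K.
  apply: (subclosed_compact _ compact_S7); last by move=> z [].
  apply: closedI; last exact: open_closedC.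
  exact: compact_closed (@norm_hausdorff _ _) compact_S7.
have [||c Kc h] := @compact_EVT_max _ R peak K _ cK.
- by exists p.
- apply: continuous_subspaceT; exact: smooth_continuous smooth_peak.
move: Kc; rewrite inE => -[c1 cU].
exists (peak c); split.
- by have /andP[] := peak_itv c1.
- by apply: peak_lt1 => // e; apply: cU; rewrite e.
- by move=> z z1 zU; apply: h; rewrite inE.
Qed.

(** The argument of Laplace's method: with F np > 0, the contribution near [np] decays no faster
    than r'^N, while that of the region where [F] may be negative is at most of order r^N, with r <
    r'. *)
Lemma peak_detects F : smooth F -> F np != 0 -> exists N, sint (F * peak ^+ N) != 0.
Proof.
wlog F0 : F / 0 < F np.
  move=> h sF Fnp; have [F0|F0] := ltP 0 (F np); first exact: h.
  have [|||N hN] := h (- F); [|by smooth_tac| |].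
  - by rewrite -[ltRHS]/(- F np) oppr_gt0 lt_neqAle Fnp.
  - by rewrite -[X in X != _]/(- F np) oppr_eq0.
  exists N; apply: contra hN; rewrite mulNr => /eqP FN.
  rewrite sintN ?FN ?oppr0//; apply: smooth_bm; apply: smoothM => //.
  exact: smoothX smooth_peak.
move=> sF _; apply: contrapT => /forallNP nN.
have F_eq0 N : sint (F * peak ^+ N) = 0 by apply/eqP; have /negP := nN N; rewrite negbK.
pose c := F np / 2; have c0 : 0 < c by rewrite divr_gt0.
pose U := F @^-1` `]c, +oo[%classic.
have oU : open U by apply: open_comp; [move=> z _; exact: smooth_continuous|exact: interval_open].
have [r [r0 r1 hr]] : exists r : R, [/\ 0 <= r, r < 1 & forall z, S7 z -> ~ U z -> peak z <= r].
  by apply: peak_sup oU _; rewrite /U /= in_itv/= andbT /c; lra.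
have [M M0 hM] := S7_bounded (smooth_continuous sF).
(* Any number strictly between [r] and 1 would do; [peak] exceeds it on a neighbourhood [W] of
   [np]. *)
pose r' := (1 + r) / 2.
have r'0 : 0 < r' by rewrite /r'; lra.
have rr' : r < r' by rewrite /r'; lra.
have r'1 : r' < 1 by rewrite /r'; lra.
pose W := peak @^-1` `]r', +oo[%classic.
have cp := smooth_continuous smooth_peak.
have mW : measurable W.
  by rewrite /W -[X in measurable X]setTI; apply: smooth_measurable => //; exact: smooth_peak.
have np1 : S7 np := dot_np.
have s0 : 0 < sint (\1_W : HH -> R).
  rewrite -lte_fin sint_indic//. 
  have h1 := @sphere_measure_gt0 R W np mW. apply: h1; last exact: np1.
  have o : nbhs (peak np) `]r', +oo[%classic.
    apply: open_nbhs_nbhs; split; first exact: interval_open.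
    rewrite /= in_itv/= andbT; apply: lt_le_trans r'1 _.
    by rewrite -[peak np]/(2^-1 + 2^-1 * dot np np) dot_np; lra.
  exact: (cp _ _ o).
set s := sint (\1_W : HH -> R) in s0.
pose V := sint (cst 1 : HH -> R).
have V0 : 0 <= V by apply: sint_ge0.
(* The vanishing integral is at least c r'^N s - M r^N V; dividing by r'^N gives a bound that tends
   to 0. *)
have key N : c * s <= M * V * (r / r') ^+ N.
  have bX : bm (F * peak ^+ N).
    by apply: smooth_bm; apply: smoothM => //; exact: smoothX smooth_peak.
  have bW := bm_indic mW.
  have b1 : bm (cst (c * r' ^+ N) * \1_W : HH -> R) by apply: bmM => //; exact: bm_cst.
  have b2 : bm (cst (- (M * r ^+ N)) * cst 1 : HH -> R) by apply: bmM; exact: bm_cst.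
  have h : sint (cst (c * r' ^+ N) * \1_W + cst (- (M * r ^+ N)) * cst 1 : HH -> R)
      <= sint (F * peak ^+ N).
    apply: sint_le => //; first exact: bmD.
    move=> z z1; rewrite [leRHS](_ : _ = F z * peak z ^+ N); last by rewrite -fctXE.
    rewrite -[leLHS]/(c * r' ^+ N * \1_W z + - (M * r ^+ N) * 1) mulr1 indicE.
    have /andP[p0 p1] := peak_itv z1.
    have [Uz|Uz] := pselect (U z).
      have cF : c < F z by move: Uz; rewrite /U /= in_itv/= andbT.
      have B : 0 <= M * r ^+ N by rewrite mulr_ge0// exprn_ge0.
      have [/set_mem|_] := boolP (z \in W).
        rewrite /W /= in_itv/= andbT mulr1 => rp.
        apply: (@le_trans _ _ (c * r' ^+ N)); first by rewrite gerDl oppr_le0.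
        apply: ler_pM; [exact: ltW|by rewrite exprn_ge0// ltW|exact: ltW|].
        by rewrite lerXn2r ?nnegrE// ltW.
      rewrite mulr0 add0r; apply: (@le_trans _ _ 0); first by rewrite oppr_le0.
      by rewrite mulr_ge0 ?exprn_ge0// ltW// (lt_trans c0).
    have pr := hr _ z1 Uz.
    have -> : z \in W = false.
      apply/negbTE/negP => /set_mem; rewrite /W /= in_itv/= andbT ltNge.
      by rewrite (le_trans pr (ltW rr')).
    rewrite mulr0 add0r lerNl; apply: le_trans (ler_norm _) _.
    rewrite normrN normrM; apply: ler_pM => //; first exact: hM.
    by rewrite ger0_norm ?exprn_ge0// lerXn2r ?nnegrE.
  move: h; rewrite F_eq0 sintD// sintZ// sintZ; last exact: bm_cst.
  rewrite -/s -/V => h.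
  have r'N : r' ^+ N != 0 by rewrite expf_neq0// gt_eqF.
  rewrite expr_div_n mulrA ler_pdivlMr ?exprn_gt0//; lra.
have q1 : `|r / r'| < 1.
  by rewrite ger0_norm ?ltr_pdivrMr ?mul1r//; apply: divr_ge0 => //; exact: ltW.
have cv : (fun N => M * V * (r / r') ^+ N) @ \oo --> M * V * 0.
  by apply: cvgMr; exact: cvg_expr.
have : c * s <= M * V * 0 by apply: (cvgr_to_ge cv); exact: nearW.
by rewrite mulr0 leNgt mulr_gt0.
Qed.

End Peak.

(** * Density of polynomials in L^2 *)

Section Density.
Context {R : realType}.
Local Notation HH := (H2 R).
Local Notation basis := (Defs.basis : seq HH).
Implicit Types (F G q : HH -> R) (u v w z e : HH).

Inductive spoly : (HH -> R) -> Prop :=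
| spoly_hpoly k F : hpoly k F -> spoly F
| spolyD F G : spoly F -> spoly G -> spoly (F + G).

Lemma smooth_spoly F : spoly F -> smooth F.
Proof. by elim=> [k {}F|{}F G _ sF _ sG]; [exact: smooth_hpoly|smooth_tac]. Qed.

Lemma killed_spoly F : spoly F -> killed F.
Proof.
elim=> [k {}F hF|{}F G _ kF _ kG]; [|exact: killedD].
exact: killed_hpoly hF.
Qed.

Lemma spolyM F G : spoly F -> spoly G -> spoly (F * G).
Proof.
move=> pF; elim: pF G => [k {}F hF|{}F F' _ ih _ ih'] G pG.
  elim: pG => [k' {}G hG|{}G G' _ ih _ ih'].
    exact: spoly_hpoly (hpolyM hF hG).
  by rewrite mulrDr; exact: spolyD.
by rewrite mulrDl; apply: spolyD; [exact: ih|exact: ih'].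
Qed.

Lemma spoly_cst (c : R) : spoly (cst c).
Proof. exact: spoly_hpoly (hpoly_cst c). Qed.

Lemma spoly_dot e : spoly (fun z => dot z e).
Proof. by rewrite -(mulr1 (fun z => _)); exact: spoly_hpoly (hpoly_dot e (hpoly_cst 1)). Qed.

(** Boundedness makes the approximable functions an algebra, so that the sets with approximable
    indicator form a sigma-algebra. *)
Definition approx F := bm F /\ forall eps : R, 0 < eps ->
  exists q, spoly q /\ sint ((F - q) * (F - q)) < eps.

Lemma bmB F G : bm F -> bm G -> bm (F - G).
Proof. by move=> bF bG; apply: bmD => //; exact: bmN. Qed.

Lemma bm_spoly q : spoly q -> bm q.
Proof. by move=> /smooth_spoly; exact: smooth_bm. Qed.

Lemma sint0 : sint (0 : HH -> R) = 0.
Proof.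
by rewrite -(mul0r (1 : HH -> R)) (_ : 0 = cst 0 :> (HH -> R))// sintZ ?mul0r//; exact: (bm_cst 1).
Qed.

Lemma approx_spoly q : spoly q -> approx q.
Proof.
move=> pq; split=> [|eps e0]; first exact: bm_spoly.
by exists q; split=> //; rewrite subrr mul0r sint0.
Qed.

Lemma sint_sqrD F G : bm F -> bm G ->
  sint ((F + G) * (F + G)) <= 2 * sint (F * F) + 2 * sint (G * G).
Proof.
move=> bF bG; rewrite -!sintZ -?sintD; try by do ?[exact: bm_cst|apply: bmM].
apply: sint_le; try by do ?[exact: bm_cst|apply: bmM|apply: bmD].
move=> z _; rewrite !fctE -subr_ge0.
have -> : 2 * (F z * F z) + 2 * (G z * G z) - (F z + G z) * (F z + G z) = (F z - G z) ^+ 2 by ring.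
exact: sqr_ge0.
Qed.

Lemma sint_sqrM F G (M : R) : bm F -> bm G -> (forall z, S7 z -> `|F z| <= M) ->
  sint ((F * G) * (F * G)) <= M ^+ 2 * sint (G * G).
Proof.
move=> bF bG hM; rewrite -sintZ; last exact: bmM.
apply: sint_le; try by do ?[exact: bm_cst|apply: bmM|apply: bmD].
move=> z z1; rewrite !fctE.
have -> : F z * G z * (F z * G z) = F z ^+ 2 * (G z * G z) by ring.
apply: ler_wpM2r; first by rewrite -expr2 sqr_ge0.
by rewrite -(real_normK (num_real (F z))) lerXn2r ?nnegrE ?hM// (le_trans _ (hM _ z1)).
Qed.

Lemma approx_closed F : bm F -> (forall eps : R, 0 < eps ->
  exists G, approx G /\ sint ((F - G) * (F - G)) < eps) -> approx F.
Proof.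
move=> bF h; split=> // eps e0; have e4 : 0 < eps / 4 by rewrite divr_gt0.
have [G [[bG /(_ _ e4)[q [pq hq]]] hG]] := h _ e4.
exists q; split=> //; have bq := bm_spoly pq.
have -> : F - q = (F - G) + (G - q) by ring.
apply: le_lt_trans (sint_sqrD (bmB bF bG) (bmB bG bq)) _; lra.
Qed.

Lemma approxD F G : approx F -> approx G -> approx (F + G).
Proof.
move=> [bF aF] [bG aG]; split=> [|eps e0]; first exact: bmD.
have e4 : 0 < eps / 4 by rewrite divr_gt0.
have [p [pp hp]] := aF _ e4; have [q [pq hq]] := aG _ e4.
have bp := bm_spoly pp; have bq := bm_spoly pq.
exists (p + q); split; first exact: spolyD.
have -> : F + G - (p + q) = (F - p) + (G - q) by ring.
apply: le_lt_trans (sint_sqrD (bmB bF bp) (bmB bG bq)) _; lra.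
Qed.

Lemma approxM F G : approx F -> approx G -> approx (F * G).
Proof.
move=> [bF aF] [bG aG]; split=> [|eps e0]; first exact: bmM.
have [mF [M hM]] := bF.
have d0 : 0 < eps / (4 * (M ^+ 2 + 1)).
  by rewrite divr_gt0// mulr_gt0// ltr_wpDl// sqr_ge0.
have [q [pq hq]] := aG _ d0; have bq := bm_spoly pq.
(* The error splits as F (G - q) + q (F - p): the accuracy required of [p] depends on the bound [N]
   of [q], so [q] is chosen first. *)
have [mq [N hN]] := bq.
have d0' : 0 < eps / (4 * (N ^+ 2 + 1)).
  by rewrite divr_gt0// mulr_gt0// ltr_wpDl// sqr_ge0.
have [p [pp hp]] := aF _ d0'; have bp := bm_spoly pp.
exists (p * q); split; first exact: spolyM.
have -> : F * G - p * q = F * (G - q) + q * (F - p) by ring.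
apply: le_lt_trans (sint_sqrD (bmM bF (bmB bG bq)) (bmM bq (bmB bF bp))) _.
have small (K x : R) : x < eps / (4 * (K ^+ 2 + 1)) -> 0 <= x -> K ^+ 2 * x < eps / 4.
  move=> hx x0; have K1 : 0 < K ^+ 2 + 1 by rewrite ltr_wpDl// sqr_ge0.
  apply: (@le_lt_trans _ _ ((K ^+ 2 + 1) * x)); first by rewrite ler_wpM2r// lerDl.
  by move: hx; rewrite invfM mulrA ltr_pdivlMr// mulrC.
have h1 := small _ _ hq (sint_sqr_ge0 _); have h2 := small _ _ hp (sint_sqr_ge0 _).
have h3 := sint_sqrM bF (bmB bG bq) hM; have h4 := sint_sqrM bq (bmB bF bp) hN.
lra.
Qed.

Lemma approx_cst (c : R) : approx (cst c).
Proof. exact: approx_spoly (spoly_cst c). Qed.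

Lemma approxN F : approx F -> approx (- F).
Proof.
move=> aF; have -> : - F = cst (-1) * F by apply/funext => z; rewrite -[LHS]mulN1r.
by apply: approxM => //; exact: approx_cst.
Qed.

Lemma approxX F n : approx F -> approx (F ^+ n).
Proof.
move=> aF; elim: n => [|n ih]; first exact: (approx_cst 1).
by rewrite exprS; exact: approxM.
Qed.

Lemma approx_sum (I : Type) (s : seq I) (f : I -> HH -> R) : (forall i, approx (f i)) ->
  approx (\sum_(i <- s) f i).
Proof.
by move=> af; elim/big_ind : _ => [||i _] //; [exact: (approx_cst 0)|exact: approxD].
Qed.

Lemma approx_lim (f : nat -> HH -> R) F (M : R) : (forall n, approx (f n)) -> bm F ->
  (forall n z, S7 z -> `|f n z| <= M) -> (forall z, S7 z -> f n z @[n --> \oo] --> F z) ->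
  approx F.
Proof.
move=> af bF hM fF; have [mF [N hN]] := bF.
have bf n : bm (f n) by case: (af n).
apply: approx_closed => // eps e0.
pose d n := (F - f n) * (F - f n).
have bd n : bm (d n) by apply: bmM; exact: bmB.
have h : sint (d n) @[n --> \oo] --> sint (cst 0 : HH -> R).
  apply: (@sint_dominated R d (cst 0) ((N + M) * (N + M))) => //; first exact: bm_cst.
  - move=> n z z1; rewrite normrM.
    have : `|F z - f n z| <= N + M.
      by apply: le_trans (ler_normB _ _) _; apply: lerD; [exact: hN|exact: hM].
    by move=> ?; apply: ler_pM.
  - move=> z z1; have e : (fun n => F z - f n z) @ \oo --> F z - F z.
      by apply: cvgB; [exact: cvg_cst|exact: fF].
    rewrite subrr in e; rewrite -[X in _ --> X](mulr0 0); exact: (cvgM e e).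
rewrite (_ : cst 0 = 0)// sint0 in h; move: h => /cvgr_lt /(_ _ e0)[n _ /(_ n (leqnn n)) hn].
by exists (f n).
Qed.

Lemma bernoulli (y : R) m : -1 <= y -> 1 + m%:R * y <= (1 + y) ^+ m.
Proof.
move=> y1; elim: m => [|m ih]; first by rewrite mul0r addr0 expr0.
have y0 : 0 <= 1 + y by lra.
rewrite exprS; apply: le_trans (ler_wpM2l y0 ih).
rewrite -subr_ge0 -natr1.
have -> : (1 + y) * (1 + m%:R * y) - (1 + (m%:R + 1) * y) = m%:R * y ^+ 2 by ring.
by rewrite mulr_ge0// sqr_ge0.
Qed.

(* By Bernoulli's inequality, the sequence is at least [1 - (2 t) ^+ n] and at
   most [(2 t) ^- n]. *)
Lemma cvg_step (t : R) : 0 <= t <= 1 -> t != 2^-1 ->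
  (1 - t ^+ n) ^+ (2 ^ n) @[n --> \oo] --> (((t < 2^-1)%R)%:R : R).
Proof.
move=> /andP[t0 t1] th.
have tn n : 0 <= t ^+ n <= 1 by rewrite exprn_ge0//= exprn_ile1.
have p0 n : 0 <= (1 - t ^+ n) ^+ (2 ^ n) by rewrite exprn_ge0// subr_ge0; case/andP: (tn n).
have e n : (2 ^ n)%:R * t ^+ n = (2 * t) ^+ n by rewrite natrX exprMn.
have [tl|tl] := ltP t 2^-1.
  apply: (@squeeze_cvgr _ _ _ _ (fun n => 1 - (2 * t) ^+ n) (fun=> 1)); last exact: cvg_cst.
    apply: nearW => n; have /andP[h0 h1] := tn n; apply/andP; split.
      have := @bernoulli (- t ^+ n) (2 ^ n); rewrite mulrN e; apply; lra.
    by rewrite exprn_ile1 ?subr_ge0// gerBl.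
  rewrite -[X in _ --> X](subr0 1); apply: cvgB; first exact: cvg_cst.
  by apply: cvg_expr; rewrite ger0_norm; lra.
have {}tl : 2^-1 < t by rewrite lt_neqAle eq_sym th.
have t2 : 1 < 2 * t by lra.
apply: (@squeeze_cvgr _ _ _ _ (fun=> 0) (fun n => ((2 * t)^-1) ^+ n)); [|exact: cvg_cst|].
  apply: nearW => n; rewrite p0/= exprVn -[leRHS]mul1r ler_pdivlMr; last by rewrite exprn_gt0//; lra.
  have /andP[h0 h1] := tn n.
  apply: (@le_trans _ _ ((1 - t ^+ n) ^+ (2 ^ n) * (1 + t ^+ n) ^+ (2 ^ n))).
    apply: ler_wpM2l => //; rewrite -e; apply: le_trans (bernoulli _ _); last lra.
    by rewrite lerDr.
  rewrite -exprMn -subr_sqr expr1n exprn_ile1 ?subr_ge0 ?gerBl ?sqr_ge0//.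
  by rewrite exprn_ile1.
apply: cvg_expr; rewrite ger0_norm ?invr_ge0; last lra.
by rewrite invf_lt1; lra.
Qed.

End Density.

(** * Polynomial approximation of indicators and of bounded functions *)

Section Indicators.
Context {R : realType}.
Local Notation HH := (H2 R).
Local Notation basis := (Defs.basis : seq HH).
Implicit Types (F G q : HH -> R) (u v w z e : HH) (A : set HH).

Lemma coord_le1 e z : e \in basis -> S7 z -> `|dot z e| <= 1.
Proof.
move=> be z1; rewrite -(@expr_le1 _ 2)// real_normK ?num_real//.
have <- : dot z z = 1 by exact: z1.
exact: coord_sqr_le.
Qed.

Definition approx_set A := measurable A /\ approx (\1_A : HH -> R).

(** On S^7 the function [y] takes values between 0 and 1 and vanishes exactly on the hyperplane, so
    the powers of 1 - y converge to its indicator. *)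
Lemma approx_set_coord_eq e a : e \in basis -> approx_set [set z | dot z e = a].
Proof.
move=> be; set A := [set z | _].
have mA : measurable A.
  by rewrite /A -[X in measurable X]setTI; exact: (measurable_dotr e measurableT (measurable_set1 a)).
split=> //; pose c := (1 + `|a|) ^+ 2.
have c0 : 0 < c by rewrite exprn_gt0// ltr_wpDr.
pose y : HH -> R := cst c^-1 * ((fun z => dot z e) - cst a) ^+ 2.
have ay : approx y.
  apply: approxM; first exact: approx_cst.
  by apply/approxX/approxD; [exact: approx_spoly (spoly_dot e)|exact/approxN/approx_cst].
have yE z : y z = c^-1 * (dot z e - a) ^+ 2 by rewrite /y -[LHS]/(c^-1 * (((fun z => dot z e) - cst a) ^+ 2) z) fctXE.
have y1 z : S7 z -> 0 <= y z <= 1.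
  move=> z1; rewrite yE mulr_ge0 ?invr_ge0 ?(ltW c0) ?sqr_ge0//=.
  rewrite mulrC ler_pdivrMr// mul1r -(real_normK (num_real (_ - _))).
  rewrite lerXn2r ?nnegrE ?addr_ge0//.
  by apply: le_trans (ler_normB _ _) _; rewrite lerD2r coord_le1.
apply: (@approx_lim R (fun n => (cst 1 - y) ^+ n) _ 1).
- by move=> n; apply/approxX/approxD; [exact: approx_cst|exact: approxN].
- exact: bm_indic.
- move=> n z z1; rewrite fctXE -[_ z]/(1 - y z) normrX exprn_ile1//.
  by have /andP[h0 h1] := y1 _ z1; rewrite ger0_norm ?subr_ge0// gerBl.
move=> z z1; under eq_fun do rewrite fctXE -[_ z]/(1 - y z).
have /andP[h0 h1] := y1 _ z1; rewrite indicE.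
have [/set_mem za|za] := boolP (z \in A).
  by rewrite yE (_ : dot z e = a)// subrr expr0n mulr0 subr0; under eq_fun do rewrite expr1n; exact: cvg_cst.
apply: cvg_expr; rewrite ger0_norm ?subr_ge0// ltrBlDr ltrDl yE mulr_gt0 ?invr_gt0//.
rewrite exprn_even_gt0//= subr_eq0; apply: contra za => /eqP h; exact/mem_set.
Qed.

(** The affine map [t] sends [a] to 1/2 and the range of the coordinate on S^7 into the unit
    interval, where [cvg_step] applies. The excluded value 1/2 is the hyperplane [E], suppressed by
    the factor [cst 1 - \1_E]. *)
Lemma approx_set_coord_lt e a : e \in basis -> approx_set [set z | dot z e < a].
Proof.
move=> be; set A := [set z | _].
have mA : measurable A.
  rewrite (_ : A = (fun z => dot z e) @^-1` `]-oo, a[%classic).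
    by rewrite -[X in measurable X]setTI; exact: (measurable_dotr e measurableT (measurable_itv _)).
  by apply/seteqP; split=> z /=; rewrite in_itv.
split=> //; pose c := 2 * (1 + `|a|).
have c0 : 0 < c by rewrite mulr_gt0// ltr_wpDr.
pose t : HH -> R := cst 2^-1 + cst c^-1 * ((fun z => dot z e) - cst a).
have tE z : t z = 2^-1 + c^-1 * (dot z e - a) by [].
have at_ : approx t.
  apply: approxD; [exact: approx_cst|apply: approxM; [exact: approx_cst|]].
  by apply: approxD; [exact: approx_spoly (spoly_dot e)|exact/approxN/approx_cst].
have t1 z : S7 z -> 0 <= t z <= 1.
  move=> z1; have : `|c^-1 * (dot z e - a)| <= 2^-1.
    rewrite normrM gtr0_norm ?invr_gt0// mulrC ler_pdivrMr//.
    rewrite /c mulrA mulVf// mul1r.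
    by apply: le_trans (ler_normB _ _) _; rewrite lerD2r coord_le1.
  by rewrite ler_norml tE => /andP[h1 h2]; apply/andP; split; lra.
pose E := [set z | dot z e = a].
have [mE aE] : approx_set E by exact: approx_set_coord_eq.
apply: (@approx_lim R (fun n => (cst 1 - t ^+ n) ^+ (2 ^ n) * (cst 1 - \1_E)) _ 1).
- move=> n; apply: approxM; last by apply: approxD; [exact: approx_cst|exact: approxN].
  by apply/approxX/approxD; [exact: approx_cst|exact/approxN/approxX].
- exact: bm_indic.
- move=> n z z1; have /andP[h0 h1] := t1 _ z1.
  have h2 : 0 <= t z ^+ n <= 1 by rewrite exprn_ge0//= exprn_ile1.
  rewrite -[X in `|X|]/(((cst 1 - t ^+ n) ^+ (2 ^ n)) z * (1 - \1_E z)) fctXE.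
  rewrite -[X in X ^+ _]/(1 - (t ^+ n) z) fctXE indicE normrM -[leRHS]mulr1.
  case/andP: h2 => h2 h3; apply: ler_pM => //.
    by rewrite normrX exprn_ile1// ger0_norm ?subr_ge0// gerBl.
  by case: (z \in E); rewrite ?subrr ?subr0 ?normr0 ?normr1.
move=> z z1.
have -> : (fun n => ((cst 1 - t ^+ n) ^+ (2 ^ n) * (cst 1 - \1_E)) z) =
    (fun n => (1 - t z ^+ n) ^+ (2 ^ n) * (1 - (z \in E)%:R)).
  apply/funext => n.
  have Q : (cst 1 - t ^+ n) z = 1 - t z ^+ n by rewrite -fctXE.
  by rewrite -[LHS]/(((cst 1 - t ^+ n) ^+ (2 ^ n)) z * (1 - \1_E z)) fctXE Q indicE.
have tA : (z \in A) = (t z < 2^-1).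
  rewrite tE; apply/idP/idP => [/set_mem /= h|h].
    by rewrite gtrDl pmulr_rlt0 ?invr_gt0// subr_lt0.
  by apply/mem_set => /=; move: h; rewrite gtrDl pmulr_rlt0 ?invr_gt0// subr_lt0.
rewrite indicE tA; have [/set_mem /= za|za] := boolP (z \in E).
  rewrite subrr; under eq_fun do rewrite mulr0.
  by rewrite tE za subrr mulr0 addr0 ltxx; exact: cvg_cst.
rewrite subr0; under eq_fun do rewrite mulr1.
apply: cvg_step; first exact: t1.
rewrite tE -subr_eq0 addrC addKr; apply: mulf_neq0; first by rewrite invr_neq0// gt_eqF.
by rewrite subr_eq0; apply: contra za => /eqP h; exact/mem_set.
Qed.

Lemma approx_setC A : approx_set A -> approx_set (~` A).
Proof.
move=> [mA aA]; split; first exact: measurableC.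
have -> : \1_(~` A) = cst 1 - \1_A :> (HH -> R).
  apply/funext => z; rewrite -[RHS]/(1 - \1_A z) !indicE in_setC.
  by case: (z \in A); rewrite ?subrr ?subr0.
by apply: approxD; [exact: approx_cst|exact: approxN].
Qed.

Lemma approx_setU A B : approx_set A -> approx_set B -> approx_set (A `|` B).
Proof.
move=> [mA aA] [mB aB]; split; first exact: measurableU.
have -> : \1_(A `|` B) = \1_A + \1_B - \1_A * \1_B :> (HH -> R).
  apply/funext => z; rewrite -[RHS]/(\1_A z + \1_B z - \1_A z * \1_B z) !indicE in_setU.
  by case: (z \in A); case: (z \in B) => /=; ring.
by apply: approxD; [exact: approxD|exact/approxN/approxM].
Qed.

Lemma approx_set0 : approx_set set0.
Proof. by split=> //; rewrite indic0; exact: approx_cst. Qed.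

Lemma approx_set_bigcup (A : (set HH)^nat) : (forall n, approx_set (A n)) ->
  approx_set (\bigcup_n A n).
Proof.
move=> aA; pose B n := \big[setU/set0]_(i < n) A i.
have aB n : approx_set (B n).
  rewrite /B; elim: n => [|n ih]; first by rewrite big_ord0; exact: approx_set0.
  by rewrite big_ord_recr/=; exact: approx_setU.
have mU : measurable (\bigcup_n A n) by apply: bigcup_measurable => n _; case: (aA n).
split=> //; apply: (@approx_lim R (fun n => \1_(B n)) _ 1).
- by move=> n; case: (aB n).
- exact: bm_indic.
- by move=> n z _; rewrite indicE; case: (_ \in _); rewrite ?normr1 ?normr0.
move=> z _; apply: cvg_near_cst.
have [[i _ Ai]|nA] := pselect ((\bigcup_n A n) z).
  exists i.+1 => // n /= ni; rewrite !indicE !mem_set//; first by exists i.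
  by rewrite /B -bigcup_mkord; exists i.
apply: nearW => n; rewrite !indicE !memNset//.
by rewrite /B -bigcup_mkord => -[i _ Ai]; apply: nA; exists i.
Qed.

Lemma approx_set_sigma_algebra : sigma_algebra setT approx_set.
Proof.
split; [exact: approx_set0| |exact: approx_set_bigcup].
by move=> A aA; rewrite setTD; exact: approx_setC.
Qed.

Local Notation S := (g_sigma_algebraType approx_set).

(** The coordinates are measurable for the sigma-algebra of approximable sets, since half-spaces
    belong to it. Hence so is the identity into R^8 with its product sigma-algebra. *)
Lemma approx_set_measurable A : measurable A -> approx_set A.
Proof.
have mS (B : set S) : measurable B -> approx_set B.
  by move=> mB; rewrite -(sigma_algebra_id approx_set_sigma_algebra).
have Sm (B : set HH) : approx_set B -> measurable (B : set S).
  exact: sub_sigma_algebra.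
have mc e : e \in basis -> measurable_fun setT ((fun z => dot z e) : S -> R).
  move=> be; apply: (measurability _ (RGenInftyO.measurableE R)).
  move=> _ [_ [a ->] <-]; rewrite setTI; apply: Sm.
  have eA : [set z : HH | dot z e < a] = (fun z => dot z e) @^-1` `]-oo, a[%classic.
    by apply/seteqP; split=> z /=; rewrite in_itv.
  by have := approx_set_coord_lt a be; rewrite eA.
have mid : measurable_fun setT (id : S -> HH).
  have bi i : (i < 8)%N -> nth 0 basis i \in basis by move=> i8; exact: mem_nth.
  have e1 : (q1, 0) \in basis := bi 0 isT.
  have e2 : (qi, 0) \in basis := bi 1 isT.
  have e3 : (qj, 0) \in basis := bi 2 isT.
  have e4 : (qk, 0) \in basis := bi 3 isT.
  have e5 : (0, q1) \in basis := bi 4 isT.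
  have e6 : (0, qi) \in basis := bi 5 isT.
  have e7 : (0, qj) \in basis := bi 6 isT.
  have e8 : (0, qk) \in basis := bi 7 isT.
  rewrite (_ : id = fun z : S => ((dot z (q1, 0), dot z (qi, 0), dot z (qj, 0), dot z (qk, 0)),
     (dot z (0, q1), dot z (0, qi), dot z (0, qj), dot z (0, qk)))); last first.
    apply/funext => -[[[[a b] c] d] [[[a' b'] c'] d']]; rewrite /dot /qdot /=.
    by congr ((_, _, _, _), (_, _, _, _)); ring.
  exact: (measurable_fun_pair
    (measurable_fun_pair (measurable_fun_pair (measurable_fun_pair (mc _ e1) (mc _ e2)) (mc _ e3)) (mc _ e4))
    (measurable_fun_pair (measurable_fun_pair (measurable_fun_pair (mc _ e5) (mc _ e6)) (mc _ e7)) (mc _ e8))).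
by move=> mA; apply: mS; have := mid measurableT _ mA; rewrite setTI.
Qed.

(** The sum counts the positive integers up to [y], so it is the integer part of [y]. *)
Lemma sum_lt_truncn n (y : R) : 0 <= y -> y <= n%:R ->
  `|y - \sum_(k < n) ((k.+1%:R <= y)%R)%:R| <= 1.
Proof.
move=> y0 yn.
have h m : (\sum_(k < m) ((k.+1%:R <= y)%R)%:R = (minn (Num.truncn y) m)%:R :> R).
  elim: m => [|m ih]; first by rewrite big_ord0 minn0.
  rewrite big_ord_recr/= ih -natrD; congr _%:R.
  by rewrite -truncn_gt_nat; case: (ltnP m (Num.truncn y)) => /=; lia.
have /andP[t1 t2] := truncn_itv y0.
rewrite h (minn_idPl _); last by rewrite -(ler_nat R) (le_trans t1).
by rewrite -natr1 in t2; rewrite ger0_norm ?subr_ge0//; lra.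
Qed.

(** A function with values between 0 and 1 is, on S^7, a uniform limit of averages of indicators of
    its superlevel sets; an affine change of values reduces the general case to this one. *)
Lemma bm_approx F : bm F -> approx F.
Proof.
have unit G : bm G -> (forall z, S7 z -> 0 <= G z <= 1) -> approx G.
  move=> bG hG; have [mG _] := bG.
  pose A n k := [set z | k.+1%:R <= n.+1%:R * G z].
  pose g n := cst (n.+1%:R^-1) * \sum_(k < n.+1) (\1_(A n k) : HH -> R).
  have gE n z : S7 z -> `|G z - g n z| <= n.+1%:R^-1.
    move=> z1; have /andP[G0 G1] := hG _ z1.
    have n0 : (0 : R) < n.+1%:R by rewrite ltr0n.
    have -> : G z - g n z = n.+1%:R^-1 * (n.+1%:R * G z - \sum_(k < n.+1) ((k.+1%:R <= n.+1%:R * G z)%R)%:R).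
      rewrite mulrBr mulKf ?gt_eqF//; congr (_ - _).
      rewrite -[LHS]/(n.+1%:R^-1 * (\sum_(k < n.+1) (\1_(A n k) : HH -> R)) z) fct_sumE.
      congr (_ * _); apply: eq_bigr => k _; rewrite indicE; congr (nat_of_bool _)%:R.
      by apply/idP/idP => [/set_mem//|h]; exact/mem_set.
    rewrite normrM gtr0_norm ?invr_gt0//; apply: ler_piMr; first by rewrite invr_ge0 ltW.
    apply: sum_lt_truncn; first by rewrite mulr_ge0// ltW.
    by rewrite ler_piMr// ltW.
  apply: (@approx_lim R g _ 2) => //.
  - move=> n; apply: approxM; first exact: approx_cst.
    apply: approx_sum => k; have [] // : approx_set (A n k).
    apply: approx_set_measurable.
    rewrite (_ : A n k = (fun z => n.+1%:R * G z) @^-1` `[k.+1%:R, +oo[%classic).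
      rewrite -[X in measurable X]setTI.
      exact: (measurable_funM (measurable_cst _) mG measurableT (measurable_itv _)).
    by apply/seteqP; split=> z /=; rewrite in_itv/= andbT.
  - move=> n z z1; have := gE n _ z1; have /andP[G0 G1] := hG _ z1.
    have n1 : n.+1%:R^-1 <= 1 :> R by rewrite invf_le1 ?ltr0n// ler1n.
    rewrite !ler_norml; move: (g n z) (G z) (n.+1%:R^-1) G0 G1 n1 => a b c *.
    by apply/andP; split; lra.
  - move=> z z1; apply/cvgrPdist_le => eps e0.
    have := @cvg_harmonic R => /cvgrPdist_le /(_ _ e0); apply: filterS => n.
    rewrite sub0r normrN /= ger0_norm ?invr_ge0// => h.
    exact: le_trans (gE n _ z1) h.
move=> bF; have [mF [M0 hM0]] := bF.
pose M := `|M0| + 1; have Mp : 0 < M by rewrite ltr_wpDl.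
have hM z : S7 z -> `|F z| <= M.
  by move=> z1; apply: le_trans (hM0 _ z1) _; have := ler_norm M0; rewrite /M; lra.
pose G := cst (2 * M)^-1 * (F + cst M).
have -> : F = cst (2 * M) * G + cst (- M).
  apply/funext => z; rewrite /G !fctE; field.
  by rewrite gt_eqF.
apply: approxD; [apply: approxM|]; try exact: approx_cst.
apply: unit; first by apply: bmM; [exact: bm_cst|apply: bmD => //; exact: bm_cst].
move=> z z1; have := hM _ z1; rewrite ler_norml => /andP[h1 h2].
rewrite -[G z]/((2 * M)^-1 * (F z + M)) mulr_ge0 ?invr_ge0//=; [|lra|lra].
by rewrite mulrC ler_pdivrMr; lra.
Qed.

End Indicators.

(** * The L^2 norm *)

Section L2norm.
Context {R : realType}.
Local Notation HH := (H2 R).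
Local Notation sigma := (@sphere_measure R).
Implicit Types (f g F G q : HH -> R) (u v w z e : HH) (A : set HH).

Import HBNNSimple.

(* Measurability of [g] is not needed because [S7] has full measure. *)
Lemma integral_S7 (g : HH -> \bar R) : (forall z, 0 <= g z)%E ->
  (\int[sigma]_z g z = \int[sigma]_(z in S7) g z)%E.
Proof.
move=> g0; rewrite ge0_integralTE// ge0_integralE//.
have mS := measurable_S7 (R := R).
apply/eqP; rewrite eq_le; apply/andP; split; apply: ub_ereal_sup => _ [h hg <-]; last first.
  apply: ereal_sup_ubound; exists h => // z; apply: le_trans (hg z) _.
  by rewrite /patch; case: ifP.
apply: ereal_sup_ubound; exists (proj_nnsfun h mS).
  move=> z /=; rewrite -[X in X%:E]/((proj_nnsfun h mS : HH -> R) z) -mrestrict /patch.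
  by case: ifP => // _; exact: hg.
have mh : measurable_fun setT (EFin \o h) by apply/measurable_EFinP.
have h0 z : setT z -> (0 <= (EFin \o h) z)%E by move=> _; rewrite lee_fin; exact: fun_ge0.
have hS := ge0_negligible_integral (measurableC mS) measurableT mh h0 sphere_measure_compl.
rewrite setTD setCK in hS.
have hT : (\int[sigma]_z (h z)%:E = sintegral sigma h)%E.
  by apply: etrans (integral_nnsfun sigma measurableT h) _; rewrite patch_setT.
rewrite -mrestrict; apply: etrans hT; apply: esym; apply: etrans hS _.
exact: integral_nnsfun.
Qed.

Definition sqint f : \bar R := (\int[sigma]_(z in S7) (f z ^+ 2)%:E)%E.

Lemma sqint_ge0 f : (0 <= sqint f)%E.
Proof. by apply: integral_ge0 => z _; rewrite lee_fin sqr_ge0. Qed.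

Lemma norm2E f : norm2 f = (sqint f `^ 2^-1)%E.
Proof.
rewrite /norm2 Lnorm.unlock/= integral_S7; last by move=> z; rewrite lee_fin powR_ge0.
by congr (_ `^ _)%E; apply: eq_integral => z _; rewrite /= powR_mulrn// real_normK// num_real.
Qed.

Lemma norm2_ge0 f : (0 <= norm2 f)%E.
Proof. exact: Lnorm_ge0. Qed.

Lemma norm2_eq f g : (forall z, S7 z -> f z = g z) -> norm2 f = norm2 g.
Proof.
move=> fg; rewrite !norm2E; congr (_ `^ _)%E; apply: eq_integral => z.
by rewrite inE => z1; rewrite fg.
Qed.

Lemma sqint_bm F : bm F -> sqint F = (sint (F * F))%:E.
Proof. by move=> bF; rewrite -integral_sint//; exact: bmM. Qed.

Lemma norm2_bm F : bm F -> norm2 F = (Num.sqrt (sint (F * F)))%:E.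
Proof.
by move=> bF; rewrite norm2E sqint_bm// poweR_EFin powR12_sqrt ?sint_sqr_ge0.
Qed.

Lemma norm2_lt f (eps : R) : 0 < eps -> (sqint f < (eps ^+ 2)%:E)%E -> (norm2 f < eps%:E)%E.
Proof.
move=> e0; rewrite norm2E; have := sqint_ge0 f.
case: (sqint f) => // x; rewrite lee_fin lte_fin => x0 h.
rewrite poweR_EFin powR12_sqrt// lte_fin.
by rewrite -(ger0_norm (ltW e0)) -sqrtr_sqr ltr_sqrt// exprn_gt0.
Qed.

Lemma norm2D f g : measurable_fun setT f -> measurable_fun setT g ->
  (norm2 (f + g)%R <= norm2 f + norm2 g)%E.
Proof. by move=> mf mg; apply: minkowski_EFin => //; rewrite ler1n. Qed.

Lemma norm2N f : norm2 (- f) = norm2 f.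
Proof. by rewrite !norm2E; congr (_ `^ _)%E; apply: eq_integral => z _; rewrite !fctE sqrrN. Qed.

Lemma norm2Z c f : measurable_fun setT f -> norm2 (cst c * f) = (`|c|%:E * norm2 f)%E.
Proof.
move=> mf; rewrite !norm2E.
have -> : sqint (cst c * f) = ((c ^+ 2)%:E * sqint f)%E.
  have mf2 : measurable_fun S7 (fun z => (f z ^+ 2)%:E).
    by apply: measurable_funTS; apply/measurable_EFinP; exact: measurable_funX.
  rewrite -(ge0_integralZl _ (measurable_S7 (R := R)) mf2) ?lee_fin ?sqr_ge0//; last first.
    by move=> z _; rewrite lee_fin sqr_ge0.
  by apply: eq_integral => z _; rewrite !fctE exprMn.
rewrite poweRM ?lee_fin ?sqr_ge0 ?sqint_ge0//; congr (_ * _)%E.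
by rewrite poweR_EFin powR12_sqrt ?sqr_ge0// sqrtr_sqr.
Qed.

Lemma L2P f : L2 f <-> measurable_fun setT f /\ (norm2 f < +oo)%E.
Proof.
rewrite /L2 /= inE; split=> [/andP[]|[mf nf]]; first by rewrite !inE.
by apply/andP; rewrite !inE.
Qed.

Lemma L2_bm F : bm F -> L2 F.
Proof. by move=> bF; apply/L2P; split; [case: bF|rewrite norm2_bm// ltry]. Qed.

Lemma L2D f g : L2 f -> L2 g -> L2 (f + g).
Proof.
move=> /L2P[mf nf] /L2P[mg ng]; apply/L2P; split; first exact: measurable_funD.
by apply: le_lt_trans (norm2D mf mg) _; rewrite lte_add_pinfty.
Qed.

Lemma L2Z c f : L2 f -> L2 (cst c * f).
Proof.
move=> /L2P[mf nf]; apply/L2P; split; first exact: measurable_funM.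
by rewrite norm2Z// lte_mul_pinfty// ge0_fin_numE.
Qed.

Lemma sqint_fin f : L2 f -> (sqint f < +oo)%E.
Proof.
by move=> /L2P[_]; rewrite norm2E => h; apply: (@lty_poweRy _ _ 2^-1).
Qed.

End L2norm.

(** * Completeness of L^2 *)

Section Completeness.
Context {R : realType}.
Local Notation HH := (H2 R).
Local Notation sigma := (@sphere_measure R).
Implicit Types (f g F G q : HH -> R) (u v w z e : HH) (A : set HH).

(** The real-valued form of [norm2], with which it agrees on [bm]; it keeps estimates out of the
    extended reals. *)
Definition nrm F : R := Num.sqrt (sint (F * F)).

Lemma nrm_ge0 F : 0 <= nrm F.
Proof. exact: sqrtr_ge0. Qed.

Lemma nrm_sqr F : nrm F ^+ 2 = sint (F * F).
Proof. by rewrite sqr_sqrtr// sint_sqr_ge0. Qed.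

Lemma norm2_nrm F : bm F -> norm2 F = (nrm F)%:E.
Proof. exact: norm2_bm. Qed.

Lemma nrmD F G : bm F -> bm G -> nrm (F + G) <= nrm F + nrm G.
Proof.
move=> bF bG; have := norm2D bF.1 bG.1.
by rewrite !norm2_nrm ?lee_fin//; exact: bmD.
Qed.

Lemma nrmN F : nrm (- F) = nrm F.
Proof. by rewrite /nrm mulrNN. Qed.

Lemma nrm_le F (c : R) : 0 <= c -> (nrm F <= c) = (sint (F * F) <= c ^+ 2).
Proof. by move=> c0; rewrite -nrm_sqr ler_pXn2r// nnegrE nrm_ge0. Qed.

Lemma nrm_lt F (c : R) : 0 < c -> (nrm F < c) = (sint (F * F) < c ^+ 2).
Proof. by move=> c0; rewrite -nrm_sqr ltr_pXn2r// nnegrE ?nrm_ge0 ?ltW. Qed.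

Lemma nrm_eq F G : (forall z, S7 z -> F z = G z) -> nrm F = nrm G.
Proof.
by move=> e; congr Num.sqrt; apply: sint_eq => z z1; rewrite -[LHS]/(F z * F z) e.
Qed.

Lemma cauchy_schwarz F G : bm F -> bm G -> sint (F * G) <= nrm F * nrm G.
Proof.
move=> bF bG; set a := nrm F; set b := nrm G.
have a0 : 0 <= a by exact: nrm_ge0.
have b0 : 0 <= b by exact: nrm_ge0.
have bFF := bmM bF bF; have bGG := bmM bG bG; have bFG := bmM bF bG.
have key s t : 0 <= s ^+ 2 * a ^+ 2 - 2 * (s * t) * sint (F * G) + t ^+ 2 * b ^+ 2.
  rewrite !nrm_sqr; apply: le_trans (sint_sqr_ge0 (cst s * F - cst t * G)) _.
  have -> : (cst s * F - cst t * G) * (cst s * F - cst t * G) =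
      cst (s ^+ 2) * (F * F) + (cst (- (2 * (s * t))) * (F * G) + cst (t ^+ 2) * (G * G)).
    by apply/funext => z; rewrite !fctE; ring.
  rewrite !sintD ?sintZ//; try by do ?[exact: bm_cst|apply: bmM|apply: bmD|by []].
  by rewrite mulNr addrA.
have [a00|an0] := eqVneq a 0.
  rewrite a00 mul0r leNgt; apply/negP => p0.
  (* With the square term in [s] gone, this value makes the form equal to - b^2 - 2, which is
     negative. *)
  have := key ((b ^+ 2 + 1) / sint (F * G)) 1.
  rewrite a00 expr0n mulr0 mulr1 expr1n mul1r -mulrA divfK ?gt_eqF//.
  have := sqr_ge0 b; lra.
have [b00|bn0] := eqVneq b 0.
  rewrite b00 mulr0 leNgt; apply/negP => p0.
  have := key 1 ((a ^+ 2 + 1) / sint (F * G)).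
  rewrite b00 expr0n mulr0 mul1r expr1n mul1r -mulrA divfK ?gt_eqF//.
  have := sqr_ge0 a; lra.
have ab : 0 < a * b by rewrite mulr_gt0// lt_neqAle eq_sym ?an0 ?bn0.
have := key b a.
have -> : b ^+ 2 * a ^+ 2 - 2 * (b * a) * sint (F * G) + a ^+ 2 * b ^+ 2 =
  2 * (a * b) * (a * b - sint (F * G)) by ring.
by rewrite pmulr_rge0 ?subr_ge0//; apply: mulr_gt0.
Qed.

(** Replace [f] by 0 where its absolute value exceeds n; the squared error is dominated by the
    square of [f]. *)
Lemma L2_truncate f (eps : R) : 0 < eps -> L2 f ->
  exists F, bm F /\ (norm2 (F - f)%R < eps%:E)%E.
Proof.
move=> e0 lf; have [mf _] := (L2P f).1 lf.
have mS := measurable_S7 (R := R).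
pose A n : set HH := f @^-1` `[- n%:R, n%:R]%classic.
have mA n : measurable (A n) by rewrite /A -[X in measurable X]setTI; exact: mf.
pose F n := f * (\1_(A n) : HH -> R).
have FE n z : F n z - f z = if z \in A n then 0 else - f z.
  rewrite -[F n z]/(f z * \1_(A n) z) indicE; case: (z \in A n).
    by rewrite mulr1 subrr.
  by rewrite mulr0 sub0r.
have mF n : measurable_fun setT (F n) by apply: measurable_funM => //; exact: measurable_indic.
have bF n : bm (F n).
  split=> //; exists n%:R => z _; rewrite -[F n z]/(f z * \1_(A n) z) indicE.
  have [/set_mem|_] := boolP (z \in A n); last by rewrite mulr0 normr0.
  by rewrite /A /= in_itv/= mulr1 ler_norml.
pose h n := fun z => ((F n z - f z) ^+ 2)%:E.
have [] := @dominated_convergence _ _ R sigma S7 mS h (cst 0%E) (fun z => (f z ^+ 2)%:E).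
- move=> n; apply: measurable_funTS; apply/measurable_EFinP; apply: measurable_funX.
  exact: measurable_funB.
- exact: measurable_cst.
- apply: aeW => z _; apply: cvg_near_cst.
  exists (Num.truncn `|f z|).+1 => // n /= hn; rewrite /h FE mem_set ?expr0n//.
  rewrite /A /= in_itv/= -ler_norml.
  by apply: le_trans (ltW (truncnS_gt _)) _; rewrite ler_nat.
- apply/integrableP; split.
    by apply: measurable_funTS; apply/measurable_EFinP; exact: measurable_funX.
  rewrite (eq_integral (fun z => (f z ^+ 2)%:E)); first exact: sqint_fin.
  by move=> z _ /=; rewrite ger0_norm// sqr_ge0.
- apply: aeW => z n _ /=; rewrite lee_fin ger0_norm ?sqr_ge0// FE.
  by case: (z \in A n); rewrite ?sqrrN// expr0n sqr_ge0.
move=> _ _; rewrite integral0 => lim0.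
have e2 : ((0 : \bar R) < (eps ^+ 2)%:E)%E by rewrite lte_fin exprn_gt0.
have [n _ /(_ n (leqnn n)) hn] := lim0 _ (open_ereal_lt' e2).
exists (F n); split=> //; exact: norm2_lt.
Qed.

Lemma L2_dense f (eps : R) : 0 < eps -> L2 f ->
  exists q, spoly q /\ (norm2 (q - f)%R < eps%:E)%E.
Proof.
move=> e0 lf; have e2 : 0 < eps / 2 by rewrite divr_gt0.
have [mf _] := (L2P f).1 lf.
have [F [bF hF]] := L2_truncate e2 lf; have [mF _] := bF.
have [_ /(_ ((eps / 2) ^+ 2))[|q [pq hq]]] := bm_approx bF; first by rewrite exprn_gt0.
exists q; split=> //; have bq := bm_spoly pq.
have -> : q - f = (- (F - q)) + (F - f) by ring.
have bFq := bmB bF bq.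
apply: le_lt_trans (norm2D (bmN bFq).1 (measurable_funB mF mf)) _.
rewrite norm2N (norm2_nrm bFq) [X in (_ < X%:E)%E](splitr eps) EFinD.
by apply: lteD => //; rewrite lte_fin nrm_lt.
Qed.

End Completeness.

Section Complete.
Context {R : realType}.
Local Notation HH := (H2 R).
Local Notation sigma := (@sphere_measure R).
Implicit Types (f g F G q : HH -> R) (u v w z e : HH) (A : set HH).

(** The bound is the exact partial sum of the geometric series; the subtracted term is what lets the
    induction close. *)
Lemma nrm_telescope (F : nat -> HH -> R) n k : (forall n, bm (F n)) ->
  (forall n, nrm (F n.+1 - F n) <= 2^-1 ^+ n) ->
  nrm (F (n + k)%N - F n) <= 2 * 2^-1 ^+ n - 2 * 2^-1 ^+ (n + k).
Proof.
move=> bF hF; elim: k => [|k ih].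
  rewrite addn0 !subrr (_ : nrm 0 = 0)//; apply/eqP.
  by rewrite eq_le nrm_ge0 andbT nrm_le// mul0r sint0 expr0n.
rewrite addnS; have -> : F (n + k).+1 - F n = (F (n + k).+1 - F (n + k)%N) + (F (n + k)%N - F n) by ring.
apply: le_trans (nrmD (bmB (bF _) (bF _)) (bmB (bF _) (bF _))) _.
apply: le_trans (lerD (hF _) ih) _.
rewrite [2^-1 ^+ (n + k).+1]exprS; lra.
Qed.

(* By Cauchy-Schwarz the increments are summable in L^1, so that their sum is
   finite almost everywhere. *)
Lemma ae_cvg (F : nat -> HH -> R) : (forall n, bm (F n)) ->
  (forall n, nrm (F n.+1 - F n) <= 2^-1 ^+ n) ->
  exists E : set HH, [/\ measurable E, sigma (S7 `\` E) = 0%E &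
    forall z, E z -> cvgn (fun n => F n z)].
Proof.
move=> bF hF; have mS := measurable_S7 (R := R).
pose d n : HH -> R := fun z => `|F n.+1 z - F n z|.
have bd n : bm (d n).
  have [md [M hM]] := bmB (bF n.+1) (bF n).
  split; first exact: measurableT_comp md.
  by exists M => z z1; rewrite /d normr_id; exact: hM.
have dd n : nrm (d n) = nrm (F n.+1 - F n).
  congr Num.sqrt; apply: sint_eq => z _.
  by rewrite -[LHS]/(d n z * d n z) -expr2 real_normK ?num_real.
have b1 : bm (1 : HH -> R) by exact: (bm_cst 1).
have id n : sint (d n) <= nrm (1 : HH -> R) * 2^-1 ^+ n.
  rewrite -[d n]mul1r; apply: le_trans (cauchy_schwarz b1 (bd n)) _.
  by rewrite dd; apply: ler_wpM2l (hF n); exact: nrm_ge0.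
pose S z : \bar R := (\sum_(n <oo) (d n z)%:E)%E.
have d0 n z : setT z -> (0 <= (d n z)%:E)%E by move=> _; rewrite lee_fin normr_ge0.
have md n : measurable_fun setT (fun z => (d n z)%:E) by apply/measurable_EFinP; case: (bd n).
have mSum : measurable_fun setT S.
  by apply: (ge0_emeasurable_sum (P := xpredT)) => // n z _ _; exact: d0.
have K0 : 0 <= nrm (1 : HH -> R) by exact: nrm_ge0.
have iS : (\int[sigma]_(z in S7) S z < +oo)%E.
  have mdS n : measurable_fun S7 (fun z => (d n z)%:E) by exact: measurable_funTS (md n).
  have d0S n z : S7 z -> (0 <= (d n z)%:E)%E by move=> _; exact: d0.
  rewrite (integral_nneseries _ mS mdS d0S).
  apply: (@le_lt_trans _ _ (nrm (1 : HH -> R) * 2)%:E); last exact: ltry.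
  apply: lime_le.
    by apply: is_cvg_nneseries => n _ _; apply: integral_ge0 => z _; exact: d0.
  apply: nearW => n; under eq_bigr do rewrite (integral_sint (bd _)).
  rewrite sumEFin lee_fin.
  apply: (@le_trans _ _ (nrm (1 : HH -> R) * (2 - 2 * 2^-1 ^+ n))).
    elim: n => [|n ih]; first by rewrite big_geq// expr0; lra.
    rewrite big_nat_recr//=; apply: le_trans (lerD ih (id n)) _.
    by rewrite exprS; lra.
  by apply: ler_wpM2l => //; rewrite gerBl mulr_ge0// exprn_ge0.
have S0 z : (0 <= S z)%E by apply: nneseries_ge0 => n _ _; exact: d0.
pose E := [set z | (S z < +oo)%E].
have mE : measurable E.
  by have := emeasurable_fun_infty_o measurableT mSum +oo%E; rewrite setTI.
exists E; split=> //.
  have inS : sigma.-integrable S7 S.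
    apply/integrableP; split; first exact: measurable_funTS.
    by under eq_integral do rewrite gee0_abs//.
  have [N [mN N0 hN]] : {ae sigma, forall z, S7 z -> S z \is a fin_num}.
    exact: integrable_ae.
  apply: (subset_measure0 (B := N)) => //; first exact: measurableD.
  move=> z [z1 nE]; apply: hN => /= h; apply: nE.
  by rewrite /E /=; move: (h z1); rewrite ge0_fin_numE.
move=> z Ez; pose u n := F n.+1 z - F n z.
have nsE n : [normed series u] n = \sum_(0 <= k < n) `|u k| by [].
have cu : cvgn [normed series u].
  apply: nondecreasing_is_cvgn.
    by apply/nondecreasing_seqP => n; rewrite !nsE big_nat_recr//= lerDl.
  exists (fine (S z)) => _ [n _ <-]; rewrite nsE -lee_fin fineK; last by rewrite ge0_fin_numE.
  rewrite -sumEFin; apply: (nneseries_lim_ge (P := xpredT)) => k _ _.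
  exact: d0.
have -> : (fun n => F n z) = (fun n => F 0%N z + series u n).
  by apply/funext => n; exact: (eq_sum_telescope (fun n => F n z)).
by apply: is_cvgD; [exact: is_cvg_cst|exact: normed_cvg].
Qed.

(** Fatou's lemma applied to the squares of [F n - F m] as m grows; the rate is the tail of the
    geometric series. *)
Lemma L2_complete (F : nat -> HH -> R) : (forall n, bm (F n)) ->
  (forall n, nrm (F n.+1 - F n) <= 2^-1 ^+ n) ->
  exists f, L2 f /\ forall n, (norm2 (F n - f)%R <= (2 * 2^-1 ^+ n)%:E)%E.
Proof.
move=> bF hF; have mS := measurable_S7 (R := R).
have [E [mE E0 cE]] := ae_cvg bF hF.
(* With the value 0 off the convergence set, [f] is the pointwise limit of [F n * \1_E] and hence
   measurable. *)
pose f z := if z \in E then limn (fun n => F n z) else 0.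
have limf z : E z -> F n z @[n --> \oo] --> f z.
  by move=> Ez; rewrite /f mem_set//; exact: cE.
have mf : measurable_fun setT f.
  apply: (@measurable_fun_cvg _ _ _ setT (fun n => F n * (\1_E : HH -> R))).
    by move=> n; apply: measurable_funM; [case: (bF n)|exact: measurable_indic].
  move=> z _; have [Ez|Ez] := pselect (E z).
    apply: cvg_trans (limf z Ez); apply: near_eq_cvg; apply: nearW => n.
    by rewrite -[RHS]/(F n z * \1_E z) indicE mem_set// mulr1.
  rewrite /f memNset//; apply: cvg_near_cst; apply: nearW => n.
  by rewrite -[LHS]/(F n z * \1_E z) indicE memNset// mulr0.
have mFf n : measurable_fun setT (F n - f) by apply: measurable_funB => //; case: (bF n).
have mSE : measurable (S7 `&` E) by exact: measurableI.
have bound n : (norm2 (F n - f)%R <= (2 * 2^-1 ^+ n)%:E)%E.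
  pose c : R := 2 * 2^-1 ^+ n; have c0 : 0 <= c by rewrite mulr_ge0// exprn_ge0.
  suff h : (sqint (F n - f)%R <= (c ^+ 2)%:E)%E.
    rewrite norm2E; move: (sqint _) (sqint_ge0 (F n - f)) h => [x|//|//].
    rewrite !lee_fin => x0 xc; rewrite powR12_sqrt//.
    by rewrite -[leRHS]/c -(ger0_norm c0) -sqrtr_sqr ler_wsqrtr.
  have mg (g : HH -> R) : measurable_fun setT g -> measurable_fun S7 (fun z => (g z ^+ 2)%:E).
    by move=> mg; apply: measurable_funTS; apply/measurable_EFinP; exact: measurable_funX.
  have g0 (g : HH -> R) z : S7 z -> (0 <= (g z ^+ 2)%:E)%E by rewrite lee_fin sqr_ge0.
  have -> : sqint (F n - f) = (\int[sigma]_(z in S7 `&` E) (((F n - f) z) ^+ 2)%:E)%E.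
    have -> : S7 `&` E = S7 `\` (S7 `\` E) by rewrite setDD.
    by apply: (ge0_negligible_integral _ mS (mg _ (mFf n)) (g0 _) E0); exact: measurableD.
  pose h m z := (((F n - F m) z) ^+ 2)%:E.
  have mh m : measurable_fun S7 (h m).
    by apply: mg; apply: measurable_funB; [case: (bF n)|case: (bF m)].
  have -> : (\int[sigma]_(z in S7 `&` E) (((F n - f) z) ^+ 2)%:E =
      \int[sigma]_(z in S7 `&` E) limn_einf (h^~ z))%E.
    apply: eq_integral => z; rewrite inE => -[_ Ez]; apply/esym.
    have cz : h^~ z @ \oo --> (((F n - f) z) ^+ 2)%:E.
      apply: cvg_EFin; first exact: nearW.
      have e : (fun m => F n z - F m z) @ \oo --> F n z - f z.
        by apply: cvgB; [exact: cvg_cst|exact: limf].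
      exact: (cvgM e e).
    by have [-> _] := cvg_limn_einf_sup cz.
  apply: le_trans (fatou _ mSE _ _) _.
  - by move=> m; apply: measurable_funS (mh m).
  - by move=> m z [z1 _]; exact: g0.
  rewrite limn_einf_lim; apply: lime_le; first exact: is_cvg_einfs.
  (* The infimum over the indices from m on is estimated by a single term whose index is also at
     least n, where [nrm_telescope] applies. *)
  apply: nearW => m; apply: ge_ereal_inf; exists (\int[sigma]_(z in S7 `&` E) h (maxn n m) z)%E.
    by exists (maxn n m) => //=; exact: leq_maxr.
  have hsub : S7 `&` E `<=` S7 by move=> z [].
  have sub := @ge0_subset_integral _ _ R sigma _ _ mSE mS _ (mh (maxn n m)) (g0 (F n - F (maxn n m))) hsub.
  apply: le_trans sub _.
  have -> : (\int[sigma]_(z in S7) h (maxn n m) z)%E = (sint ((F n - F (maxn n m)) * (F n - F (maxn n m))))%:E.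
    by rewrite -sqint_bm//; exact: bmB.
  rewrite lee_fin -nrm_le// -opprB nrmN -(subnKC (leq_maxl n m)).
  apply: le_trans (nrm_telescope _ _ bF hF) _.
  by rewrite gerBl mulr_ge0// exprn_ge0.
exists f; split=> //; apply/L2P; split=> //.
have -> : f = - (F 0%N - f) + F 0%N by ring.
apply: le_lt_trans (norm2D (measurable_funN (mFf 0%N)) (bF 0%N).1) _.
by rewrite norm2N (norm2_nrm (bF 0%N)) lte_add_pinfty ?ltry// (le_lt_trans (bound 0%N))// ltry.
Qed.

End Complete.

(** * The spectra *)

Section Spectra.
Context {R : realType}.
Local Notation HH := (H2 R).
Local Notation sigma := (@sphere_measure R).
Implicit Types (f g h F G q : HH -> R) (u v w z e : HH) (l d : R).

Lemma subT_sym F G : smooth F -> smooth G ->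
  sint (subT_poly F * G) = sint (F * subT_poly G).
Proof.
have [k1 k2 k3 k4] := @skew_A R.
suff h F' G' : smooth F' -> smooth G' -> sint (subT_poly F' * G') =
    sint (vf (@A1 R) F' * vf (@A1 R) G') + sint (vf (@A2 R) F' * vf (@A2 R) G')
    + sint (vf (@A3 R) F' * vf (@A3 R) G') + sint (vf (@A4 R) F' * vf (@A4 R) G').
  move=> sF sG; rewrite h// [F * _]mulrC h//.
  by congr (_ + _ + _ + _); congr sint; rewrite mulrC.
move=> sF sG; rewrite /subT_poly sintNM//; [|smooth_tac].
rewrite !sintDM//; [|smooth_tac..].
by rewrite !sint_by_parts//; ring.
Qed.

(** Duality: for a polynomial [q] near [F], solve (Delta_Q - l) r = q with d |r| at most |q|. By
    symmetry the pairing of [F] with [q] is that of [G] with [r], so Cauchy-Schwarz bounds it by |G|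
    |q| / d. *)
Lemma apriori l d F : 0 < d -> (forall nu, hopf_eigenvalue nu -> d <= `|nu - l|) ->
  smooth F -> d * nrm F <= nrm (subQ_poly F - cst l * F).
Proof.
move=> d0 dE sF; set G := subQ_poly F - cst l * F; set x := nrm F; set g := nrm G.
have sG : smooth G by rewrite /G; smooth_tac.
have bF := smooth_bm sF; have bG := smooth_bm sG.
have x0 : 0 <= x by exact: nrm_ge0.
have g0 : 0 <= g by exact: nrm_ge0.
rewrite leNgt; apply/negP => gdx.
have key s : 0 < s -> d * x ^+ 2 <= g * (x + s) + d * (x * s).
  move=> s0; have [_ /(_ (s ^+ 2))[|q [pq hq]]] := bm_approx bF; first by rewrite exprn_gt0.
  have bq := bm_spoly pq; have bFq := bmB bF bq.
  have {}hq : nrm (F - q) < s by rewrite nrm_lt.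
  have [r [sr rE rq]] := poly_resolvent d0 dE (killed_spoly pq).
  have br := smooth_bm sr.
  have drq : d * nrm r <= nrm q.
    rewrite -(ler_pXn2r (n := 2)) ?nnegrE ?nrm_ge0 ?mulr_ge0 ?nrm_ge0 ?(ltW d0)//.
    by rewrite exprMn !nrm_sqr.
  have qx : nrm q <= x + s.
    have -> : q = F + - (F - q) by ring.
    apply: le_trans (nrmD bF (bmN bFq)) _; rewrite nrmN; exact: lerD (ltW hq).
  have Fq : sint (F * q) = sint (G * r).
    have -> : sint (F * q) = sint (F * subQ_poly r + - (cst l * F * r)).
      by apply: sint_eq => z z1; rewrite !fctE rE//; ring.
    rewrite sintD; [|apply: smooth_bm; smooth_tac..].
    rewrite -subQ_sym// -sintD; [|apply: smooth_bm; smooth_tac..].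
    by congr sint; rewrite /G; ring.
  have dFq : d * sint (F * q) <= g * (x + s).
    rewrite Fq; apply: (@le_trans _ _ (d * (g * nrm r))).
      by apply: ler_wpM2l (cauchy_schwarz bG br); exact: ltW.
    by rewrite mulrCA; apply: ler_wpM2l => //; exact: le_trans drq qx.
  have xE : x ^+ 2 = sint (F * q) + sint (F * (F - q)).
    by rewrite nrm_sqr -sintD; [congr sint; ring|exact: bmM..].
  rewrite xE mulrDr; apply: lerD => //; apply: ler_wpM2l; first exact: ltW.
  apply: le_trans (cauchy_schwarz bF bFq) _; apply: ler_wpM2l => //; exact: ltW.
have xp : 0 < x by rewrite -(pmulr_rgt0 _ d0) (le_lt_trans g0).
have K0 : 0 < 2 * (g + d * x) by rewrite mulr_gt0// ltr_wpDl// mulr_gt0.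
have D0 : 0 < x * (d * x - g) by rewrite mulr_gt0// subr_gt0.
(* Rearranged, [key] says that x (d x - g) is at most s (g + d x); this [s] makes the right side
   half of the positive left side. *)
have := key _ (divr_gt0 D0 K0); set s := _ / _.
have : s * (2 * (g + d * x)) = x * (d * x - g) by rewrite divfK// gt_eqF.
nra.
Qed.

(** With h = 0 the resolvent bound would force the norm of [F] to be 0, hence [F] to vanish on S^7
    and at [np] in particular. *)
Lemma eigenfunction_spectrum (D : (HH -> R) -> HH -> R) l F : smooth F ->
  (forall z, S7 z -> D F z = l * F z) -> F np != 0 -> spectrum D l.
Proof.
move=> sF eF Fnp [_ [C hC]]; have bF := smooth_bm sF.
have lF := L2_bm bF.
have l0 : L2 (0 : HH -> R) by exact: L2_bm (bm_cst 0).
have n0 : norm2 (0 : HH -> R) = 0%E.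
  have b0 : bm (0 : HH -> R) by exact: (bm_cst 0).
  by rewrite norm2_bm// mul0r sint0 sqrtr0.
have := hC F 0 l0; rewrite n0 mule0 => /(_ _)/wrap[].
  split=> //; first by have := L2D (L2Z l lF) l0.
  move=> eps e0; exists F; split=> //.
    by rewrite (norm2_eq (g := 0)) ?n0 ?lte_fin// => z _; rewrite subrr.
  rewrite (norm2_eq (g := 0)) ?n0 ?lte_fin// => z z1.
  by rewrite eF// -[(0 : HH -> R) z]/(0 : R); ring.
rewrite norm2_bm// lee_fin => h; have := sint_sqr_ge0 F => h'.
have s0 : sint (F * F) <= 0 by rewrite -sqrtr_eq0 eq_le h sqrtr_ge0.
by move: Fnp; rewrite (sint_sqr_eq0 sF s0 dot_np) eqxx.
Qed.

Lemma op_closure_bound l d f h : 0 < d ->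
  (forall nu, hopf_eigenvalue nu -> d <= `|nu - l|) -> L2 h ->
  op_closure subQ f (fun z => l * f z + h z) -> (norm2 f <= d^-1%:E * norm2 h)%E.
Proof.
move=> d0 dE /[dup] lh /L2P[mh nh] [/[dup] lf /L2P[mf nf] _ cl].
have fa : norm2 f = (fine (norm2 f))%:E by rewrite fineK// ge0_fin_numE// norm2_ge0.
have hb : norm2 h = (fine (norm2 h))%:E by rewrite fineK// ge0_fin_numE// norm2_ge0.
move: fa hb; set a := fine (norm2 f); set b := fine (norm2 h) => fa hb.
rewrite fa hb -EFinM lee_fin; apply/ler_addgt0Pr => e e0.
(* The error e / K enters once through f - F and, multiplied by 1 / d, a further 1 + |l| times
   through the estimate of [G]; these add up to e. *)
pose K := 1 + d^-1 * (1 + `|l|).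
have dv : 0 < d^-1 by rewrite invr_gt0.
have K0 : 0 < K by rewrite ltr_pwDl// mulr_ge0 ?(ltW dv)// addr_ge0.
have [F [sF F1 F2]] := cl _ (divr_gt0 e0 K0).
have bF := smooth_bm sF; have [mF _] := bF.
pose G := subQ_poly F - cst l * F.
have sG : smooth G by rewrite /G; smooth_tac.
have [mG _] := smooth_bm sG.
have {}F2 : (norm2 (G - (cst l * (f - F) + h))%R < (e / K)%:E)%E.
  rewrite (norm2_eq (g := fun z => subQ F z - (l * f z + h z)))// => z z1.
  by rewrite subQE// /G !fctE; ring.
have mfF : measurable_fun setT (f - F) by exact: measurable_funB.
have n1 : (norm2 (f - F)%R < (e / K)%:E)%E.
  by rewrite -norm2N opprB.
have n2 : ((nrm G)%:E <= (e / K)%:E + (`|l|%:E * (e / K)%:E + b%:E))%E.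
  rewrite -norm2_nrm; last exact: smooth_bm.
  have mlf : measurable_fun setT (cst l * (f - F)) by exact: measurable_funM.
  have mS : measurable_fun setT (cst l * (f - F) + h) by exact: measurable_funD.
  rewrite -[X in norm2 X](subrK (cst l * (f - F) + h) G).
  apply: le_trans (norm2D (measurable_funB mG mS) mS) _; apply: leeD; first exact: ltW.
  apply: le_trans (norm2D mlf mh) _; rewrite norm2Z// hb; apply: leeD => //.
  by apply: lee_wpmul2l; [rewrite lee_fin|exact: ltW].
have n3 : (a%:E <= (e / K)%:E + (nrm F)%:E)%E.
  rewrite -fa -[X in norm2 X](subrK F f); apply: le_trans (norm2D mfF mF) _.
  by apply: leeD; [exact: ltW|rewrite norm2_nrm].
rewrite -!EFinM -!EFinD !lee_fin in n2 n3.
have n4 : nrm F <= d^-1 * nrm G by rewrite mulrC ler_pdivlMr// mulrC; exact: apriori.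
apply: le_trans n3 _.
apply: le_trans (lerD (lexx _) (le_trans n4 (ler_wpM2l (ltW dv) n2))) _.
suff -> : e / K + d^-1 * (e / K + (`|l| * (e / K) + b)) = d^-1 * b + e / K * K.
  by rewrite divfK// gt_eqF.
by rewrite /K; ring.
Qed.

(** Solve exactly for polynomials converging to [h]; [apriori] makes the solutions Cauchy, and their
    limit lies in the domain of the closure. *)
Lemma op_closure_solve l d h : 0 < d ->
  (forall nu, hopf_eigenvalue nu -> d <= `|nu - l|) -> L2 h ->
  exists f, op_closure subQ f (fun z => l * f z + h z).
Proof.
move=> d0 dE /[dup] lh /L2P[mh nh].
(* With this accuracy consecutive right-hand sides differ by at most d 2^(-n), so consecutive
   solutions differ by at most 2^(-n), the rate that [L2_complete] expects. *)
have step (n : nat) : exists qr : (HH -> R) * (HH -> R), [/\ smooth qr.1, smooth qr.2,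
    forall z, S7 z -> subQ_poly qr.2 z = l * qr.2 z + qr.1 z
    & (norm2 (qr.1 - h)%R < (d / 2 * 2^-1 ^+ n)%:E)%E].
  have e0 : 0 < d / 2 * 2^-1 ^+ n by rewrite mulr_gt0 ?divr_gt0// exprn_gt0// invr_gt0.
  have [q [pq hq]] := L2_dense e0 lh.
  have [r [sr rE _]] := poly_resolvent d0 dE (killed_spoly pq).
  by exists (q, r); split=> //; exact: smooth_spoly.
have [qr qrP] := choice step.
pose q n := (qr n).1; pose r n := (qr n).2.
have sq n : smooth (q n) by case: (qrP n).
have sr n : smooth (r n) by case: (qrP n).
have bq n := smooth_bm (sq n); have br n := smooth_bm (sr n).
have rE n z : S7 z -> subQ_poly (r n) z = l * r n z + q n z by case: (qrP n) => _ _ + _; exact.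
have hq n : (norm2 (q n - h)%R < (d / 2 * 2^-1 ^+ n)%:E)%E by case: (qrP n).
have mqh n : measurable_fun setT (q n - h) by apply: measurable_funB => //; case: (bq n).
have cq n : nrm (q n.+1 - q n) <= d * 2^-1 ^+ n.
  rewrite -lee_fin -norm2_nrm; last exact: bmB.
  have -> : q n.+1 - q n = (q n.+1 - h) + - (q n - h) by ring.
  apply: le_trans (norm2D (mqh _) (measurable_funN (mqh n))) _; rewrite norm2N.
  apply: le_trans (leeD (ltW (hq n.+1)) (ltW (hq n))) _.
  rewrite -EFinD lee_fin exprS.
  have : 0 <= 2^-1 ^+ n :> R by rewrite exprn_ge0.
  by move: (2^-1 ^+ n) (ltW d0) => a; clear => ? ?; nra.
have cr n : nrm (r n.+1 - r n) <= 2^-1 ^+ n.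
  rewrite -(ler_pM2l d0); apply: le_trans (cq n).
  have srr : smooth (r n.+1 - r n) by have := sr n => ?; have := sr n.+1 => ?; smooth_tac.
  apply: le_trans (apriori d0 dE srr) _; rewrite le_eqVlt; apply/orP; left; apply/eqP.
  apply: nrm_eq => z z1.
  have -> : r n.+1 - r n = r n.+1 + cst (-1) * r n by apply/funext => w; rewrite !fctE; ring.
  have := sr n => ?; have := sr n.+1 => ?.
  by rewrite subQ_polyD ?subQ_polyZ; [rewrite !fctE !rE//; ring|smooth_tac..].
have [f [lf hf]] := L2_complete br cr; have [mf nf] := (L2P f).1 lf.
exists f; split=> //; first by have := L2D (L2Z l lf) lh.
(* [K] dominates both error coefficients: 2 for [r n - f], and 2 |l| + d / 2 for the right-hand
   side. *)
move=> eps e0; pose K := 2 + 2 * `|l| + d.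
have K0 : 0 < K by rewrite ltr_wpDl// addr_ge0// mulr_ge0.
have [n hn] : exists n, K * 2^-1 ^+ n < eps.
  have cv : (fun n => K * 2^-1 ^+ n) @ \oo --> K * 0.
    by apply: cvgMr; apply: cvg_expr; rewrite ger0_norm// invf_lt1// ltr1n.
  by move: cv; rewrite mulr0 => /cvgr_lt /(_ _ e0)[n _ /(_ n (leqnn n)) hn]; exists n.
have p0 : 0 <= 2^-1 ^+ n :> R by rewrite exprn_ge0.
exists (r n); split=> //.
  apply: le_lt_trans (hf n) _; rewrite lte_fin; apply: le_lt_trans hn.
  apply: ler_wpM2r => //; rewrite /K; move: `|l| (normr_ge0 l) (ltW d0) => a; clear; lra.
have mrf : measurable_fun setT (r n - f) by apply: measurable_funB => //; case: (br n).
rewrite (norm2_eq (g := cst l * (r n - f) + (q n - h))); last first.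
  by move=> z z1; rewrite subQE// rE// !fctE; ring.
apply: le_lt_trans (norm2D (measurable_funM (measurable_cst _) mrf) (mqh n)) _.
rewrite norm2Z//; apply: (@le_lt_trans _ _ (`|l|%:E * (2 * 2^-1 ^+ n)%:E + (d / 2 * 2^-1 ^+ n)%:E)%E).
  by apply: leeD; [apply: lee_wpmul2l; [rewrite lee_fin|exact: hf]|exact: ltW].
rewrite -EFinM -EFinD lte_fin; apply: le_lt_trans hn.
have -> : `|l| * (2 * 2^-1 ^+ n) + d / 2 * 2^-1 ^+ n = (2 * `|l| + d / 2) * 2^-1 ^+ n by ring.
apply: ler_wpM2r => //; rewrite /K; move: `|l| (ltW d0) => a; clear; lra.
Qed.

Lemma spectrum_subQ l : spectrum (@subQ R) l <-> hopf_eigenvalue l.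
Proof.
split=> [sl|hl].
  apply: contrapT => /hopf_eigenvalue_gap[d d0 dE]; apply: sl; split.
    by move=> h lh; exact: op_closure_solve d0 dE lh.
  by exists d^-1 => f h lh; exact: op_closure_bound.
have [u [wu eu unp]] := zonal_eigenfunction hl; have su := smooth_wpoly wu.
apply: (eigenfunction_spectrum su _ unp) => z z1.
by rewrite subQE// eu.
Qed.

Lemma wpoly_spoly F : wpoly F -> spoly F.
Proof.
have [_ hx _] := @sqxE R; have [_ hy _] := @sqyE R.
elim=> [c|{}F _ ih|{}F _ ih|{}F _ ih|{}F G _ ih _ ih'].
- exact: spoly_cst.
- by apply: spolyM => //; exact: spoly_dot.
- by apply: spolyM => //; exact: spoly_hpoly hx.
- by apply: spolyM => //; exact: spoly_hpoly hy.
- exact: spolyD.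
Qed.

Lemma wpolyX F n : wpoly F -> wpoly (F ^+ n).
Proof.
by move=> wF; elim: n => [|n ih]; [exact: (wpoly_cst 1)|rewrite exprS; exact: wpolyM].
Qed.

Lemma wpoly_peak : wpoly (peak : HH -> R).
Proof.
apply: wpolyD; [exact: wpoly_cst|apply: wpolyZ].
by rewrite -[re_x]mulr1; exact: wpoly_re_x (wpoly_cst 1).
Qed.

(* [subT] and [subQ] agree on [wpoly], so [phi] is orthogonal to every
   eigencomponent of [F] whose eigenvalue differs from [l]. *)
Lemma orth_wpoly l phi F : ~ hopf_eigenvalue l -> smooth_ker subT l phi ->
  killed F -> wpoly F -> sint (phi * F) = 0.
Proof.
move=> nl [sphi ephi]; elim=> [_|mu {}F muE sF _ ih wF].
  by rewrite mulr0 sint0.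
have [wQ _ eTQ _] := wpoly_subQ wF.
have h : sint (phi * (subQ_poly F - cst mu * F)) = 0.
  by apply: ih; apply: wpolyD => //; exact/wpolyN/wpolyZ.
have hT : sint (phi * subQ_poly F) = l * sint (phi * F).
  have -> : sint (phi * subQ_poly F) = sint (phi * subT_poly F).
    by apply: sint_eq => z z1; rewrite !fctE eTQ.
  rewrite -subT_sym// -sintZM//; apply: sint_eq => z z1.
  by rewrite !fctE -subTE ephi.
have hQ : (l - mu) * sint (phi * F) = 0.
  have e : phi * (subQ_poly F - cst mu * F) = phi * subQ_poly F + - (cst mu * phi * F) by ring.
  have b1 : bm (phi * subQ_poly F) by apply: smooth_bm; smooth_tac.
  have b2 : bm (cst mu * phi * F) by apply: smooth_bm; smooth_tac.
  move: h; rewrite e sintD//; last exact: bmN.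
  by rewrite sintN// hT sintZM// mulrBl.
apply/eqP; move/eqP: hQ; rewrite mulf_eq0 subr_eq0 => /orP[/eqP lm|//].
by case: nl; rewrite lm.
Qed.

Lemma detected_hopf l phi : smooth_ker subT l phi -> phi np != 0 -> hopf_eigenvalue l.
Proof.
move=> kphi phinp; apply: contrapT => nl.
have [N] := peak_detects kphi.1 phinp; have wN := wpolyX N wpoly_peak.
by rewrite (orth_wpoly nl kphi (killed_spoly (wpoly_spoly wN)) wN) eqxx.
Qed.

Lemma hopf_detected l : hopf_eigenvalue l ->
  exists phi, smooth_ker (@subT R) l phi /\ phi np != 0.
Proof.
move=> hl; have [u [wu eu unp]] := zonal_eigenfunction hl.
exists u; split=> //; split; first exact: smooth_wpoly.
move=> z z1; have [_ _ e _] := wpoly_subQ wu.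
by rewrite subTE e// eu.
Qed.

End Spectra.

Theorem theorem9p2 (R : realType) :
  let Lambda := [set l : R | spectrum (@subT R) l /\
                   exists phi : H2 R -> R, smooth_ker subT l phi /\ phi np != 0] in
  Lambda = spectrum (@subQ R) /\ spectrum (@subQ R) `<=` spectrum (@subT R).
Proof.
move=> Lambda; have sub l : spectrum (@subQ R) l -> Lambda l.
  move=> /spectrum_subQ/hopf_detected[phi [kphi phinp]]; split; last by exists phi.
  exact: (eigenfunction_spectrum kphi.1 kphi.2 phinp).
split; last by move=> l /sub[].
apply/seteqP; split=> // l [_ [phi [kphi phinp]]].
exact/spectrum_subQ/(detected_hopf kphi phinp).
Qed.
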